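(* Suppose $A\in K(H)^+$ has infinite rank and infinite dimensional kernel, i.e. $\operatorname{Tr}R_A=\infty=\operatorname{Tr}R_A^\perp$. Then $E(\mathcal{U}(A))$ is the disjoint union \[ E(\mathcal{U}(A))=E(\mathcal{U}(A))_{fk}\sqcup E(\mathcal{U}(A))_{ik}, \] where $E(\mathcal{U}(A))_{fk}$ and $E(\mathcal{U}(A))_{ik}$, the sets of members of $E(\mathcal{U}(A))$ with finite dimensional kernel and with infinite dimensional kernel respectively, are characterized by \[ E(\mathcal{U}(A))_{fk}=\{B\in\mathcal{D}\cap K(H)^+\mid s(B)\prec_\infty s(A)\ \text{and}\ \operatorname{Tr}R_B^\perp<\infty\} \] and \[ E(\mathcal{U}(A))_{ik}=\{B\in\mathcal{D}\cap K(H)^+\mid s(B)\prec s(A)\ \text{and}\ \operatorname{Tr}R_B^\perp=\infty\}. \]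
   Context: $H$ is a complex separable infinite dimensional Hilbert space with a fixed orthonormal basis $\{e_n\}$. $K(H)^+$ is the set of positive (i.e. positive semidefinite) compact operators on $H$. $\mathcal{D}\subseteq B(H)$ is the algebra of operators that are diagonal with respect to $\{e_n\}$. $E:B(H)\to\mathcal{D}$ is the canonical conditional expectation: $E(X)$ is the diagonal operator with $\langle E(X)e_n,e_n\rangle=\langle Xe_n,e_n\rangle$ for all $n$. $\mathcal{U}(A)=\{UAU^*\mid U\in B(H)\text{ unitary}\}$ is the unitary orbit of $A$, and $E(\mathcal{U}(A))=\{E(X)\mid X\in\mathcal{U}(A)\}$. For self-adjoint $A$, $R_A$ is the orthogonal projection onto $\overline{\operatorname{ran}A}$ and $R_A^\perp=I-R_A$ is the projection onto $\ker A$, so $\operatorname{Tr}R_A=\operatorname{rank}A$ and $\operatorname{Tr}R_A^\perp=\dim\ker A$. For $A\in K(H)^+$, $s(A)=(s_j(A))_{j\ge1}$ is the nonincreasing sequence of singular values of $A$: the nonzero eigenvalues listed in decreasing order with multiplicity, followed by zeros if $A$ has finite rank (and having no zeros if $A$ has infinite rank). For nonnegative nonincreasing sequences $\xi,\eta$ converging to $0$: - Majorization $\xi\prec\eta$ means $\sum_{j=1}^n\xi_j\le\sum_{j=1}^n\eta_j$ for all $n\in\mathbb{N}$ and $\sum_{j=1}^\infty\xi_j=\sum_{j=1}^\infty\eta_j$ (both sums possibly $\infty$). - For an integer $0\le p<\infty$, $p$-majorization $\xi\prec_p\eta$ means $\xi\prec\eta$ and there exists $N_p\in\mathbb{N}$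 such that $\sum_{k=1}^{n+p}\xi_k\le\sum_{k=1}^n\eta_k$ for all $n\ge N_p$. - $\infty$-majorization $\xi\prec_\infty\eta$ means $\xi\prec_p\eta$ for all $p\in\mathbb{N}$. *)

(* Defs.v *)
From HB Require Import structures.
From mathcomp Require Import all_boot all_order all_algebra.
From mathcomp Require Export complex.
From mathcomp Require Import all_classical all_reals all_analysis.
Import Order.TTheory GRing.Theory Num.Theory.
Import numFieldNormedType.Exports.

Set Implicit Arguments.
Unset Strict Implicit.
Unset Printing Implicit Defensive.

Local Open Scope classical_set_scope.
Local Open Scope ring_scope.
Local Open Scope complex_scope.

Section Majorization.
Context {R : realType}.
Implicit Types x y : R^nat.

(* Sequences are indexed from 0, so the first n terms are x 0, ..., x n.-1. *)
Definition majorized x y : Prop :=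
  (forall n, \sum_(j < n) x j <= \sum_(j < n) y j) /\
  (\sum_(0 <= j <oo) (x j)%:E = \sum_(0 <= j <oo) (y j)%:E)%E.

Definition p_majorized (p : nat) x y : Prop :=
  majorized x y /\
  exists N, forall n, (N <= n)%N ->
    \sum_(k < n + p) x k <= \sum_(k < n) y k.

Definition oo_majorized x y : Prop := forall p, p_majorized p x y.

End Majorization.

Section HilbertSpace.
Context {R : realType} {H : completeNormedModType R[i]}.

(* An inner product (linear on the left, antilinear on the right) inducing the
   norm of H; norms of H are nonnegative elements of R[i]. *)
Definition hilbert_dot (dot : {dot H for Num.conj}) : Prop :=
  forall x, `|x| ^+ 2 = dot x x.

Variable dot : {dot H for Num.conj}.

Definition orthonormal_basis (e : nat -> H) : Prop :=
  (forall m n, dot (e m) (e n) = (m == n)%:R) /\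
  (forall x, (\sum_(k < n) dot x (e k) *: e k) @[n --> \oo] --> x).

(* For V a linear subspace. *)
Definition has_dim (V : set H) (n : nat) : Prop :=
  exists b : 'I_n -> H, (forall i, V (b i)) /\
    forall x, V x -> exists! c : 'I_n -> R[i], x = \sum_i c i *: b i.

Definition finite_dim (V : set H) : Prop := exists n, has_dim V n.

(* Operators are functions H -> H lying in B(H). *)
Definition BH : set (H -> H) := [set T | linear T /\ continuous T].

Definition compact_operators : set (H -> H) :=
  [set T | BH T /\ compact (closure (T @` [set x | `|x| <= 1]))].

(* In R[i], 0 <= z means that z is real and nonnegative; since the scalars are
   complex, self-adjointness follows. *)
Definition positive_operators : set (H -> H) :=
  [set T | BH T /\ forall x, 0 <= dot (T x) x].

Definition Kplus : set (H -> H) := compact_operators `&` positive_operators.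

Definition kernel (T : H -> H) : set H := [set x | T x = 0].

Definition op_eigenspace (T : H -> H) (l : R) : set H :=
  [set x | T x = l%:C *: x].

(* Counting every l > 0 as often as the dimension of its eigenspace leaves
   infinitely many positive terms when T has infinite rank (hence no zeros, s
   being nonincreasing), and finitely many, followed by zeros, otherwise. *)
Definition is_singular_seq (T : H -> H) (s : R^nat) : Prop :=
  [/\ nonincreasing_seq s,
      forall j, 0 <= s j &
      forall l : R, 0 < l ->
        exists2 n, has_dim (op_eigenspace T l) n &
          ([set j | s j = l] #= `I_n)%card].

(* Meaningful for T in Kplus, where is_singular_seq T has exactly one
   solution. *)
Definition singular_seq (T : H -> H) : R^nat :=
  xget (fun=> 0) (is_singular_seq T).

(* For V a closed linear subspace: the orthogonal projection onto V. *)
Definition is_orth_proj (V : set H) (P : H -> H) : Prop :=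
  forall x, V (P x) /\ forall y, V y -> dot (x - P x) y = 0.

Definition orth_proj (V : set H) : H -> H := xget (fun=> 0) (is_orth_proj V).

Definition range_proj (T : H -> H) : H -> H := orth_proj (closure (range T)).

Definition range_proj_perp (T : H -> H) : H -> H :=
  fun x => x - range_proj T x.

Definition adjoint_of (T S : H -> H) : Prop :=
  forall x y, dot (T x) y = dot x (S y).

(* U is unitary, with adjoint S. *)
Definition unitary_with_adjoint (U S : H -> H) : Prop :=
  [/\ BH U, BH S, adjoint_of U S, U \o S = id & S \o U = id].

Definition unitary_orbit (A : H -> H) : set (H -> H) :=
  [set X | exists U S, unitary_with_adjoint U S /\ X = U \o A \o S].

Variable e : nat -> H.

(* For positive T, so that the series has nonnegative terms. *)
Definition trace (T : H -> H) : \bar R :=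
  (\sum_(0 <= n <oo) (complex.Re (dot (T (e n)) (e n)))%:E)%E.

Definition diagonal_operators : set (H -> H) :=
  [set T | BH T /\ forall n, exists c : R[i], T (e n) = c *: e n].

(* For X in B(H), exactly one diagonal operator has the diagonal of X. *)
Definition cond_exp (X : H -> H) : H -> H :=
  xget (fun=> 0) [set Y | diagonal_operators Y /\
    forall n, dot (Y (e n)) (e n) = dot (X (e n)) (e n)].

Definition EU (A : H -> H) : set (H -> H) := cond_exp @` unitary_orbit A.

Definition EU_fk (A : H -> H) : set (H -> H) :=
  [set B | EU A B /\ finite_dim (kernel B)].

Definition EU_ik (A : H -> H) : set (H -> H) :=
  [set B | EU A B /\ ~ finite_dim (kernel B)].

End HilbertSpace.

(* Main.v *)
(* By the spectral theorem A is diagonal, with eigenvalues lam_j, in a basis g, and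
   E(U(A)) consists of the diagonals b_n = <A h_n, h_n> of A in the orthonormal bases
   h, placed along e.

   Necessity: b_n = sum_j lam_j |<h_n, g_j>|^2 is an average of the lam_j with doubly
   stochastic weights, whence majorization. If b has finitely many zeros, take many
   kernel vectors g_j: each has total mass 1, and the rows with b_n = 0 carry only a
   bounded part of it, so finitely many rows with b_n > 0 already carry mass p. For
   large n the n + p largest b's therefore put a mass of at most n on the positive
   eigenvalues, which gives p-majorization for every p.

   Sufficiency: the required vectors are found one at a time. To realize xi_k, a
   largest remaining weight w_a >= xi_k is paired with some w_b <= xi_k: a rotation in
   the plane of the two corresponding vectors produces a unit vector with diagonal
   entry xi_k and an orthogonal residual vector of weight w_a + w_b - xi_k, to which
   A is again diagonally compressed. Choosing w_b negligible as often as domination of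
   the remaining xi's allows forces the largest remaining weight to tend to 0, so that
   the vectors obtained leave out only kernel vectors; under oo-majorization (the only
   case where kernel vectors enter the process) each of those is used up too. *)

Require Import Defs.
From mathcomp Require Import all_boot all_order all_algebra.
From mathcomp Require Import finmap.
From mathcomp Require Import all_classical all_reals all_analysis.
From mathcomp Require Import ring lra zify.
Import Order.TTheory GRing.Theory Num.Theory.
Import numFieldNormedType.Exports.

Set Implicit Arguments.
Unset Strict Implicit.
Unset Printing Implicit Defensive.

Local Open Scope classical_set_scope.
Local Open Scope ring_scope.
Local Open Scope complex_scope.

(** * Domination of finite sums *)

Section Pairing.
Context {R : realType}.
Implicit Types (w xi : nat -> R) (al : pred nat) (J : {fset nat}) (V : R).

(** If the trace of [A] is finite, equality of the two sums already makes the active weights vanish: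
    after [k] steps their total is at most the tail of the [xi]. If it is infinite, the equality
    reads oo = oo and says nothing; some weight might then never decay and a vector outside the
    kernel be missed. A step with room takes [xi k] off the large weights up to an error [e k];
    since the sum of [xi] diverges and that of [e] converges, this cannot go on while a large weight
    survives. A step where room fails certifies instead that at some later stage all active weights
    are at most [2 * xi k]. Completeness follows because, on the complement of the chosen vectors,
    the form of [A] is bounded by the largest active weight. Kernel vectors can be spent only in
    steps with room, as the other steps retire a positive weight. A step may cost one surplus target
    of domination; only a surplus of every finite size survives all steps and makes room recur,
    whence oo-majorization. The residuals disturb any ordering of the weights, so domination is
    expressed by finite index sets. *)

Definition upd w (a : nat) (x : R) : nat -> R := fun j => if j == a then x else w j.
Definition kill al (b : nat) : pred nat := fun j => al j && (j != b).

Lemma sum_upd_in w a x J : a \in J ->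
  \sum_(j <- J) upd w a x j = \sum_(j <- J) w j - w a + x.
Proof.
move=> aJ; rewrite !(big_fsetD1 a aJ) /= /upd eqxx.
have -> : \sum_(j <- (J `\ a)%fset) (if j == a then x else w j) =
          \sum_(j <- (J `\ a)%fset) w j.
  by apply: eq_fbigr => j; rewrite !inE => /andP[/negPf -> _].
by lra.
Qed.

Lemma sum_upd_notin w a x J : a \notin J ->
  \sum_(j <- J) upd w a x j = \sum_(j <- J) w j.
Proof.
move=> aJ; apply: eq_fbigr => j jJ _; rewrite /upd.
by case: eqP => // ja; move: aJ; rewrite -ja jJ.
Qed.

Lemma sum_const_le (c : R) (F : nat -> R) J :
  {in J, forall j, c <= F j} -> c *+ #|`J| <= \sum_(j <- J) F j.
Proof.
move=> H; rewrite -sum1_size -sumrMnr.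
by rewrite !big_seq; apply: ler_sum => j jJ; rewrite mulr1n; exact: H.
Qed.

(* A sorting-free form of V <= w_0 + ... + w_(n-1) for nonincreasing w; al
   tells which indices are still active. *)
Definition fits al w n V : Prop := exists J,
  [/\ {in J, forall j, al j}, (#|`J| <= n)%N & V <= \sum_(j <- J) w j].

Lemma fits_le al w m n V W : (m <= n)%N -> W <= V -> fits al w m V -> fits al w n W.
Proof.
by move=> mn WV [J [Ja Jm VJ]]; exists J; split=> //; [exact: leq_trans mn|exact: le_trans VJ].
Qed.

Section Step.
Variables (al : pred nat) (w : nat -> R) (a b : nat) (x : R).
Hypotheses (w0 : forall j, 0 <= w j) (ala : al a) (alb : al b) (ab : a != b).
Hypotheses (wb : w b <= x) (wa : x <= w a).
Let w' := upd w a (w a + w b - x).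
Let al' := kill al b.

Let ba : b != a. Proof. by rewrite eq_sym. Qed.

(** Deleting [b] costs [w b <= x] when [a] lies outside [J]; when [a] lies in [J], the residual at
    [a] absorbs [w b] and the sum drops by exactly [x]. *)
Lemma fits_step_with J n V : {in J, forall j, al j} -> (#|`J| <= n.+1)%N ->
  V <= \sum_(j <- J) w j -> b \in J -> fits al' w' n (V - x).
Proof.
move=> Ja Jn VJ bJ; exists (J `\ b)%fset; split.
- by move=> j; rewrite !inE /al' /kill => /andP[-> /Ja ->].
- by move: Jn; rewrite (cardfsD1 b) bJ.
  have E : \sum_(j <- J) w j = w b + \sum_(j <- (J `\ b)%fset) w j by rewrite (big_fsetD1 b bJ).
  have [aJ|aJ] := boolP (a \in (J `\ b)%fset).
    by rewrite sum_upd_in //; lra.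
  by rewrite sum_upd_notin //; move: wb VJ E; lra.
Qed.

(** For an arbitrary [b] the length need not shrink: a set without [b] is kept, and its sum falls by
    at most [x] because [w b] is nonnegative. Surplus domination is passed on in this form. *)
Lemma fits_step_same n V : fits al w n V -> fits al' w' n (V - x).
Proof.
move=> [J [Ja Jn VJ]]; have [bJ|bJ] := boolP (b \in J).
  by apply: (fits_step_with Ja (leqW Jn) VJ bJ).
exists J; split=> //.
  move=> j jJ; rewrite /al' /kill Ja //=; apply: contraNneq bJ => <-; exact: jJ.
have wb0 := w0 b; have [aJ|aJ] := boolP (a \in J).
  by rewrite sum_upd_in //; lra.
by rewrite sum_upd_notin //; move: wb wb0; lra.
Qed.

(** The length shrinks once the set contains [b], and a member other than [a] of weight at most [x]
    can be exchanged for [b], which is at least as heavy. The second alternative is the obstruction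
    to this; it is harmless, since [n] weights above [x] dominate any [n] later targets, these being
    at most [x]. *)
Lemma fits_step_max n V :
  (forall j, al j -> j != a -> w j <= x -> w j <= w b) ->
  fits al w n.+1 V -> fits al' w' n (V - x) \/
  exists J, [/\ {in J, forall j, al' j && (x < w j)}, a \notin J & #|`J| = n].
Proof.
move=> bmax [J [Ja Jn VJ]]; have [bJ|bJ] := boolP (b \in J).
  by left; apply: (fits_step_with Ja Jn VJ bJ).
have [[c [cJ ca wc]]|Hc] := pselect (exists c, [/\ c \in J, c != a & w c <= x]).
  left; apply: (@fits_step_with (b |` (J `\ c))%fset) => //.
  - by move=> j; rewrite !inE => /orP[/eqP -> //|/andP[_ /Ja]].
  - move: Jn; rewrite cardfsU1 !inE (negPf bJ) andbF /=.
    by rewrite (cardfsD1 c) cJ.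
  - rewrite big_fsetU1 /=; last by rewrite !inE (negPf bJ) andbF.
    apply: le_trans VJ _; rewrite (big_fsetD1 c cJ) /= lerD2r.
    by apply: bmax => //; exact: Ja.
  - by rewrite !inE eqxx.
have big j : j \in J -> j != a -> x < w j.
  by move=> jJ ja; rewrite ltNge; apply/negP => wj; apply: Hc; exists j.
have bigJ : {in (J `\ a)%fset, forall j, al' j && (x < w j)}.
  move=> j; rewrite !inE => /andP[ja jJ]; rewrite big // /al' /kill Ja //=.
  by rewrite andbT; apply: contraNneq bJ => <-.
have [aJ|aJ] := boolP (a \in J).
  have [Jn'|Jn'] := leqP #|`J| n.
    left; apply: (@fits_step_with (b |` J)%fset) => //.
    - by move=> j; rewrite !inE => /orP[/eqP -> //|/Ja].
    - by rewrite cardfsU1 (negPf bJ).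
    - rewrite big_fsetU1 //=; apply: le_trans VJ _; rewrite lerDr; exact: w0.
    - by rewrite !inE eqxx.
  right; exists (J `\ a)%fset; split=> //; first by rewrite !inE eqxx.
  by apply/eqP; rewrite -eqSS -add1n; move: (cardfsD1 a J); rewrite aJ /= => <-; rewrite eqn_leq Jn.
have [Jn'|Jn'] := leqP #|`J| n.
  by left; apply: fits_step_same; exists J.
have [J0|[c cJ]] := fset_0Vmem J; first by move: Jn'; rewrite J0 cardfs0.
right; exists (J `\ c)%fset; split.
- move=> j; rewrite !inE => /andP[_ jJ]; apply: bigJ; rewrite !inE jJ andbT.
  by apply: contraNneq aJ => <-.
- by rewrite !inE (negPf aJ) andbF.
- apply/eqP; rewrite -eqSS -add1n; move: (cardfsD1 c J); rewrite cJ /= => <-.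
  by rewrite eqn_leq Jn.
Qed.

(** A set for the new weights is enlarged by [b] if it contains [a], and by [a] otherwise; the old
    sum of the enlarged set exceeds the new sum by at least [x]. *)
Lemma fits_step_bound n V :
  (forall J, {in J, forall j, al j} -> (#|`J| <= n.+1)%N -> \sum_(j <- J) w j <= V) ->
  forall J, {in J, forall j, al' j} -> (#|`J| <= n)%N -> \sum_(j <- J) w' j <= V - x.
Proof.
move=> H J Ja Jn; have bJ : b \notin J.
  by apply/negP => /Ja; rewrite /al' /kill eqxx andbF.
have Jal j : j \in J -> al j by move=> /Ja /andP[].
have [aJ|aJ] := boolP (a \in J).
  have := H (b |` J)%fset; rewrite big_fsetU1 //= sum_upd_in // cardfsU1 bJ => /(_ _ Jn) H'.
  have : w b + \sum_(j <- J) w j <= V.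
    by apply: H' => j; rewrite !inE => /orP[/eqP ->|/Jal].
  by lra.
have := H (a |` J)%fset; rewrite big_fsetU1 //= sum_upd_notin // cardfsU1 aJ => /(_ _ Jn) H'.
have : w a + \sum_(j <- J) w j <= V.
  by apply: H' => j; rewrite !inE => /orP[/eqP ->|/Jal].
by move: wa; lra.
Qed.

End Step.
End Pairing.

(** * The greedy pairing *)

Definition vanishes {R : realType} (v : nat -> R) : Prop :=
  forall eps, 0 < eps -> exists N, forall j, (N <= j)%N -> v j < eps.

Lemma exists_max {R : realType} (w : nat -> R) (P : pred nat) :
  (forall j, 0 <= w j) -> vanishes w -> (exists j, P j) ->
  exists2 j, P j & forall i, P i -> w i <= w j.
Proof.
move=> w0 wv [j0 Pj0].
have [[j1 /andP[Pj1 wj1]]|H] := pselect (exists j, P j && (0 < w j)); last first.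
  exists j0 => // i Pi; apply: le_trans (w0 j0); rewrite leNgt; apply/negP => wi.
  by apply: H; exists i; rewrite Pi.
have [N HN] := wv _ wj1; pose M := (maxn N j1.+1).
have j1M : (j1 < M)%N by rewrite leq_max ltnSn orbT.
have [i Pi Hi] := @Order.TotalTheory.arg_maxP _ _ 'I_M (Ordinal j1M)
  (fun i => P i) (fun i => w i) Pj1.
exists (val i) => // k Pk; have [kM|Mk] := ltnP k M; first exact: (Hi (Ordinal kM)).
apply: le_trans (Hi (Ordinal j1M) Pj1) => /=; apply/ltW/HN.
by apply: leq_trans Mk; rewrite leq_max leqnn.
Qed.

Section Greedy.
Context {R : realType}.
Variables (v xi e : nat -> R).
Implicit Types (w : nat -> R) (al : pred nat) (J : {fset nat}) (V : R).

Definition tail_sum k n := \sum_(i < n) xi (k + i)%N.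

Lemma tail_sumS k n : tail_sum k n.+1 = xi k + tail_sum k.+1 n.
Proof.
rewrite /tail_sum big_ord_recl addn0; congr (_ + _).
by apply: eq_bigr => i _; rewrite /bump /= addnS.
Qed.

Lemma tail_sumB k n : tail_sum k n.+1 - xi k = tail_sum k.+1 n.
Proof. by rewrite tail_sumS addrAC subrr add0r. Qed.

Definition dominates k al w := forall n, fits al w n (tail_sum k n).

(* There is room when the remaining weights still dominate although the step
   reduces only w_a and absorbs no second weight: then any small w_b can be paired
   with w_a. *)
Definition room k al w a := forall n, fits al (upd w a (w a - xi k)) n (tail_sum k.+1 n).

(* The target xi_k is split off the pair (a, b): the residual w_a + w_b - xi_k
   stays at a, and b is retired. Here a is a largest active weight. With room, b is
   a negligible weight of least index, so that the total of the large weights drops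
   by almost xi_k and every zero weight is eventually used; otherwise b is a largest
   weight below xi_k, which always preserves domination. *)
Definition greedy k al w a b : Prop :=
  [/\ [/\ al a, al b & a != b], forall j, al j -> w j <= w a, w b <= xi k, xi k <= w a &
   [/\ room k al w a, xi k < w a, w b <= e k &
       forall j, al j -> j != a -> w j <= e k -> (b <= j)%N]
   \/ [/\ ~ (room k al w a /\ xi k < w a), 0 < w b &
       forall j, al j -> j != a -> w j <= xi k -> w j <= w b]].

Hypotheses (v0 : forall j, 0 <= v j) (vv : vanishes v).
Hypothesis vpos : forall N, exists2 j, (N <= j)%N & 0 < v j.
Hypotheses (xi0 : forall k, 0 < xi k) (xiN : forall k l, (k <= l)%N -> xi l <= xi k).
Hypotheses (xiv : vanishes xi).
Hypotheses (e0 : forall k, 0 < e k) (exi : forall k, e k <= xi k).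

(** The last clause says that only finitely many indices have been touched, so that the infinitely
    many positive terms of [v] keep supplying small positive partners. *)
Definition greedy_inv k (s : pred nat * (nat -> R)) : Prop :=
  [/\ forall j, 0 <= s.2 j, forall j, 0 < v j -> 0 < s.2 j, forall j, s.2 j <= v j,
      dominates k s.1 s.2 &
      exists N, forall j, (N <= j)%N -> s.1 j /\ s.2 j = v j].

Lemma tail_sum_le k n : tail_sum k.+1 n <= xi k *+ n.
Proof.
elim: n k => [|n IH] k; first by rewrite /tail_sum big_ord0.
rewrite tail_sumS mulrS; apply: lerD; first exact: xiN.
by apply: le_trans (IH _) _; apply: ler_wMn2r; exact: xiN.
Qed.

Lemma tail_sum_ge0 k n : 0 <= tail_sum k n.
Proof. by apply: sumr_ge0 => i _; exact: ltW. Qed.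

Lemma vanishes_le w : (forall j, w j <= v j) -> vanishes w.
Proof.
by move=> wv eps /vv[N HN]; exists N => j /HN; apply: le_lt_trans.
Qed.

Lemma greedy_exists k s : greedy_inv k s -> exists ab, greedy k s.1 s.2 ab.1 ab.2.
Proof.
case: s => al w [/= w0 wp wv dom [N HN]].
have wvan := vanishes_le wv.
have [a ala amax] : exists2 j, al j & forall i, al i -> w i <= w j.
  by apply: exists_max => //; exists N; have [] := HN N (leqnn _).
(* Domination at length 1: a single active weight reaches [xi k]. *)
have wa : xi k <= w a.
  have [J [Ja J1]] := dom 1%N; rewrite tail_sumS /tail_sum big_ord0 addr0 => H.
  apply: le_trans H _; have [->|[c cJ]] := fset_0Vmem J.
    by rewrite big_seq_fset0.
  have -> : J = [fset c]%fset.
    apply/eqP; rewrite eq_sym eqEfcard fsub1set cJ cardfs1; exact: J1.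
  rewrite big_seq_fset1; exact: amax (Ja _ cJ).
have [[rm xa]|nrm] := pselect (room k al w a /\ xi k < w a).
  have [N2 /(_ _ (leq_maxr (maxn N a.+1) N2))/ltW wj] := vv (e0 k).
  have Hj := leq_maxl (maxn N a.+1) N2; set j := maxn _ N2 in wj Hj.
  have Pj : [&& al j, j != a & w j <= e k].
    move: Hj; rewrite geq_max => /andP[/HN[-> ->] aj]; rewrite wj andbT /=.
    by rewrite neq_ltn aj orbT.
    have exP : exists j, [&& al j, j != a & w j <= e k] by exists j.
  case: (ex_minnP exP) => b /and3P[alb ba wb] bmin; exists (a, b); split=> //=.
  - by rewrite eq_sym.
  - exact: le_trans (exi k).
  - by left; split=> // i ali ia wi; apply: bmin; rewrite ali ia.
(* An untouched index with weight in the interval from 0 (excluded) to [xi k] shows that the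
   heaviest admissible partner is positive. *)
have [N2 HN2] := vv (xi0 k).
have [j] := vpos (maxn (maxn N a.+1) N2).
rewrite !geq_max => /andP[/andP[/HN[alj wj] aj] /HN2 /ltW vj] vj0.
have Pj : [&& al j, j != a & w j <= xi k] by rewrite alj wj vj neq_ltn aj orbT.
have [b /and3P[alb ba wb] bmax] :
    exists2 j, [&& al j, j != a & w j <= xi k] &
      forall i, [&& al i, i != a & w i <= xi k] -> w i <= w j.
  by apply: (@exists_max _ _ (fun j => [&& al j, j != a & w j <= xi k])) => //; exists j.
exists (a, b); split=> //=; first by rewrite eq_sym.
right; split=> //; first by apply: lt_le_trans (bmax _ Pj); rewrite wj.
by move=> i ali ia wi; apply: bmax; rewrite ali ia.
Qed.

Definition greedy_next k (s : pred nat * (nat -> R)) (ab : nat * nat) :=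
  (kill s.1 ab.2, upd s.2 ab.1 (s.2 ab.1 + s.2 ab.2 - xi k)).

Lemma greedy_dominates k al w a b : (forall j, 0 <= w j) -> dominates k al w ->
  greedy k al w a b -> dominates k.+1 (kill al b) (upd w a (w a + w b - xi k)).
Proof.
move=> w0 dom [[ala alb ab] amax wb wa [[rm xa wbe bmin]|[nrm wb0 bmax]]] n.
  have [J [Ja Jn HJ]] := rm n.
  (* If the set witnessing room contains [b], its loss is made up by [a]: either [a] is present and
     absorbs [w b], or it replaces [b] with a residual of at least [w b]. *)
  have [bJ|bJ] := boolP (b \in J).
    have EJ : \sum_(j <- J) upd w a (w a - xi k) j =
        w b + \sum_(j <- (J `\ b)%fset) upd w a (w a - xi k) j.
      by rewrite (big_fsetD1 b bJ) /= {1}/upd eq_sym (negPf ab).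
    rewrite EJ in HJ.
    have Jb1 : #|`J| = #|` J `\ b|%fset.+1 by rewrite (cardfsD1 b) bJ.
    have [aJ|aJ] := boolP (a \in (J `\ b)%fset).
      exists (J `\ b)%fset; split.
      - by move=> j; rewrite !inE /kill => /andP[-> /Ja ->].
      - by apply: leq_trans Jn; rewrite Jb1.
      - by move: HJ; rewrite !sum_upd_in //; lra.
    exists (a |` (J `\ b))%fset; split.
    - move=> j; rewrite !inE /kill => /orP[/eqP ->|/andP[-> /Ja ->]] //.
      by rewrite ala ab.
    - by apply: leq_trans Jn; rewrite cardfsU1 aJ Jb1.
    - rewrite big_fsetU1 //= sum_upd_notin // /upd eqxx.
      by move: HJ; rewrite sum_upd_notin //; lra.
  exists J; split=> //.
    by move=> j jJ; rewrite /kill Ja //=; apply: contraNneq bJ => <-.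
  have wb0 := w0 b; have [aJ|aJ] := boolP (a \in J).
    by move: HJ; rewrite !sum_upd_in //; lra.
  by move: HJ; rewrite !sum_upd_notin //; lra.
have := fits_step_max w0 alb wb bmax (dom n.+1).
rewrite tail_sumB => -[//|[J [HJ aJ Jn]]].
exists J; split; first by move=> j /HJ /andP[].
  by rewrite Jn.
rewrite sum_upd_notin //; apply: le_trans (tail_sum_le _ _) _.
by rewrite -Jn; apply: sum_const_le => j /HJ /andP[_ /ltW].
Qed.

Lemma greedy_inv_next k s ab : greedy_inv k s -> greedy k s.1 s.2 ab.1 ab.2 ->
  greedy_inv k.+1 (greedy_next k s ab).
Proof.
case: s ab => al w [a b] [/= w0 wp wv dom [N HN]] G.
have [[ala alb ab] amax wb wa C] := G.
have wd : 0 <= w a + w b - xi k by have := w0 b; lra.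
split=> //=.
- by move=> j; rewrite /upd; case: eqP.
- move=> j vj; rewrite /upd; case: eqP => _; last exact: wp.
  by have := w0 b; case: C => [[_ xa _ _]|[_ wb0 _]]; lra.
- move=> j; rewrite /upd; case: eqP => [->|_]; last exact: wv.
  by apply: le_trans (wv a); lra.
- exact: greedy_dominates.
- exists (maxn N (maxn a.+1 b.+1)) => j; rewrite !geq_max => /and3P[/HN[alj wj] aj bj].
  by rewrite /kill /upd alj wj !(gtn_eqF _) //= gtn_eqF.
Qed.

Hypothesis dom0 : dominates 0 xpredT v.

Definition greedy_choice k (s : pred nat * (nat -> R)) : nat * nat :=
  xget (0%N, 0%N) [set ab | greedy k s.1 s.2 ab.1 ab.2].

Fixpoint greedy_state k : pred nat * (nat -> R) :=
  if k is m.+1 then greedy_next m (greedy_state m) (greedy_choice m (greedy_state m))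
  else (xpredT, v).

Lemma greedy_choiceP k s : greedy_inv k s ->
  greedy k s.1 s.2 (greedy_choice k s).1 (greedy_choice k s).2.
Proof.
move=> /greedy_exists[ab Hab].
by apply: (@xgetPex _ _ [set ab | greedy k s.1 s.2 ab.1 ab.2]); exists ab.
Qed.

Lemma greedy_stateP k : greedy_inv k (greedy_state k).
Proof.
elim: k => [|k IH] /=; last by apply: greedy_inv_next => //; exact: greedy_choiceP.
by split=> //=; exists 0%N.
Qed.

Let al k := (greedy_state k).1.
Let w k := (greedy_state k).2.
Let a k := (greedy_choice k (greedy_state k)).1.
Let b k := (greedy_choice k (greedy_state k)).2.

Let greedyP k : greedy k (al k) (w k) (a k) (b k).
Proof. exact: greedy_choiceP (greedy_stateP k). Qed.
Let alS k : al k.+1 = kill (al k) (b k). Proof. by []. Qed.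
Let wS k : w k.+1 = upd (w k) (a k) (w k (a k) + w k (b k) - xi k). Proof. by []. Qed.
Let w_ge0 k j : 0 <= w k j. Proof. by have [H _ _ _ _] := greedy_stateP k; exact: H. Qed.
Let w_le k j : w k j <= v j. Proof. by have [_ _ H _ _] := greedy_stateP k; exact: H. Qed.


Lemma tail_sum_cat m n : tail_sum 0 (m + n) = tail_sum 0 m + tail_sum m n.
Proof. by rewrite /tail_sum big_split_ord. Qed.

Let ub k n V := forall J, {in J, forall j, al k j} -> (#|`J| <= n)%N ->
  \sum_(j <- J) w k j <= V.

Let ubS k n V : ub k n.+1 V -> ub k.+1 n (V - xi k).
Proof.
move=> H; have [[ala alb ab] _ _ wa _] := greedyP k.
exact: (fits_step_bound ala alb wa H).
Qed.

Let ub_down n k : ub k n.+1 (tail_sum k n.+2) ->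
  exists2 k', (k <= k')%N & ub k' 1 (tail_sum k' 2).
Proof.
elim: n k => [|n IH] k; first by exists k.
move=> /ubS; rewrite tail_sumB => /IH[k' kk' H].
by exists k' => //; exact: ltnW.
Qed.

(* The failure of domination at some length n is passed on to length n - 1 one
   step later, and at length 1 it bounds every active weight. *)
Let no_room k : ~ room k (al k) (w k) (a k) ->
  exists2 k', (k <= k')%N & forall j, al k' j -> w k' j <= xi k *+ 2.
Proof.
move=> /existsNP[n nf].
have H J : {in J, forall j, al k j} -> (#|`J| <= n)%N ->
    \sum_(j <- J) upd (w k) (a k) (w k (a k) - xi k) j < tail_sum k.+1 n.
  by move=> Ja Jn; rewrite ltNge; apply/negP => HJ; apply: nf; exists J.
(* Undoing the subtraction at [a k] adds at most [xi k], so any [n] active weights are bounded by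
   [n.+1] targets. *)
have ubn : ub k n (tail_sum k n.+1).
  move=> J Ja Jn; have := H J Ja Jn; rewrite tail_sumS.
  have [aJ|aJ] := boolP (a k \in J); first by rewrite sum_upd_in //; lra.
  by rewrite sum_upd_notin //; have := xi0 k; lra.
case: n ubn H {nf} => [|n] ubn H.
  have /H : {in fset0, forall j, al k j} by move=> j; rewrite inE.
  by rewrite cardfs0 => /(_ (leqnn _)); rewrite big_seq_fset0 /tail_sum big_ord0 ltxx.
have [k' kk' H'] := ub_down ubn; exists k' => // j alj.
have /H' : {in [fset j]%fset, forall i, al k' i} by move=> i; rewrite inE => /eqP ->.
rewrite cardfs1 big_seq_fset1 => /(_ (leqnn _)) H1; apply: le_trans H1 _.
rewrite !tail_sumS /tail_sum big_ord0 addr0 mulr2n.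
by apply: lerD; apply: xiN => //; exact: ltnW.
Qed.

(** Suppose that a weight above [eps] exists at all stages. Once [xi k < eps / 2], a failure of room
    would bring all weights below [eps]; hence every step has room and [w b <= e k]. The largest
    weights sit among finitely many indices, whose total then falls by at least [xi k - e k] each
    time and would become negative. *)
Lemma greedy_vanish_divergent :
  (forall M, exists n, M < tail_sum 0 n) ->
  (exists C, forall n, \sum_(i < n) e i <= C) ->
  forall eps, 0 < eps -> exists k, forall j, al k j -> w k j <= eps.
Proof.
move=> div [C HC] eps eps0; apply: contrapT => H.
have big k : eps < w k (a k).
  have [_ amax _ _ _] := greedyP k; rewrite ltNge; apply/negP => wa.
  by apply: H; exists k => j /amax /le_trans; apply.
have [K HK] := xiv (divr_gt0 eps0 (ltr0n R 2)).
have tiny k : (K <= k)%N -> w k (b k) <= e k.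
  move=> Kk; have [_ _ _ _ [[//]|[nr _ _]]] := greedyP k.
  exfalso; apply: nr; split.
    apply: contrapT => /no_room[k' kk' Hk']; apply: H; exists k' => j /Hk'.
    by move=> /le_trans; apply; rewrite mulr2n; have := HK k Kk; lra.
  by have := big k; have := HK k Kk; lra.
have [N HN] := vv eps0.
have aN k : (a k < N)%N.
  rewrite ltnNge; apply/negP => /HN; apply/negP; rewrite -leNgt.
  exact: le_trans (ltW (big k)) (w_le _ _).
(* Retired indices stay in this total: their frozen weights are nonnegative, and only the slot [a k]
   changes in a step. *)
pose S k := \sum_(j < N) w k j.
have SS k : S k.+1 = S k - xi k + w k (b k).
  rewrite /S (bigD1 (Ordinal (aN k))) //= [in RHS](bigD1 (Ordinal (aN k))) //=.
  rewrite wS {1}/upd eqxx.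
  rewrite (eq_bigr (fun i : 'I_N => w k i)); first by rewrite /=; lra.
  by move=> i ia; rewrite /upd; case: eqP => // E; case/eqP: ia; apply: val_inj.
have Sle n : S (K + n)%N <= S K - tail_sum K n + (\sum_(i < n) e (K + i)%N).
  elim: n => [|n IH]; first by rewrite addn0 /tail_sum !big_ord0; lra.
  rewrite addnS SS /tail_sum !big_ord_recr /=.
  by have := tiny (K + n)%N (leq_addr _ _); move: IH; rewrite /tail_sum; lra.
have S0 k : 0 <= S k by apply: sumr_ge0.
have [n Hn] := div (tail_sum 0 K + S K + C).
have eC : \sum_(i < n) e (K + i)%N <= C.
  apply: le_trans (HC (K + n)%N); rewrite [leRHS]big_split_ord /= lerDr.
  by apply: sumr_ge0 => i _; exact: ltW.
have : tail_sum 0 n <= tail_sum 0 (K + n)%N.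
  by rewrite addnC /tail_sum big_split_ord /= lerDl sumr_ge0 // => i _; exact: ltW.
rewrite tail_sum_cat; have := Sle n; have := S0 (K + n)%N.
by move: Hn eC; lra.
Qed.

(** The bound [V] on all finite sums of active weights falls by [xi k] at each step, so that after
    [k] steps a single weight is at most the tail of the targets. *)
Lemma greedy_vanish_summable V : (forall J, \sum_(j <- J) v j <= V) ->
  (forall eps, 0 < eps -> exists n, V - eps <= tail_sum 0 n) ->
  forall eps, 0 < eps -> exists k, forall j, al k j -> w k j <= eps.
Proof.
move=> HV lim eps eps0; have [k Hk] := lim _ eps0; exists k => j alj.
have H i n : ub i n (V - tail_sum 0 i).
  elim: i n => [|i IH] n; first by move=> J _ _; rewrite /tail_sum big_ord0 subr0.
  have := ubS (IH n.+1); rewrite -[i.+1]addn1 tail_sum_cat.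
  by rewrite tail_sumS /tail_sum big_ord0 addr0 addn1 opprD addrA.
have /(H k 1%N) : {in [fset j]%fset, forall i, al k i} by move=> i; rewrite inE => /eqP ->.
by rewrite big_seq_fset1 cardfs1 => /(_ (leqnn _)) H1; apply: le_trans H1 _; lra.
Qed.

(** * Using up the zero weights *)

Section Kernel.
Hypothesis oo : forall p, exists N, forall m, (N <= m)%N ->
  fits xpredT v m (tail_sum 0 (m + p)).

(** A step turns a surplus of [p.+1] targets into a surplus of [p] at the same length, so a surplus
    of every size at the start leaves one of every size at each stage. *)
Let dompP k p : exists N, forall m, (N <= m)%N ->
  fits (al k) (w k) m (tail_sum k (m + p)).
Proof.
elim: k p => [|k IH] p; first exact: oo.
have [N HN] := IH p.+1; exists N => m /HN.
have [[ala alb ab] _ wb wa _] := greedyP k.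
have := fits_step_same (al := al k) (a k) (w_ge0 k) wb.
move=> F; rewrite addnS => /F; rewrite tail_sumB; exact.
Qed.

Lemma fits_const al' (w' : nat -> R) J x n : {in J, forall j, al' j && (x < w' j)} ->
  (n <= #|`J|)%N -> fits al' w' n (x *+ n).
Proof.
move=> HJ; move Ed : (#|`J| - n)%N => d; elim: d J HJ Ed => [|d IH] J HJ Ed nJ.
  have Jn : #|`J| = n by apply/eqP; rewrite eqn_leq nJ andbT -subn_eq0 Ed.
  exists J; split; first by move=> j /HJ /andP[].
    by rewrite Jn.
  by rewrite -Jn; apply: sum_const_le => j /HJ /andP[_ /ltW].
have [J0|[c cJ]] := fset_0Vmem J; first by move: Ed; rewrite J0 cardfs0 sub0n.
have Jc := cardfsD1 c J; rewrite cJ add1n in Jc.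
apply: (IH (J `\ c)%fset).
- by move=> j; rewrite !inE => /andP[_ /HJ].
- by move: Ed; rewrite Jc; lia.
- by move: Ed nJ; rewrite Jc; lia.
Qed.

(* A step without room shortens by one the lengths at which domination by one
   extra term may fail; this cannot go on for ever, whence room recurs. *)
Let no_room_domination k N : ~ (room k (al k) (w k) (a k) /\ xi k < w k (a k)) ->
  (forall m, (N.+1 <= m)%N -> fits (al k) (w k) m (tail_sum k m.+1)) ->
  forall m, (N <= m)%N -> fits (al k.+1) (w k.+1) m (tail_sum k.+1 m.+1).
Proof.
move=> nr dom m Nm; have [[ala alb ab] amax wb wa C] := greedyP k.
have [[rm xa _ _]|[_ _ bmax]] := C; first by case: nr.
have := fits_step_max (w_ge0 k) alb wb bmax (dom m.+1 Nm).
rewrite tail_sumB => -[//|[J [HJ aJ Jn]]].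
exfalso; apply: nr; split=> [n|].
  (* Room is verified at length [n]: up to [m], the indices heavier than [xi k] suffice; beyond [m],
     the surplus target in [dom] pays for the reduction at [a k], which is brought into the set if
     necessary. *)
  have [nm|mn] := leqP n m.
    have Hx : {in J, forall j, al k j && (xi k < upd (w k) (a k) (w k (a k) - xi k) j)}.
      move=> j jJ; have /andP[/andP[-> _] wj] := HJ j jJ; rewrite /upd /=.
      by case: eqP => // ja; move: aJ; rewrite -ja jJ.
    apply: fits_le (leqnn _) (tail_sum_le k n) _.
    by apply: fits_const Hx _; rewrite Jn.
  have [J1 [J1a J1n HJ1]] := dom n (leq_ltn_trans Nm mn).
  rewrite tail_sumS in HJ1.
  have [aJ1|aJ1] := boolP (a k \in J1).
    by exists J1; split=> //; rewrite sum_upd_in //; lra.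
  have [J0|[c cJ]] := fset_0Vmem J1.
    by move: HJ1; rewrite J0 big_seq_fset0; have := xi0 k; have := tail_sum_ge0 k.+1 n; lra.
  have aJ2 : a k \notin (J1 `\ c)%fset by rewrite !inE (negPf aJ1) andbF.
  exists (a k |` (J1 `\ c))%fset; split.
  - by move=> j; rewrite !inE => /orP[/eqP ->|/andP[_ /J1a]].
  - by rewrite cardfsU1 aJ2; move: J1n; rewrite (cardfsD1 c) cJ.
  - rewrite sum_upd_in; last by rewrite !inE eqxx.
    rewrite big_fsetU1 //=; move: HJ1; rewrite (big_fsetD1 c cJ) /=.
    by have := amax c (J1a c cJ); lra.
(* Strictness: a member of [J] is heavier than [xi k]; if [J] is empty then [m = 0], and one weight
   dominates two positive targets. *)
have [J0|[c cJ]] := fset_0Vmem J; last first.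
  by have /andP[/andP[/amax wc _] xc] := HJ c cJ; apply: lt_le_trans wc.
have m0 : m = 0%N by rewrite -Jn J0 cardfs0.
have N1 : (N < 1)%N by rewrite ltnS -m0.
have [J1 [J1a J1n HJ1]] := dom 1%N N1.
apply: (@lt_le_trans _ _ (tail_sum k 2)).
  by rewrite !tail_sumS /tail_sum big_ord0 addr0 ltrDl.
apply: le_trans HJ1 _; have [->|[c cJ]] := fset_0Vmem J1; first by rewrite big_seq_fset0.
have -> : J1 = [fset c]%fset by apply/eqP; rewrite eq_sym eqEfcard fsub1set cJ cardfs1.
by rewrite big_seq_fset1; apply: amax; exact: J1a.
Qed.

Let room_cofinal K : exists2 k, (K <= k)%N &
  room k (al k) (w k) (a k) /\ xi k < w k (a k).
Proof.
apply: contrapT => H.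
have nt i : ~ (room (K + i) (al (K + i)) (w (K + i)) (a (K + i)) /\
               xi (K + i) < w (K + i) (a (K + i))).
  by move=> Hi; apply: H; exists (K + i)%N => //; exact: leq_addr.
have [N HN] := dompP K 1.
(* After [N] steps without room the admissible length would reach 0, where the empty sum cannot
   dominate a positive target. *)
have HS i : forall m, (N - i <= m)%N -> fits (al (K + i)) (w (K + i)) m (tail_sum (K + i) m.+1).
  elim: i => [|i IH] m; first by rewrite subn0 addn0 -(addn1 m); exact: HN.
  move=> Nm; rewrite addnS; apply: (@no_room_domination _ (N - i.+1)) => // m' Hm'; apply: IH.
  by lia.
have [J [_ J0]] := HS N 0%N (eq_leq (subnn N)).
have -> : J = fset0 by apply/eqP; rewrite -cardfs_eq0 -leqn0.
by rewrite big_seq_fset0 tail_sumS /tail_sum big_ord0 addr0 leNgt xi0.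
Qed.

(** The weight at [z] stays 0, so [z] never plays the role of [a] and can be retired only in a step
    with room. While [z] is active, each such step retires an index at most [z]; as room recurs for
    ever, these finitely many indices run out. *)
Lemma greedy_kernel z : v z = 0 -> exists k, [/\ b k = z, xi k < w k (a k) & forall i, a i != z].
Proof.
move=> vz.
have wz k : w k z = 0.
  by apply: le_anti; rewrite w_ge0 andbT -vz.
have az i : a i != z.
  have [_ _ _ wa _] := greedyP i; apply/negP => /eqP E; move: wa.
  by rewrite E wz leNgt xi0.
apply: contrapT => H.
have alz k : al k z.
  elim: k => [//|k IH]; rewrite alS /kill IH /=; apply/negP => /eqP E.
  have [_ _ _ _ [[_ xa _ _]|[_ wb _]]] := greedyP k.
    by apply: H; exists k.
  by move: wb; rewrite -E wz ltxx.
pose c k := (\sum_(j < z.+1) (al k j : nat))%N.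
have cS k : (c k.+1 <= c k)%N.
  by apply: leq_sum => j _; rewrite alS /kill; case: (al k j) => //=; case: (_ != _).
have cle k n : (k <= n)%N -> (c n <= c k)%N.
  move=> /subnK <-; elim: (n - k)%N => [//|d IH]; apply: leq_trans IH; exact: cS.
have cdrop k : room k (al k) (w k) (a k) /\ xi k < w k (a k) -> (c k.+1 < c k)%N.
  move=> rx; have [[ala alb ab] _ _ _ [[_ _ _ bmin]|[nr _ _]]] := greedyP k; last by case: nr.
  have bz : (b k < z.+1)%N by rewrite ltnS; apply: bmin; rewrite ?wz ?(ltW (e0 k)) // eq_sym.
  rewrite /c (bigD1 (Ordinal bz)) //= [X in (_ < X)%N](bigD1 (Ordinal bz)) //=.
  rewrite alS {1}/kill eqxx andbF alb add0n add1n ltnS.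
  by apply: leq_sum => j _; rewrite /kill; case: (al k j) => //=; case: (_ != _).
have Hn n : exists k, (c k + n <= z.+1)%N.
  elim: n => [|n [k IH]].
    exists 0%N; rewrite addn0 /c; under eq_bigr do rewrite /=.
    by rewrite sum_nat_const card_ord muln1.
  have [k' kk' /cdrop dk] := room_cofinal k; exists k'.+1; rewrite addnS.
  apply: leq_trans IH; rewrite ltn_add2r; apply: leq_trans dk _; exact: cle.
by have [k] := Hn z.+2; lia.
Qed.
End Kernel.

End Greedy.

(** * Hilbert space preliminaries *)

Section Abs2.
Context {R : realType}.
Implicit Types (z : R[i]) (r : R).

Definition abs2 z : R := complex.Re z ^+ 2 + complex.Im z ^+ 2.

Lemma abs2_ge0 z : 0 <= abs2 z. Proof. by rewrite addr_ge0 ?sqr_ge0. Qed.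

Lemma abs2E z : (abs2 z)%:C = z * conjc z.
Proof.
case: z => a b; rewrite /abs2; simpc; apply/eqP; rewrite eq_complex /=.
by apply/andP; split; apply/eqP; ring.
Qed.

Lemma abs2_eq0 z : abs2 z = 0 -> z = 0.
Proof.
case: z => a b /eqP; rewrite /abs2 /= paddr_eq0 ?sqr_ge0 // !sqrf_eq0.
by move=> /andP[/eqP -> /eqP ->].
Qed.

Lemma abs2M z1 z2 : abs2 (z1 * z2) = abs2 z1 * abs2 z2.
Proof. by case: z1 z2 => a b [c d]; rewrite /abs2 /=; ring. Qed.

Lemma abs2_conj z : abs2 (conjc z) = abs2 z.
Proof. by case: z => a b; rewrite /abs2 /= sqrrN. Qed.

Lemma abs2R r : abs2 r%:C = r ^+ 2.
Proof. by rewrite /abs2 /= expr0n addr0. Qed.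

Lemma abs20 : abs2 (0 : R[i]) = 0. Proof. by rewrite abs2R expr0n. Qed.
Lemma abs21 : abs2 (1 : R[i]) = 1. Proof. by rewrite abs2R expr1n. Qed.

Lemma abs2N z : abs2 (- z) = abs2 z.
Proof. by case: z => a b; rewrite /abs2 /= !sqrrN. Qed.

Lemma abs2D_le z1 z2 : abs2 (z1 + z2) <= 2 * abs2 z1 + 2 * abs2 z2.
Proof.
case: z1 z2 => a b [c d]; rewrite /abs2 /=.
by have := sqr_ge0 (a - c); have := sqr_ge0 (b - d); rewrite !sqrrB !sqrrD; lra.
Qed.

Lemma norm_lt_sqr (V : normedZmodType R[i]) (x : V) (s e : R) :
  `|x| ^+ 2 = s%:C -> 0 < e -> (`|x| < e%:C) = (s < e ^+ 2).
Proof.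
move=> xs e0; have x0 : 0 <= `|x| by [].
have e0' : 0 <= e%:C :> R[i] by rewrite ler0c ltW.
by rewrite -(ltr_pXn2r (n:=2)) // xs -rmorphXn /= ltcR.
Qed.

End Abs2.

Section Dot.
Context {R : realType} {H : completeNormedModType R[i]} (dot : {dot H for Num.conj}).
Implicit Types (x y z : H) (a : R[i]).

Lemma dotC x y : dot x y = conjc (dot y x).
Proof. by rewrite hermC /= expr0 mul1r. Qed.
Lemma dotDl x y z : dot (x + y) z = dot x z + dot y z.
Proof. by rewrite linearDl. Qed.
Lemma dotDr x y z : dot z (x + y) = dot z x + dot z y.
Proof. by rewrite linearDr. Qed.
Lemma dotBl x y z : dot (x - y) z = dot x z - dot y z.
Proof. by rewrite linearBl. Qed.
Lemma dotBr x y z : dot z (x - y) = dot z x - dot z y.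
Proof. by rewrite linearBr. Qed.
Lemma dotZl a x y : dot (a *: x) y = a * dot x y.
Proof. by rewrite linearZl_LR. Qed.
Lemma dotZr a x y : dot x (a *: y) = conjc a * dot x y.
Proof. by rewrite linearZr_LR. Qed.
Lemma dot0l x : dot 0 x = 0. Proof. by rewrite linear0l. Qed.
Lemma dot0r x : dot x 0 = 0. Proof. by rewrite linear0r. Qed.
Lemma dot_suml x I (r : seq I) (P : pred I) (F : I -> H) :
  dot (\sum_(i <- r | P i) F i) x = \sum_(i <- r | P i) dot (F i) x.
Proof. by rewrite linear_sumlz. Qed.
Lemma dot_sumr x I (r : seq I) (P : pred I) (F : I -> H) :
  dot x (\sum_(i <- r | P i) F i) = \sum_(i <- r | P i) dot x (F i).
Proof. by rewrite linear_sumr. Qed.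

Definition sq x : R := complex.Re (dot x x).

Lemma sqE x : dot x x = (sq x)%:C.
Proof. by rewrite /sq RRe_real // ger0_real // dnorm_ge0. Qed.

Lemma sq_ge0 x : 0 <= sq x. Proof. by rewrite -ler0c -sqE dnorm_ge0. Qed.

Lemma sq_eq0 x : sq x = 0 -> x = 0.
Proof. by move=> x0; apply/eqP; rewrite -(dnorm_eq0 dot) sqE x0. Qed.

Lemma sq0 : sq 0 = 0. Proof. by rewrite /sq dot0l. Qed.

Lemma sqZ a x : sq (a *: x) = abs2 a * sq x.
Proof. by apply: complexI; rewrite -sqE dotZl dotZr rmorphM /= abs2E -sqE mulrA. Qed.

Lemma sqN x : sq (- x) = sq x.
Proof. by rewrite -scaleN1r sqZ abs2N abs21 mul1r. Qed.

Lemma sqBC x y : sq (x - y) = sq (y - x).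
Proof. by rewrite -sqN opprB. Qed.

Lemma ReD (z1 z2 : R[i]) : complex.Re (z1 + z2) = complex.Re z1 + complex.Re z2.
Proof. by case: z1 z2 => ? ? []. Qed.

Lemma sqD x y : sq (x + y) = sq x + sq y + 2 * complex.Re (dot x y).
Proof.
rewrite /sq dotDl !dotDr !ReD (dotC y x).
by case: (dot x y) => a b /=; ring.
Qed.

Lemma sqDo x y : dot x y = 0 -> sq (x + y) = sq x + sq y.
Proof. by move=> xy; rewrite sqD xy mulr0 addr0. Qed.

Lemma sqD_le x y : sq (x + y) <= 2 * sq x + 2 * sq y.
Proof.
have := sq_ge0 (x - y); rewrite [in sq (x - y)]sqD sqN sqD.
have -> : complex.Re (dot x (- y)) = - complex.Re (dot x y).
  by rewrite -scaleN1r dotZr; case: (dot x y) => u v /=; ring.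
by lra.
Qed.

(* Stated for an operator positive on W only, so as to apply to l - T on a
   T-invariant subspace as well as to the scalar product itself. *)
Lemma positive_CauchySchwarz (W : set H) (T : H -> H) x y :
  linear T -> (forall x y, dot (T x) y = dot x (T y)) ->
  (forall a x y, W x -> W y -> W (x + a *: y)) ->
  (forall x, W x -> 0 <= complex.Re (dot (T x) x)) -> W x -> W y ->
  abs2 (dot (T x) y) <= complex.Re (dot (T x) x) * complex.Re (dot (T y) y).
Proof.
move=> Tl Ts WW Tp Wx Wy; set p := complex.Re (dot (T x) x).
set q := complex.Re (dot (T y) y); set z := dot (T x) y; set m := abs2 z.
(* Positivity at the test vector [x - s z y]. The quadratic in [s] is used at [s = 1 / q], or, if
   [q = 0], at an [s] where it would equal -1. *)
have key s : 0 <= p - 2 * s * m + s ^+ 2 * m * q.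
  have := Tp _ (WW (- (s%:C * z)) _ _ Wx Wy).
  rewrite addrC Tl dotDl !dotDr !dotZl !dotZr -/z.
  have -> : dot (T y) x = conjc z by rewrite Ts dotC.
  rewrite !ReD /p /q /m /abs2; case: (z) => u v; case: (dot (T y) y) => q1 q2.
  case: (dot (T x) x) => p1 p2 /= h; apply: le_trans h _.
  by rewrite le_eqVlt; apply/orP; left; apply/eqP; ring.
have m0 : 0 <= m by exact: abs2_ge0.
have p0 : 0 <= p by exact: Tp.
have q0 : 0 <= q by exact: Tp.
move: q0; rewrite le_eqVlt => /orP[/eqP q0|q0].
  rewrite -q0 mulr0 leNgt; apply/negP => m1.
  have := key ((p + 1) / (2 * m)); rewrite -q0 mulr0 addr0.
  have -> : 2 * ((p + 1) / (2 * m)) * m = p + 1 by field; rewrite gt_eqF.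
  by lra.
have := key q^-1.
have -> : p - 2 * q^-1 * m + q^-1 ^+ 2 * m * q = p - m / q by field; rewrite gt_eqF.
by rewrite subr_ge0 ler_pdivrMr.
Qed.

Lemma CauchySchwarz x y : abs2 (dot x y) <= sq x * sq y.
Proof.
apply: (@positive_CauchySchwarz setT (fun x => x)) => //.
by move=> z _; exact: sq_ge0.
Qed.

Definition orthonormal_seq (f : nat -> H) : Prop := forall m n, dot (f m) (f n) = (m == n)%:R.

Lemma orthonormal_sq f n : orthonormal_seq f -> sq (f n) = 1.
Proof. by move=> fo; apply: complexI; rewrite -sqE fo eqxx. Qed.

Lemma dot_orthonormal_sum f (c : nat -> R[i]) n k : orthonormal_seq f ->
  dot (\sum_(i < n) c i *: f i) (f k) = if (k < n)%N then c k else 0.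
Proof.
move=> fo; rewrite dot_suml; under eq_bigr do rewrite dotZl fo.
case: ltnP => [kn|nk]; last first.
  by rewrite big1 // => i _; rewrite ltn_eqF ?mulr0 // (leq_trans (ltn_ord i)).
rewrite (bigD1 (Ordinal kn)) //= eqxx mulr1 big1 ?addr0 // => i ik.
by case: eqP => [E|]; rewrite ?mulr0 //; case/eqP: ik; apply: val_inj.
Qed.

Lemma sq_orthonormal_sum f (c : nat -> R[i]) (P : pred nat) n : orthonormal_seq f ->
  sq (\sum_(i < n | P i) c i *: f i) = \sum_(i < n | P i) abs2 (c i).
Proof.
move=> fo; elim: n => [|n IH]; first by rewrite !big_ord0 sq0.
rewrite [in LHS]big_mkcond [in RHS]big_mkcond !big_ord_recr -!big_mkcond /=.
rewrite sqDo ?IH; last first.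
  rewrite dot_suml big1 // => i _; rewrite dotZl; case: (P n); rewrite ?dot0r ?mulr0 //.
  by rewrite dotZr fo ltn_eqF ?mulr0 //; exact: ltn_ord.
by case: (P n); rewrite ?sq0 // sqZ orthonormal_sq // mulr1.
Qed.

Lemma bessel_eq f x n : orthonormal_seq f ->
  sq (x - \sum_(i < n) dot x (f i) *: f i) = sq x - \sum_(i < n) abs2 (dot x (f i)).
Proof.
move=> fo; set s := \sum_(i < n) _ *: _.
have xs : dot (x - s) s = 0.
  rewrite {2}/s dot_sumr big1 // => i _; rewrite dotZr dotBl.
  by rewrite (dot_orthonormal_sum (fun j => dot x (f j)) n i fo) ltn_ord subrr mulr0.
have /= ss := sq_orthonormal_sum (fun i => dot x (f i)) xpredT n fo.
by have := sqDo xs; rewrite subrK /s ss => ->; rewrite addrK.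
Qed.

Lemma bessel f x n : orthonormal_seq f -> \sum_(i < n) abs2 (dot x (f i)) <= sq x.
Proof. by move=> fo; rewrite -subr_ge0 -bessel_eq // sq_ge0. Qed.

Hypothesis dotH : hilbert_dot dot.

Lemma norm_sq x : `|x| ^+ 2 = (sq x)%:C. Proof. by rewrite dotH sqE. Qed.

Lemma norm_lt x (r : R) : 0 < r -> (`|x| < r%:C) = (sq x < r ^+ 2).
Proof. by move=> r0; apply: norm_lt_sqr => //; exact: norm_sq. Qed.

Lemma gt0_complex (z : R[i]) : 0 < z -> exists2 r : R, 0 < r & z = r%:C.
Proof.
by case: z => a b; rewrite ltcE /= => /andP[/eqP -> a0]; exists a.
Qed.

Lemma cvg_sqP (T : Type) (F : set_system T) {FF : Filter F} (u : T -> H) (l : H) :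
  u x @[x --> F] --> l <-> (forall eps : R, 0 < eps -> \forall n \near F, sq (u n - l) < eps).
Proof.
split=> [/cvgrPdist_lt ul eps eps0|ul].
  have se : 0 < Num.sqrt eps by rewrite sqrtr_gt0.
  have := ul (Num.sqrt eps)%:C; rewrite ltcR => /(_ se).
  by apply: filterS => n; rewrite norm_lt // sqr_sqrtr ?ltW // sqBC.
apply/cvgrPdist_lt => z /gt0_complex[r r0 ->].
have := ul (r ^+ 2); rewrite exprn_gt0 // => /(_ isT).
by apply: filterS => n; rewrite norm_lt // sqBC.
Qed.

Lemma cvg_seqP (u : nat -> H) (l : H) :
  u n @[n --> \oo] --> l <->
  (forall eps : R, 0 < eps -> exists N, forall n, (N <= n)%N -> sq (u n - l) < eps).
Proof.
rewrite cvg_sqP; split=> h eps /h; first by case=> N _ HN; exists N.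
by case=> N HN; exists N.
Qed.

Lemma cvg_uniq (u : nat -> H) (l l' : H) :
  u n @[n --> \oo] --> l -> u n @[n --> \oo] --> l' -> l = l'.
Proof. by move=> ul ul'; exact: (cvg_unique _ ul ul'). Qed.

Lemma cauchy_sq (u : nat -> H) :
  (forall eps : R, 0 < eps -> exists N, forall n, (N <= n)%N -> sq (u n - u N) < eps) ->
  exists l : H, u n @[n --> \oo] --> l.
Proof.
move=> uC; suff /cvg_ex[l ul] : cvg (u n @[n --> \oo]) by exists l.
apply: cauchy_cvg; apply: cauchy_exP => z /gt0_complex[r r0 ->].
have [N HN] := uC (r ^+ 2) (exprn_gt0 2 r0); exists (u N); exists N => // n /= Nn.
by rewrite -ball_normE /= norm_lt // sqBC; exact: HN.
Qed.

Lemma dot_cvg (u : nat -> H) (l y : H) : u n @[n --> \oo] --> l ->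
  forall eps : R, 0 < eps -> exists N, forall n, (N <= n)%N -> abs2 (dot (u n) y - dot l y) < eps.
Proof.
move=> /cvg_seqP ul eps eps0.
have s1 : 0 < sq y + 1 by rewrite ltr_wpDl // sq_ge0.
have [N HN] := ul _ (divr_gt0 eps0 s1); exists N => n /HN h.
rewrite -dotBl; apply: le_lt_trans (CauchySchwarz _ _) _.
apply: (@le_lt_trans _ _ (sq (u n - l) * (sq y + 1))).
  by rewrite ler_wpM2l ?sq_ge0 // lerDl.
by rewrite -ltr_pdivlMr.
Qed.

Lemma dot_cvg_const (u : nat -> H) (l y : H) c : u n @[n --> \oo] --> l ->
  (exists N, forall n, (N <= n)%N -> dot (u n) y = c) -> dot l y = c.
Proof.
move=> ul [N HN]; apply/eqP; rewrite eq_sym -subr_eq0; apply/eqP/abs2_eq0/eqP.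
rewrite eq_le abs2_ge0 andbT leNgt; apply/negP => h.
have [M HM] := dot_cvg y ul h.
have := HM _ (leq_maxr N M); rewrite HN ?leq_maxl //.
by rewrite ltxx.
Qed.

Lemma riesz_fischer f (c : nat -> R[i]) (M : R) : orthonormal_seq f ->
  (forall n, \sum_(i < n) abs2 (c i) <= M) ->
  exists l : H, (\sum_(i < n) c i *: f i) @[n --> \oo] --> l /\ forall k, dot l (f k) = c k.
Proof.
move=> fo cM; set u := fun n => \sum_(i < n) c i *: f i.
have S0 : has_sup [set r | exists n, r = \sum_(i < n) abs2 (c i)].
  split; first by exists 0; exists 0%N; rewrite big_ord0.
  by exists M => _ [n ->].
have [l ul] : exists l : H, u n @[n --> \oo] --> l.
  apply: cauchy_sq => eps eps0.
  have [_ [N ->] HN] := sup_adherent eps0 S0; exists N => n Nn.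
  rewrite /u -(subnKC Nn) big_split_ord /= addrAC subrr add0r.
  have fo' : orthonormal_seq (fun j => f (N + j)%N) by move=> i j; rewrite fo eqn_add2l.
  have /= -> := sq_orthonormal_sum (fun j => c (N + j)%N) xpredT (n - N) fo'.
  have := sup_upper_bound S0; move=> /(_ (\sum_(i < n) abs2 (c i))) /(_ (ex_intro _ n erefl)).
  by rewrite -[in \sum_(i < n) _](subnKC Nn) big_split_ord /=; lra.
exists l; split=> // k; apply: dot_cvg_const ul _; exists k.+1 => n kn.
by rewrite /u dot_orthonormal_sum // kn.
Qed.

Lemma orthonormal_basis_total f : orthonormal_seq f ->
  (forall y, (forall n, dot y (f n) = 0) -> y = 0) -> orthonormal_basis dot f.
Proof.
move=> fo ft; split=> // x.
have [l [ul lk]] := @riesz_fischer f (fun i => dot x (f i)) _ fo (fun n => bessel x n fo).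
suff xl : l = x by move: ul; rewrite xl.
by apply/eqP; rewrite -subr_eq0; apply/eqP/ft => n; rewrite dotBl lk subrr.
Qed.

Lemma basis_total f y : orthonormal_basis dot f -> (forall n, dot y (f n) = 0) -> y = 0.
Proof.
move=> [fo fb] y0; apply: (cvg_uniq (fb y)).
have -> : (fun n => \sum_(k < n) dot y (f k) *: f k) = fun=> 0.
  by apply/funext => n; rewrite big1 // => i _; rewrite y0 scale0r.
exact: cvg_cst.
Qed.

Lemma parseval f x (eps : R) : orthonormal_basis dot f -> 0 < eps ->
  exists N, forall n, (N <= n)%N -> sq x - eps < \sum_(i < n) abs2 (dot x (f i)).
Proof.
move=> [fo fb] eps0; have /cvg_seqP/(_ _ eps0)[N HN] := fb x.
by exists N => n /HN; rewrite sqBC bessel_eq //; lra.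
Qed.

End Dot.

(** * Operators given by their coordinates *)

Section RealSeries.
Context {R : realType}.
Implicit Types (a : nat -> R) (l : R).

Definition sums_to a l : Prop := forall eps, 0 < eps ->
  exists N, forall n, (N <= n)%N -> `|\sum_(i < n) a i - l| < eps.

Lemma sums_toE a l : (forall i, 0 <= a i) ->
  sums_to a l -> (\sum_(0 <= i <oo) (a i)%:E = l%:E)%E.
Proof.
move=> a0 al; apply: cvg_lim => //.
have -> : (fun n => \sum_(0 <= i < n) (a i)%:E)%E = (fun n => (\sum_(i < n) a i)%:E).
  by apply/funext => n; rewrite sumEFin big_mkord.
apply: cvg_EFin; first by near=> n.
apply/cvgrPdist_lt => eps /al[N HN]; exists N => // n /= /HN.
by rewrite distrC.
Unshelve. all: by end_near. Qed.

End RealSeries.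

Section Operators.
Context {R : realType} {H : completeNormedModType R[i]} (dot : {dot H for Num.conj}).
Hypothesis dotH : hilbert_dot dot.
Implicit Types (x y z : H) (a : R[i]) (T : H -> H).
Local Notation sq := (sq dot).

Lemma linear_scale T : linear T -> forall a x, T (a *: x) = a *: T x.
Proof.
move=> Tl a x; have T0 : T 0 = 0.
  have := Tl 1 0 0; rewrite !scale1r addr0 => /eqP.
  by rewrite -subr_eq0 opprD addrA subrr sub0r oppr_eq0 => /eqP.
by have := Tl a x 0; rewrite T0 !addr0.
Qed.

Lemma linear_add T : linear T -> forall x y, T (x + y) = T x + T y.
Proof. by move=> Tl x y; have := Tl 1 x y; rewrite !scale1r. Qed.

Lemma linear_sub T : linear T -> forall x y, T (x - y) = T x - T y.
Proof. by move=> Tl x y; rewrite -scaleN1r linear_add // linear_scale // scaleN1r. Qed.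

Lemma linear_zero T : linear T -> T 0 = 0.
Proof. by move=> Tl; have := linear_scale Tl 0 0; rewrite !scale0r. Qed.

Lemma linear_big T I (r : seq I) (P : pred I) (F : I -> H) : linear T ->
  T (\sum_(i <- r | P i) F i) = \sum_(i <- r | P i) T (F i).
Proof.
move=> Tl; apply: (big_morph T (linear_add Tl)); exact: linear_zero.
Qed.

Lemma bounded_continuous T (M : R) : linear T ->
  (forall x, sq (T x) <= M * sq x) -> continuous T.
Proof.
move=> Tl TM x; rewrite /continuous_at; apply/(cvg_sqP dotH) => eps eps0.
have M1 : 0 < `|M| + 1 by rewrite ltr_wpDl.
have /(cvg_sqP dotH)/(_ _ (divr_gt0 eps0 M1)) : y @[y --> x] --> x by exact: cvg_id.
apply: filterS => y hy; rewrite -linear_sub //; apply: le_lt_trans (TM _) _.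
apply: (@le_lt_trans _ _ ((`|M| + 1) * sq (y - x))).
  by rewrite ler_wpM2r ?sq_ge0 //; have := ler_norm M; lra.
by rewrite mulrC -ltr_pdivlMr.
Qed.

Lemma parseval_le f x (M : R) : orthonormal_basis dot f ->
  (forall n, \sum_(i < n) abs2 (dot x (f i)) <= M) -> sq x <= M.
Proof.
move=> fb xM; rewrite leNgt; apply/negP => Mx.
have e0 : 0 < sq x - M by rewrite subr_gt0.
have [N HN] := parseval dotH x fb e0.
by have := HN N (leqnn _); have := xM N; lra.
Qed.

Lemma coord_ext f x y : orthonormal_basis dot f ->
  (forall k, dot x (f k) = dot y (f k)) -> x = y.
Proof.
move=> fb xy; apply/eqP; rewrite -subr_eq0; apply/eqP/(basis_total fb) => n.
by rewrite dotBl xy subrr.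
Qed.

(** Riesz-Fischer defines [T x] pointwise from its coordinates. Taking [f = h] gives diagonal
    operators, taking [c = 1] gives changes of basis. *)
Lemma coord_operator f h (c : nat -> R[i]) (M : R) : orthonormal_seq dot f ->
  orthonormal_basis dot h -> (forall k, abs2 (c k) <= M) ->
  exists T, [/\ linear T, forall x, sq (T x) <= M * sq x &
    forall x k, dot (T x) (h k) = c k * dot x (f k)].
Proof.
move=> fo hb cM; have M0 : 0 <= M by exact: le_trans (abs2_ge0 _) (cM 0%N).
have bnd x n : \sum_(i < n) abs2 (c i * dot x (f i)) <= M * sq x.
  apply: (@le_trans _ _ (M * \sum_(i < n) abs2 (dot x (f i)))).
    rewrite mulr_sumr; apply: ler_sum => i _; rewrite abs2M.
    by rewrite ler_wpM2r ?abs2_ge0.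
  by rewrite ler_wpM2l // bessel.
have ex x : exists y, forall k, dot y (h k) = c k * dot x (f k).
  have [l [_ lk]] := @riesz_fischer _ _ _ dotH h (fun k => c k * dot x (f k)) _ hb.1 (bnd x).
  by exists l.
have [T HT] := choice ex; exists T; split=> //.
- move=> a x y; apply: (coord_ext hb) => k.
  by rewrite HT !dotDl !dotZl !HT mulrDr mulrCA.
- move=> x; apply: parseval_le hb _ => n.
  by under eq_bigr do rewrite HT; exact: bnd.
Qed.

Lemma coord_operator_BH f h (c : nat -> R[i]) (M : R) : orthonormal_seq dot f ->
  orthonormal_basis dot h -> (forall k, abs2 (c k) <= M) ->
  exists2 T, BH T & forall x k, dot (T x) (h k) = c k * dot x (f k).
Proof.
move=> fo hb cM; have [T [Tl TM HT]] := coord_operator fo hb cM.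
by exists T => //; split=> //; exact: bounded_continuous TM.
Qed.

Lemma dot_cvg_eq (u u' : nat -> H) (l l' y y' : H) :
  u n @[n --> \oo] --> l -> u' n @[n --> \oo] --> l' ->
  (forall n, dot (u n) y = dot (u' n) y') -> dot l y = dot l' y'.
Proof.
move=> ul ul' uu'; apply/eqP; rewrite -subr_eq0; apply/eqP/abs2_eq0/eqP.
rewrite eq_le abs2_ge0 andbT leNgt; apply/negP => h.
have h4 : 0 < abs2 (dot l y - dot l' y') / 4 by rewrite divr_gt0.
have [N HN] := dot_cvg dotH y ul h4; have [N' HN'] := dot_cvg dotH y' ul' h4.
have := HN _ (leq_maxl N N'); have := HN' _ (leq_maxr N N').
set n := maxn N N'; rewrite uu'.
have := abs2D_le (dot (u' n) y' - dot l' y') (- (dot (u' n) y' - dot l y)).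
rewrite (_ : _ + - _ = dot l y - dot l' y'); last by ring.
by rewrite abs2N; lra.
Qed.

Lemma continuous_seq T (u : nat -> H) (l : H) : continuous T ->
  u n @[n --> \oo] --> l -> T (u n) @[n --> \oo] --> T l.
Proof. by move=> Tc ul; apply: (cvg_comp _ _ ul (Tc l)). Qed.

Lemma basis_dot_ext f T1 T2 y1 y2 : orthonormal_basis dot f -> BH T1 -> BH T2 ->
  (forall k, dot (T1 (f k)) y1 = dot (T2 (f k)) y2) ->
  forall x, dot (T1 x) y1 = dot (T2 x) y2.
Proof.
move=> fb [T1l T1c] [T2l T2c] E x.
apply: dot_cvg_eq (continuous_seq T1c (fb.2 x)) (continuous_seq T2c (fb.2 x)) _ => n.
rewrite !linear_big // !dot_suml; apply: eq_bigr => i _.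
by rewrite !linear_scale // !dotZl E.
Qed.

Lemma BH_id : BH (fun x : H => x).
Proof. by split=> // x; exact: cvg_id. Qed.

Lemma operator_basis_ext f T1 T2 : orthonormal_basis dot f -> BH T1 -> BH T2 ->
  (forall k, T1 (f k) = T2 (f k)) -> T1 = T2.
Proof.
move=> fb B1 B2 E; apply/funext => x; apply: (coord_ext fb) => k.
by apply: (basis_dot_ext fb B1 B2) => j; rewrite E.
Qed.

Lemma basis_change_unitary f h : orthonormal_basis dot f -> orthonormal_basis dot h ->
  exists U S, unitary_with_adjoint dot U S /\ forall k, S (f k) = h k.
Proof.
move=> fb hb; have c1 (k : nat) : abs2 (1 : R[i]) <= 1 by rewrite abs21.
have [U UB HU] := coord_operator_BH (c := fun=> 1) hb.1 fb c1.
have [S SB HS] := coord_operator_BH (c := fun=> 1) fb.1 hb c1.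
have Sf k : S (f k) = h k.
  by apply: (coord_ext hb) => j; rewrite HS mul1r fb.1 hb.1.
exists U, S; split=> //; split=> //.
- move=> x y; rewrite [RHS]dotC.
  have := @basis_dot_ext f S (fun x => x) x (U x) fb SB BH_id.
  move=> /(_ _ y) ->; first by rewrite -dotC.
  by move=> k; rewrite Sf [LHS]dotC [RHS]dotC HU mul1r.
- by apply/funext => x /=; apply: (coord_ext fb) => k; rewrite HU HS !mul1r.
- by apply/funext => x /=; apply: (coord_ext hb) => k; rewrite HS HU !mul1r.
Qed.

Definition eigenbasis T (g : nat -> H) (lam : nat -> R) : Prop :=
  [/\ orthonormal_basis dot g, BH T, forall n, 0 <= lam n &
      forall n, T (g n) = (lam n)%:C *: g n].

Section Eigen.
Variables (T : H -> H) (g : nat -> H) (lam : nat -> R).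
Hypothesis Tg : eigenbasis T g lam.

Lemma eigen_coord x k : dot (T x) (g k) = (lam k)%:C * dot x (g k).
Proof.
have [gb TB _ E] := Tg.
have -> : (lam k)%:C * dot x (g k) = dot x ((lam k)%:C *: g k).
  by rewrite dotZr conjc_real.
apply: (basis_dot_ext gb TB BH_id) => j.
by rewrite E dotZl dotZr conjc_real gb.1; case: eqP => [->|]; rewrite ?mulr0.
Qed.

Lemma eigen_form_sums x :
  sums_to (fun k => lam k * abs2 (dot x (g k))) (complex.Re (dot (T x) x)).
Proof.
move=> eps eps0; have [gb TB lam0 E] := Tg.
have e2 : 0 < eps ^+ 2 by rewrite exprn_gt0.
have [N HN] := dot_cvg dotH (T x) (gb.2 x) e2; exists N => n /HN.
set r := \sum_(i < n) lam i * abs2 (dot x (g i)).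
have -> : dot (\sum_(k < n) dot x (g k) *: g k) (T x) = r%:C.
  rewrite dot_suml rmorph_sum; apply: eq_bigr => i _.
  rewrite dotZl (dotC dot _ (T x)) eigen_coord; case: (dot x (g i)) => u v.
  by apply/eqP; rewrite eq_complex /abs2 /=; apply/andP; split; apply/eqP; ring.
have -> : dot x (T x) = conjc (dot (T x) x) by exact: dotC.
case: (dot (T x) x) => u v; rewrite /abs2 /= => h.
rewrite -(ltr_pXn2r (n:=2)) ?nnegrE ?(ltW eps0) // real_normK ?num_real //.
by apply: le_lt_trans h; rewrite lerDl sqr_ge0.
Qed.

Lemma eigen_sq_sums x : sums_to (fun k => abs2 (dot x (g k))) (sq x).
Proof.
move=> eps eps0; have [gb TB lam0 E] := Tg.
have [N HN] := parseval dotH x gb eps0; exists N => n /HN.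
have := bessel x n gb.1; rewrite ltr_norml => h1 h2; apply/andP; split; lra.
Qed.

End Eigen.

End Operators.

(** * The spectral theorem *)

Lemma infinite_inj (T : pointedType) (A : set T) : infinite_set A ->
  exists2 f : nat -> T, injective f & forall n, A (f n).
Proof.
move=> /infiniteP/pcard_leP[f]; exists f; last by move=> n; exact: funS.
by move=> m n; apply: (@inj _ _ _ f); rewrite inE.
Qed.

Lemma infinite_enum (T : pointedType) (A : set T) : countable A -> infinite_set A ->
  exists2 f : nat -> T, injective f & range f = A.
Proof.
move=> cA iA; have := eq_card_nat cA iA; rewrite card_eq_sym => /card_set_bijP[f [fA fi fs]].
exists f; first by move=> m n; apply: fi; rewrite inE.
by apply/seteqP; split=> [_ [n _ <-]|x /fs]; [exact: fA|].
Qed.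

Lemma wide_kernel (F : fieldType) n m (A : 'M[F]_(n, m)) : (m < n)%N ->
  exists2 u : 'rV_n, u != 0 & u *m A = 0.
Proof.
move=> mn; have k0 : kermx A != 0.
  rewrite kermx_eq0 /row_free neq_ltn; apply/orP; left.
  by apply: leq_ltn_trans (rank_leq_col A) mn.
exists (nz_row (kermx A)); first by rewrite nz_row_eq0.
by apply: sub_kermxP; exact: nz_row_sub.
Qed.

Section Spectral.
Context {R : realType} {H : completeNormedModType R[i]} (dot : {dot H for Num.conj}).
Hypothesis dotH : hilbert_dot dot.
Implicit Types (x y z : H) (a : R[i]) (T : H -> H).
Local Notation sq := (sq dot).

Lemma BH_bounded T : BH T -> exists2 M : R, 0 <= M & forall x, sq (T x) <= M * sq x.
Proof.
move=> [Tl Tc]; have := Tc 0; rewrite /continuous_at (linear_zero Tl).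
move=> /(cvg_sqP dotH)/(_ 1 ltr01)/nbhs_ballP[z /gt0_complex[r r0 ->]] zb.
have rb y : sq y < r ^+ 2 -> sq (T y) < 1.
  move=> yr; have := zb y; rewrite -ball_normE /= sub0r normrN subr0; apply.
  by rewrite (norm_lt dotH).
have r2 : 0 < r ^+ 2 by exact: exprn_gt0.
exists (2 / r ^+ 2); first by rewrite divr_ge0 // ltW.
move=> x; have := sq_ge0 dot x; rewrite le_eqVlt => /orP[/eqP x0|x0].
  by rewrite -x0 mulr0 (sq_eq0 (esym x0)) (linear_zero Tl) sq0.
(* [t2] rescales [x] to squared norm [r ^+ 2 / 2], inside the ball on which [T] is controlled. *)
set t2 := r ^+ 2 / (2 * sq x); have t0 : 0 < t2 by rewrite divr_gt0 // mulr_gt0.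
have := rb ((Num.sqrt t2)%:C *: x).
rewrite (linear_scale Tl) !sqZ abs2R sqr_sqrtr; last exact: ltW.
have -> : t2 * sq x = r ^+ 2 / 2 by rewrite /t2; field; rewrite gt_eqF.
move=> h; have {}h : t2 * sq (T x) < 1 by apply: h; lra.
have -> : 2 / r ^+ 2 * sq x = t2^-1 by rewrite /t2; field; rewrite !gt_eqF.
by rewrite -[leRHS]mul1r ler_pdivlMr // mulrC ltW.
Qed.

Lemma positive_selfadjoint T : linear T -> (forall x, 0 <= dot (T x) x) ->
  forall x y, dot (T x) y = dot x (T y).
Proof.
move=> Tl Tp x y; rewrite [RHS]dotC.
have Tim z : complex.Im (dot (T z) z) = 0 by exact: ger0_Im.
have h1 := Tim (1 *: x + y); have h2 := Tim ('i *: x + y).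
move: h1 h2; rewrite !Tl !dotDl !dotDr !dotZl !dotZr.
have := Tim x; have := Tim y.
case: (dot (T x) x) (dot (T y) y) (dot (T x) y) (dot (T y) x) => p1 p2 [q1 q2] [s1 s2] [t1 t2] /=.
move=> -> -> h1 h2; apply/eqP; rewrite eq_complex /=; apply/andP; split; apply/eqP; lra.
Qed.

Lemma compact_seq (K : set H) (u : nat -> H) : compact K -> (forall n, K (u n)) ->
  exists y, forall (eps : R) N, 0 < eps -> exists2 n, (N <= n)%N & sq (u n - y) < eps.
Proof.
move=> cK Ku; have KF : (u n @[n --> \oo]) K by exists 0%N => // n _; exact: Ku.
have [y [_ yc]] := cK (u n @[n --> \oo]) _ KF.
exists y => eps N eps0.
have A : (u n @[n --> \oo]) (u @` [set n | (N <= n)%N]).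
  by exists N => // n /= Nn; exists n.
have B : nbhs y [set z | sq (z - y) < eps].
  have := iffLR (cvg_sqP dotH (F := nbhs y) (fun z => z) y) cvg_id; exact.
by have [_ [[n Nn <-] h]] := yc _ _ A B; exists n.
Qed.

Definition subspace_closed (W : set H) : Prop :=
  (forall a x y, W x -> W y -> W (x + a *: y)) /\
  (forall y, (forall eps : R, 0 < eps -> exists2 x, W x & sq (x - y) < eps) -> W y).

Lemma sqB_le x y : sq (x - y) <= 2 * sq x + 2 * sq y.
Proof. by have := sqD_le dot x (- y); rewrite sqN. Qed.

Lemma le0_eps (r : R) : (forall eps, 0 < eps -> r <= eps) -> r <= 0.
Proof. by move=> h; apply/ler_addgt0Pr => eps /h; rewrite add0r. Qed.

(** With [l] the supremum of the form on unit vectors of [W], the operator [D = l - T] is positive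
    on [W], and Cauchy-Schwarz for [D] bounds the squared norm of [D x] by [l] times the form of [D]
    at [x]. Maximizing unit vectors are thus approximate eigenvectors, and compactness yields a true
    one. The invariant subspace [W] will be the complement of the eigenvectors already found. *)
Lemma eigenvector_exists T W x0 : Kplus dot T -> subspace_closed W ->
  (forall x, W x -> W (T x)) -> W x0 -> x0 != 0 ->
  exists x (l : R), [/\ W x, sq x = 1, 0 <= l & T x = l%:C *: x].
Proof.
move=> [[[Tl Tc] Tk] [_ Tp]] [WW Wc] WT W0 x00.
have Ts := positive_selfadjoint Tl Tp.
have [M M0 TM] := BH_bounded (conj Tl Tc).
have WZ a x : W x -> W (a *: x).
  by move=> Wx; have := WW (a - 1) x x Wx Wx; rewrite scalerBl scale1r addrC subrK.
have unit x : W x -> x != 0 -> exists t : R, sq (t%:C *: x) = 1 /\ 0 < t.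
  move=> Wx x1; have s0 : 0 < sq x.
    by rewrite lt_neqAle sq_ge0 andbT eq_sym; apply: contraNneq x1 => /sq_eq0 ->.
  exists (Num.sqrt (sq x)^-1); rewrite sqZ abs2R sqr_sqrtr ?invr_ge0 ?sq_ge0 //.
  by rewrite mulVf ?gt_eqF // sqrtr_gt0 invr_gt0.
pose q x := complex.Re (dot (T x) x).
have q0 x : 0 <= q x by rewrite /q; have := Tp x; rewrite lecE => /andP[].
have qZ a x : q (a *: x) = abs2 a * q x.
  rewrite /q (linear_scale Tl) dotZl dotZr /abs2.
  by case: a (dot (T x) x) => a1 a2 [u v] /=; ring.
pose S : set R := [set r | exists x, [/\ W x, sq x = 1 & r = q x]].
have S0 : has_sup S.
  split.
    have [t [t1 _]] := unit x0 W0 x00; exists (q (t%:C *: x0)), (t%:C *: x0).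
    by split=> //; exact: WZ.
  exists (M + 1) => _ [x [_ x1 ->]].
  have := CauchySchwarz dot (T x) x; rewrite x1 mulr1 => h.
  have qx : q x ^+ 2 <= M.
    apply: le_trans (_ : abs2 (dot (T x) x) <= M).
      by rewrite /abs2 lerDl sqr_ge0.
    by apply: le_trans h _; apply: le_trans (TM x) _; rewrite x1 mulr1.
  by rewrite leNgt; apply/negP => h1; have := sqr_ge0 (q x - 1); nra.
set l := sup S.
have ql x : W x -> q x <= l * sq x.
  move=> Wx; have [->|x1] := eqVneq x 0.
    by rewrite /q (linear_zero Tl) dot0l sq0 mulr0.
  have [t [t1 t0]] := unit x Wx x1.
  have : q (t%:C *: x) <= l.
    by apply: sup_upper_bound => //; exists (t%:C *: x); split=> //; exact: WZ.
  move: t1; rewrite qZ sqZ abs2R => t1 h; have t2 : 0 < t ^+ 2 by exact: exprn_gt0.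
  by rewrite -(ler_pM2l t2); apply: le_trans h _; rewrite mulrCA t1 mulr1.
have l0 : 0 <= l.
  have [t [t1 _]] := unit x0 W0 x00; apply: le_trans (q0 (t%:C *: x0)) _.
  by rewrite -[l]mulr1 -t1; apply: ql; exact: WZ.
pose D x := l%:C *: x - T x.
have Dl : linear D.
  by move=> a x y; rewrite /D Tl scalerDr scalerBr !scalerA (mulrC a) opprD addrACA.
have Dsa x y : dot (D x) y = dot x (D y).
  by rewrite /D dotBl dotBr dotZl dotZr conjc_real Ts.
have DE x : complex.Re (dot (D x) x) = l * sq x - q x.
  rewrite /D /q dotBl dotZl (sqE dot); case: (dot (T x) x) => u v /=; ring.
have WD x : W x -> W (D x).
  by move=> Wx; rewrite /D -scaleN1r; apply: WW; [exact: WZ|exact: WT].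
have Dx x : W x -> sq (D x) <= (l * sq x - q x) * l.
  move=> Wx; have Dp y : W y -> 0 <= complex.Re (dot (D y) y).
    by move=> Wy; rewrite DE subr_ge0; exact: ql.
  have := positive_CauchySchwarz Dl Dsa WW Dp Wx (WD x Wx).
  rewrite (sqE dot) abs2R !DE.
  have := q0 (D x); have := Dp x Wx; rewrite DE; have := sq_ge0 dot (D x).
  rewrite le_eqVlt => /orP[/eqP <-|s0] h1 h2 h3; first by rewrite mulr_ge0.
  rewrite -(ler_pM2l s0) -expr2; apply: le_trans h3 _.
  rewrite (mulrC (sq (D x))) -mulrA ler_wpM2l //; lra.
have Dbound x : sq (D x) <= (2 * l ^+ 2 + 2 * M) * sq x.
  apply: le_trans (sqB_le _ _) _; rewrite sqZ abs2R; have := TM x; lra.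
have seqx n : exists x, [/\ W x, sq x = 1 & sq (D x) <= l / n.+1%:R].
  have e0 : 0 < n.+1%:R^-1 :> R by rewrite invr_gt0.
  have [_ [x [Wx x1 ->]] hx] := sup_adherent e0 S0; exists x; split=> //.
  apply: le_trans (Dx x Wx) _; rewrite x1 mulr1 mulrC ler_wpM2l //.
  by move: hx => /ltW; rewrite -/l lerBlDr lerBlDl.
have [xs Hxs] := choice seqx.
have small (eps : R) : 0 < eps -> exists N, forall n, (N <= n)%N -> sq (D (xs n)) < eps.
  move=> eps0; exists (Num.truncn (l / eps)) => n nN; have [_ _ h] := Hxs n.
  apply: le_lt_trans h _; rewrite ltr_pdivrMr // mulrC -ltr_pdivrMr //.
  apply: lt_le_trans (truncnS_gt _) _; rewrite ler_nat ltnS; exact: nN.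
(* For [l = 0] the first vector of the sequence already lies in the kernel; below, [l > 0]
   guarantees a nonzero cluster point. *)
move: l0; rewrite le_eqVlt => /orP[/eqP l00|l0].
  have [Wx x1 h] := Hxs 0%N; exists (xs 0%N), 0; split=> //.
  have D0 : sq (D (xs 0%N)) = 0.
    by apply: le_anti; rewrite sq_ge0 andbT; apply: le_trans h _; rewrite -l00 mul0r.
  by move: (sq_eq0 D0); rewrite /D -l00 !scale0r sub0r => /eqP; rewrite oppr_eq0 => /eqP.
have ball_n n : closure (T @` [set x | `|x| <= 1]) (T (xs n)).
  apply: subset_closure; exists (xs n) => //=; have [_ x1 _] := Hxs n.
  by rewrite -(@ler_pXn2r _ 2) // ?expr1n ?nnegrE // (norm_sq dotH) x1 lecR.
have [y Hy] := compact_seq Tk ball_n.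
have Dy : D y = 0.
  apply: (@sq_eq0 _ _ dot); apply: le_anti; rewrite sq_ge0 andbT.
  set C := 2 * l ^+ 2 + 2 * M.
  have C0 : 0 <= C by have := sqr_ge0 l; rewrite /C; lra.
  apply: le0_eps => eps eps0.
  have e1 : 0 < eps / (4 * (M + 1)) by rewrite divr_gt0 //; lra.
  have e2 : 0 < eps / (4 * (C + 1)) by rewrite divr_gt0 //; lra.
  have [N HN] := small _ e1; have [n Nn hy] := Hy _ N e2.
  (* [T] and [D] commute, so [D y] is the small vector [T (D (xs n))] corrected by [D] of another
     small vector. *)
  have E : D y = T (D (xs n)) - D (T (xs n) - y).
    rewrite (linear_sub Dl) opprB addrCA; rewrite /D (linear_sub Tl) (linear_scale Tl).
    by rewrite subrr addr0.
  rewrite E; apply: le_trans (sqB_le _ _) _.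
  have h1 : sq (T (D (xs n))) <= eps / 4.
    apply: le_trans (TM _) _; apply: (@le_trans _ _ ((M + 1) * sq (D (xs n)))).
      by rewrite ler_wpM2r ?sq_ge0 // lerDl.
    have := HN n Nn; rewrite ltr_pdivlMr; last by lra.
    by lra.
  have h2 : sq (D (T (xs n) - y)) <= eps / 4.
    apply: le_trans (Dbound _) _; apply: (@le_trans _ _ ((C + 1) * sq (T (xs n) - y))).
      by rewrite ler_wpM2r ?sq_ge0 // lerDl.
    move: hy; rewrite ltr_pdivlMr; last by lra.
    by lra.
  by lra.
have y1 : y != 0.
  apply/negP => /eqP y0.
  have e1 : 0 < l ^+ 2 / 8 by rewrite divr_gt0 // exprn_gt0.
  have [N HN] := small _ e1; have [n Nn] := Hy _ N e1; rewrite y0 subr0 => h.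
  have := sqD_le dot (D (xs n)) (T (xs n)); rewrite /D subrK sqZ abs2R.
  have [_ -> _] := Hxs n; have := HN n Nn; rewrite /D.
  have l2 : 0 < l ^+ 2 by exact: exprn_gt0.
  by move: h; lra.
have Wy : W y.
  apply: Wc => eps eps0; have [n _ h] := Hy _ 0%N eps0.
  by exists (T (xs n)) => //; apply: WT; have [] := Hxs n.
have [t [t1 t0]] := unit y Wy y1.
exists (t%:C *: y), l; split=> //; [exact: WZ|exact: ltW|].
move: Dy => /eqP; rewrite /D subr_eq0 => /eqP E.
by rewrite (linear_scale Tl) -E !scalerA mulrC.
Qed.

End Spectral.

Section SpectralBasis.
Context {R : realType} {H : completeNormedModType R[i]} (dot : {dot H for Num.conj}).
Hypothesis dotH : hilbert_dot dot.
Implicit Types (x y z : H) (a : R[i]) (T : H -> H).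
Local Notation sq := (sq dot).

Lemma eigen_vanishes T g lam : compact_operators T -> eigenbasis dot T g lam -> vanishes lam.
Proof.
move=> [_ Tk] [gb TB lam0 E] eps eps0; apply: contrapT => Hn.
have big N : exists j, (N <= j)%N /\ eps <= lam j.
  apply: contrapT => h; apply: Hn; exists N => j Nj; rewrite ltNge.
  by apply/negP => ej; apply: h; exists j.
have [phi Hphi] := choice big.
have ball_n n : closure (T @` [set x | `|x| <= 1]) (T (g (phi n))).
  apply: subset_closure; exists (g (phi n)) => //=.
  rewrite -(@ler_pXn2r _ 2) // ?expr1n ?nnegrE // (norm_sq dotH).
  by rewrite (orthonormal_sq _ gb.1) lecR.
have [y Hy] := compact_seq dotH Tk ball_n.
have e1 : 0 < eps ^+ 2 / 4 by rewrite divr_gt0 // exprn_gt0.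
have [n1 _ h1] := Hy _ 0%N e1; have [n2 n12 h2] := Hy _ (phi n1).+1 e1.
have [n2p l2] := Hphi n2; have [_ l1] := Hphi n1.
(* Orthogonality keeps the squared distance at least [2 * eps ^+ 2], whereas two points this near to
   [y] are within [eps ^+ 2]. *)
have sqT : sq (T (g (phi n1)) - T (g (phi n2))) = lam (phi n1) ^+ 2 + lam (phi n2) ^+ 2.
  rewrite sqDo; last first.
    rewrite -scaleN1r !E !dotZl !dotZr gb.1 ltn_eqF ?mulr0 //.
    exact: leq_trans n12 n2p.
  by rewrite sqN !E !sqZ !(orthonormal_sq _ gb.1) !abs2R !mulr1.
have := sqB_le dot (T (g (phi n1)) - y) (T (g (phi n2)) - y).
rewrite opprB addrA subrK sqT.
have : eps ^+ 2 <= lam (phi n1) ^+ 2 by rewrite ler_pXn2r ?nnegrE // ltW.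
have : eps ^+ 2 <= lam (phi n2) ^+ 2 by rewrite ler_pXn2r ?nnegrE // ltW.
have : 0 < eps ^+ 2 by exact: exprn_gt0.
by move: h1 h2; lra.
Qed.

(** Zorn's lemma gives a maximal orthonormal set [G] of eigenvectors, eigenvalue 0 included; its
    complement is closed and invariant, hence zero. Indexing [G] by [nat] requires it to be
    countably infinite: a finite [G] would be orthogonal to a nonzero combination of finitely many
    [e k], and Bessel's inequality excludes an uncountable one. *)
Lemma spectral_basis e T : orthonormal_basis dot e -> Kplus dot T ->
  exists g lam, eigenbasis dot T g lam.
Proof.
move=> eb TK; have [[TB Tk] [_ Tp]] := TK; have [Tl Tc] := TB.
pose eigv x := sq x = 1 /\ exists2 l : R, 0 <= l & T x = l%:C *: x.
pose P (G : set H) := (forall x, G x -> eigv x) /\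
  (forall x y, G x -> G y -> x <> y -> dot x y = 0).
have [G [[Ge Go] Gmax]] : exists G, P G /\ forall B, G `<` B -> ~ P B.
  apply: Zorn_bigcup => F FP Ftot; split=> [x [X FX Xx]|x y [X FX Xx] [Y FY Yy] xy].
    by have [h _] := FP X FX; exact: h.
  have [XY|YX] := Ftot X Y FX FY.
    by have [_ h] := FP Y FY; apply: h => //; exact: XY.
  by have [_ h] := FP X FX; apply: h => //; exact: YX.
pose W := [set x | forall g, G g -> dot x g = 0].
have Ts := positive_selfadjoint Tl Tp.
have WT x : W x -> W (T x).
  move=> Wx g Gg; have [_ [l _ El]] := Ge g Gg.
  by rewrite Ts El dotZr Wx ?mulr0.
have Wcl : subspace_closed dot W.
  split=> [a x y Wx Wy g Gg|y Hy g Gg].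
    by rewrite dotDl dotZl Wx // Wy // mulr0 addr0.
  apply: abs2_eq0; apply: le_anti; rewrite abs2_ge0 andbT.
  apply: le0_eps => eps eps0; have [x Wx hx] := Hy eps eps0.
  have -> : dot y g = dot (y - x) g by rewrite dotBl (Wx g Gg) subr0.
  apply: le_trans (CauchySchwarz _ _ _) _.
  by have [-> _] := Ge g Gg; rewrite mulr1 sqBC ltW.
have W0 x : W x -> x = 0.
  move=> Wx; apply/eqP/negPn/negP => x0.
  have [z [l [Wz z1 l0 Ez]]] := eigenvector_exists dotH TK Wcl WT Wx x0.
  have Gz : ~ G z.
    by move=> /Wz; rewrite (sqE dot) z1 => /eqP; rewrite oner_eq0.
  apply: (Gmax (G `|` [set z])).
    by split=> [|h]; [exact: subsetUl|apply: Gz; apply: h; right].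
  split=> [y [/Ge //|->]|u v]; first by split=> //; exists l.
  move=> [Gu|->] [Gv|->] uv //; first exact: Go.
    by rewrite dotC Wz // conjc0.
  by rewrite Wz.
have Gon f : injective f -> (forall n : nat, G (f n)) -> orthonormal_seq dot f.
  move=> fi Gf m n; case: eqP => [->|mn]; last by rewrite Go // => /fi.
  by rewrite (sqE dot); have [-> _] := Ge _ (Gf n).
have Ginf : infinite_set G.
  move=> /finite_seqP[s Gs].
  pose A : 'M[R[i]]_(_, _) := \matrix_(k < (size s).+1, j < size s) dot (e k) (nth 0 s j).
  have [u u0 uA] := wide_kernel A (ltnSn _).
  pose x := \sum_(k < (size s).+1) u 0 k *: e k.
  have x0 : x = 0.
    apply: W0 => g; rewrite Gs /= => gs.
    have js : (index g s < size s)%N by rewrite index_mem.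
    have := congr1 (fun B : 'rV_(size s) => B 0 (Ordinal js)) uA; rewrite !mxE => h.
    rewrite -[RHS]h dot_suml; apply: eq_bigr => k _.
    by rewrite dotZl !mxE /= nth_index.
  move/eqP: u0; apply; apply/rowP => k; rewrite mxE.
  have : dot x (e k) = 0 by rewrite x0 dot0l.
  rewrite dot_suml (bigD1 k) //= big1 ?addr0 => [|i ik].
    by rewrite dotZl eb.1 eqxx mulr1.
  by rewrite dotZl eb.1 (_ : (i == k :> nat) = false) ?mulr0 //; apply: negbTE.
have Gcount : countable G.
  (* Level sets of the coordinates along the [e k]: [m.+2] members of level [1 / m.+1] would violate
     Bessel's inequality. *)
  pose B (p : nat * nat) := [set g | G g /\ p.2.+1%:R^-1 <= abs2 (dot (e p.1) g)].
  have GB : G `<=` \bigcup_p B p.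
    move=> g Gg; have [g1 _] := Ge g Gg.
    have [k gk] : exists k, dot g (e k) != 0.
      apply: contrapT => h; have g0 : g = 0.
        apply: (basis_total eb) => n; apply/eqP/negPn/negP => gn; apply: h; by exists n.
      by move: g1; rewrite g0 sq0 => /eqP; rewrite eq_sym oner_eq0.
    have p0 : 0 < abs2 (dot (e k) g).
      rewrite lt_neqAle abs2_ge0 andbT eq_sym; apply: contra gk => /eqP /abs2_eq0 h.
      by rewrite dotC h conjc0.
    exists (k, Num.truncn (abs2 (dot (e k) g))^-1) => //; split=> //=.
    by rewrite invf_ple ?posrE // ltW // truncnS_gt.
  apply: sub_countable (subset_card_le GB) _.
  apply: bigcup_countable => // -[k m] _; apply: finite_set_countable.
  apply: contrapT => /infinite_inj[f fi fB].
  have fo : orthonormal_seq dot f by apply: Gon => // n; have [] := fB n.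
  have := bessel (e k) m.+2 fo; rewrite (orthonormal_sq _ eb.1).
  apply/negP; rewrite -ltNge; apply: (@lt_le_trans _ _ (\sum_(i < m.+2) m.+1%:R^-1)).
    rewrite sumr_const card_ord -[_ *+ m.+2]mulr_natl ltr_pdivlMr // mul1r ltr_nat //.
  by apply: ler_sum => i _; have [_] := fB i.
have [g gi gG] := infinite_enum Gcount Ginf.
have Gg n : G (g n) by rewrite -gG; exists n.
have lamP n : exists l : R, 0 <= l /\ T (g n) = l%:C *: g n.
  by have [_ [l l0 El]] := Ge _ (Gg n); exists l.
have [lam Hlam] := choice lamP.
exists g, lam; split=> //; [|by move=> n; case: (Hlam n)..].
apply: orthonormal_basis_total => //; first exact: Gon.
move=> y yg; apply: W0 => x; rewrite -gG => -[n _ <-]; exact: yg.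
Qed.

End SpectralBasis.

(** * Compactness of diagonal operators *)

Lemma ultra_bounded_near {R : realType} (T : Type) (F : set_system T) (f : T -> R) (M delta : R) :
  UltraFilter F -> F [set y | `|f y| <= M] -> 0 < delta ->
  exists c, F [set y | `|f y - c| < delta].
Proof.
move=> UF FM d0; have PF : ProperFilter F by exact: ultra_proper.
have FfM : (f y @[y --> F]) `[- M, M]%classic.
  change (F (f @^-1` `[- M, M]%classic)); apply: filterS FM => y /= h.
  by rewrite /= in_itv /= -ler_norml.
have [c [_ cl]] := segment_compact _ FfM; exists c.
have [//|Fc] := in_ultra_setVsetC [set y | `|f y - c| < delta] UF; exfalso.
have A : (f y @[y --> F]) [set r | ~ `|r - c| < delta] by [].
have B : nbhs c [set r : R | `|r - c| < delta].
  by apply/nbhs_ballP; exists delta => // r; rewrite -ball_normE /= distrC.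
by have [r [/= h1 h2]] := cl _ _ A B.
Qed.

Section DiagonalCompact.
Context {R : realType} {H : completeNormedModType R[i]} (dot : {dot H for Num.conj}).
Hypothesis dotH : hilbert_dot dot.
Implicit Types (x y z : H) (a : R[i]) (T : H -> H).
Local Notation sq := (sq dot).

Lemma eigen_selfadjoint T g lam : eigenbasis dot T g lam ->
  forall x y, dot (T x) y = dot x (T y).
Proof.
move=> Tg x y; have [gb TB _ E] := Tg; apply: (basis_dot_ext dotH gb TB BH_id) => k.
rewrite E dotZl [RHS]dotC (eigen_coord dotH Tg) (dotC dot (g k)).
by case: (dot y (g k)) => u v; apply/eqP; rewrite eq_complex /=; apply/andP; split; apply/eqP; ring.
Qed.

Lemma sums_to_ge0 (a : nat -> R) l : (forall i, 0 <= a i) -> sums_to a l -> 0 <= l.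
Proof.
move=> a0 al; rewrite leNgt; apply/negP => l0.
have e0 : 0 < - l by rewrite oppr_gt0.
have [N /(_ N (leqnn _))] := al _ e0; rewrite ltr_norml => /andP[_].
have : 0 <= \sum_(i < N) a i by exact: sumr_ge0.
by lra.
Qed.

Lemma eigen_positive T g lam : eigenbasis dot T g lam -> positive_operators dot T.
Proof.
move=> Tg; have [gb TB lam0 E] := Tg; split=> // x.
have Im0 : complex.Im (dot (T x) x) = 0.
  have := dotC dot (T x) x; rewrite -(eigen_selfadjoint Tg).
  by case: (dot (T x) x) => u v [] /= h; lra.
have : 0 <= complex.Re (dot (T x) x).
  apply: sums_to_ge0 (eigen_form_sums dotH Tg x) => k.
  by rewrite mulr_ge0 ?abs2_ge0.
by case: (dot (T x) x) Im0 => u v /= -> u0; rewrite lecE /= eqxx.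
Qed.

Lemma norm_le1 x : (`|x| <= 1) = (sq x <= 1).
Proof.
by rewrite -(@ler_pXn2r _ 2) // ?expr1n ?nnegrE // (norm_sq dotH) lecR.
Qed.

Lemma closure_sq (K : set H) y (eps : R) : closure K y -> 0 < eps ->
  exists2 z, K z & sq (y - z) < eps.
Proof.
move=> Ky eps0; have B : nbhs y [set z | sq (z - y) < eps].
  have := iffLR (cvg_sqP dotH (F := nbhs y) (fun z => z) y) cvg_id; exact.
by have [z [Kz h]] := Ky _ B; exists z => //; rewrite sqBC.
Qed.

(** Along an ultrafilter on the closed image of the ball, finitely many coordinates settle near
    constants, while the others have uniformly small total because their eigenvalues are small; the
    ultrafilter is therefore Cauchy. *)
Lemma eigen_compact T g lam : eigenbasis dot T g lam -> vanishes lam ->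
  compact_operators T.
Proof.
move=> Tg lv; have [gb TB lam0 E] := Tg; split=> //.
have [M M0 TM] := BH_bounded dotH TB.
rewrite compact_ultra => F UF FK; have PF : ProperFilter F by exact: ultra_proper.
set K := closure _ in FK *.
suff [p Fp] : exists p : H, F --> p.
  exists p; split=> //; exact: (closed_cvg K (@closed_closure _ _) FK p Fp).
have KM y : K y -> sq y <= 2 * (M + 1).
  move=> /closure_sq/(_ ltr01)[_ [x /= x1 <-] h].
  have := sqD_le dot (T x) (y - T x); rewrite addrCA subrr addr0.
  by have := TM x; move: x1; rewrite norm_le1; nra.
have Ktail (eps : R) : 0 < eps -> exists N, forall y n, K y ->
    \sum_(i < n) abs2 (dot y (g (N + i)%N)) <= eps.
  move=> eps0; have e4 : 0 < eps / 4 by rewrite divr_gt0.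
  have s4 : 0 < Num.sqrt (eps / 4) by rewrite sqrtr_gt0.
  have [N HN] := lv _ s4; exists N => y n /closure_sq/(_ e4)[_ [x /= x1 <-] h].
  have go : orthonormal_seq dot (fun i => g (N + i)%N) by move=> i j; rewrite gb.1 eqn_add2l.
  apply: (@le_trans _ _ (\sum_(i < n) (2 * (eps / 4 * abs2 (dot x (g (N + i)%N))) +
                                       2 * abs2 (dot (y - T x) (g (N + i)%N))))).
    apply: ler_sum => i _; rewrite -[X in abs2 (dot X _) <= _](subrK (T x) y) (dotDl dot (y - T x)).
    apply: le_trans (abs2D_le _ _) _; rewrite addrC lerD2r ler_pM2l //.
    rewrite (eigen_coord dotH Tg) abs2M abs2R ler_wpM2r ?abs2_ge0 //.
    rewrite -(sqr_sqrtr (ltW e4)) ler_pXn2r ?nnegrE ?(ltW s4) // ltW //.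
    by apply: HN; exact: leq_addr.
  rewrite big_split /= -!mulr_sumr.
  have := bessel (y - T x) n go; have := bessel x n go.
  by move: x1; rewrite norm_le1; nra.
apply/cvg_ex; apply: cauchy_cvg; apply: cauchy_exP => z /gt0_complex[r r0 ->].
have r2 : 0 < r ^+ 2 by exact: exprn_gt0.
(* Tails of [r ^+ 2 / 16] give at most [r ^+ 2 / 4] for a difference; [d] is such that [N]
   coordinates, each contributing at most [8 * d ^+ 2], also stay within [r ^+ 2 / 4]. *)
have e8 : 0 < r ^+ 2 / 16 by rewrite divr_gt0.
have [N HN] := Ktail _ e8.
pose d := Num.sqrt (r ^+ 2 / (32 * N.+1%:R)).
have dd : d ^+ 2 = r ^+ 2 / (32 * N.+1%:R).
  by rewrite sqr_sqrtr // divr_ge0 ?ltW // mulr_gt0.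
have d0 : 0 < d by rewrite sqrtr_gt0 divr_gt0 // mulr_gt0.
have coord (f : H -> R) : (forall y, K y -> `|f y| <= 2 * (M + 1) + 1) ->
    exists c, F [set y | `|f y - c| < d].
  move=> fM; apply: (ultra_bounded_near UF _ d0); apply: filterS FK; exact: fM.
have KRI y k : K y -> complex.Re (dot y (g k)) ^+ 2 <= 2 * (M + 1) /\
    complex.Im (dot y (g k)) ^+ 2 <= 2 * (M + 1).
  move=> /KM yM; have := CauchySchwarz dot y (g k); rewrite (orthonormal_sq _ gb.1) mulr1.
  rewrite /abs2; have := sqr_ge0 (complex.Re (dot y (g k))).
  by have := sqr_ge0 (complex.Im (dot y (g k))); lra.
have sq1 (s B : R) : s ^+ 2 <= B -> `|s| <= B + 1.
  move=> sB; rewrite ler_norml; have := sqr_ge0 (s - 1); have := sqr_ge0 (s + 1).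
  by rewrite !sqrrD sqrrN; lra.
have HRe (k : 'I_N) : exists c, F [set y | `|complex.Re (dot y (g k)) - c| < d].
  by apply: coord => y Ky; apply: sq1; case: (KRI y k Ky).
have HIm (k : 'I_N) : exists c, F [set y | `|complex.Im (dot y (g k)) - c| < d].
  by apply: coord => y Ky; apply: sq1; case: (KRI y k Ky).
have [cr Hcr] := choice HRe; have [ci Hci] := choice HIm.
pose G := K `&` ([set y | forall k : 'I_N, `|complex.Re (dot y (g k)) - cr k| < d] `&`
                 [set y | forall k : 'I_N, `|complex.Im (dot y (g k)) - ci k| < d]).
have FG : F G.
  by apply: filterI => //; apply: filterI; apply: filter_forall.
have [y0 [Ky0 [yr0 yi0]]] := filter_ex FG; exists y0.
apply: filterS FG => y [Ky [yr yi]].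
rewrite -ball_normE /= (norm_lt dotH) //.
apply: (@le_lt_trans _ _ (r ^+ 2 / 2)); last by lra.
have near2 (s t c : R) : `|s - c| < d -> `|t - c| < d -> (s - t) ^+ 2 <= 4 * d ^+ 2.
  rewrite !ltr_norml => /andP[h1 h2] /andP[h3 h4].
  have : 0 <= (2 * d - (s - t)) * (2 * d + (s - t)) by apply: mulr_ge0; lra.
  by rewrite expr2; lra.
apply: (parseval_le dotH gb) => n.
apply: (@le_trans _ _ (\sum_(i < N + n) abs2 (dot (y0 - y) (g i)))).
  by rewrite addnC big_split_ord /= lerDl sumr_ge0 // => i _; exact: abs2_ge0.
rewrite big_split_ord /=.
have part1 : \sum_(i < N) abs2 (dot (y0 - y) (g (lshift n i))) <= r ^+ 2 / 4.
  apply: (@le_trans _ _ (\sum_(i < N) (8 * d ^+ 2))).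
    apply: ler_sum => i _; rewrite dotBl /abs2 /=.
    have := near2 _ _ _ (yr0 i) (yr i); have := near2 _ _ _ (yi0 i) (yi i).
    by case: (dot y0 (g i)) (dot y (g i)) => ? ? [? ?] /=; lra.
  rewrite sumr_const card_ord -[_ *+ N]mulr_natr dd.
  have N1 : N%:R <= N.+1%:R :> R by rewrite ler_nat.
  have N0 : 0 < N.+1%:R :> R by [].
  have -> : 8 * (r ^+ 2 / (32 * N.+1%:R)) * N%:R = r ^+ 2 / 4 * (N%:R / N.+1%:R).
    by field; rewrite gt_eqF.
  by rewrite ler_piMr ?ler_pdivrMr ?mul1r // divr_ge0 // ltW.
have part2 : \sum_(i < n) abs2 (dot (y0 - y) (g (rshift N i))) <= r ^+ 2 / 4.
  apply: (@le_trans _ _ (\sum_(i < n) (2 * abs2 (dot y0 (g (N + i)%N)) +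
                                       2 * abs2 (dot y (g (N + i)%N))))).
    apply: ler_sum => i _; rewrite dotBl; apply: le_trans (abs2D_le _ _) _.
    by rewrite abs2N.
  rewrite big_split /= -!mulr_sumr; have := HN y n Ky; have := HN y0 n Ky0; lra.
by lra.
Qed.

Lemma eigen_Kplus T g lam : eigenbasis dot T g lam -> vanishes lam -> Kplus dot T.
Proof. by move=> Tg lv; split; [exact: eigen_compact Tg lv|exact: eigen_positive Tg]. Qed.

End DiagonalCompact.

(** * Singular sequences and dimensions *)

Section Rearrangement.
Context {R : realType}.
Implicit Types (s lam : nat -> R).

Lemma injective_unbounded (p : nat -> nat) : injective p -> forall N, exists i, (N <= p i)%N.
Proof.
move=> pi N; apply: contrapT => h.
have lt i : (p i < N)%N by rewrite ltnNge; apply/negP => Ni; apply: h; exists i.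
have U : uniq (map p (iota 0 N.+1)) by rewrite map_inj_uniq ?iota_uniq.
have sub : {subset map p (iota 0 N.+1) <= iota 0 N}.
  by move=> _ /mapP[i _ ->]; rewrite mem_iota add0n lt.
by have := uniq_leq_size U sub; rewrite size_map !size_iota ltnn.
Qed.

Lemma infinite_nat_unbounded (A : set nat) : infinite_set A ->
  forall N, exists2 n, (N <= n)%N & A n.
Proof.
move=> /infinite_inj[f fi fA] N; have [i Ni] := injective_unbounded fi N.
by exists (f i).
Qed.

(** Nothing is asked of [p] where [s] vanishes, since a singular sequence does not record how many
    zero eigenvalues there are. *)
Definition rearranges s lam (p : nat -> nat) : Prop :=
  [/\ forall i, 0 < s i -> lam (p i) = s i,
      forall i j, 0 < s i -> 0 < s j -> p i = p j -> i = j &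
      forall j, 0 < lam j -> exists2 i, 0 < s i & p i = j].

Lemma decreasing_rearrangement lam : (forall j, 0 <= lam j) -> vanishes lam ->
  exists p : nat -> nat, [/\ injective p, nonincreasing_seq (lam \o p) &
    forall j, 0 < lam j -> exists i, p i = j].
Proof.
move=> lam0 lv.
have ex (s : seq nat) : exists j, j \notin s /\ forall i, i \notin s -> lam i <= lam j.
  have [|j js jmax] := @exists_max _ lam (fun j => j \notin s) lam0 lv.
    exists (\max_(i <- s) i).+1; apply/negP => h.
    by have := @leq_bigmax_seq _ s xpredT (fun i => i) _ h isT; rewrite ltnn.
  by exists j.
have [next Hnext] := choice ex.
pose ps := fix ps n := if n is m.+1 then next (ps m) :: ps m else [::] : seq nat.
pose p n := next (ps n).
have pin m n : (m < n)%N -> p m \in ps n.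
  elim: n => // n IH; rewrite ltnS leq_eqVlt inE => /orP[/eqP -> |/IH ->].
    by rewrite eqxx.
  by rewrite orbT.
have pi : injective p.
  have lt m n : (m < n)%N -> p m <> p n.
    by move=> /pin mn E; have [] := Hnext (ps n); rewrite -/(p n) -E mn.
  by move=> m n E; have [/lt|/lt|//] := ltngtP m n; rewrite E.
exists p; split=> //.
  apply/nonincreasing_seqP => n /=; have [_] := Hnext (ps n); apply.
  by have [] := Hnext (ps n.+1); rewrite inE negb_or => /andP[_].
move=> j lj; apply: contrapT => h.
have notin n : j \notin ps n.
  elim: n => // n IH; rewrite inE negb_or IH andbT; apply/negP => /eqP E.
  by apply: h; exists n.
have [N HN] := lv _ lj; have [i Ni] := injective_unbounded pi N.
have [_ /(_ j (notin i))] := Hnext (ps i).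
by rewrite leNgt HN.
Qed.

Lemma level_sets_rearrange s lam : (forall j, 0 <= s j) -> (forall j, 0 <= lam j) ->
  (forall l, 0 < l -> ([set j | s j = l] #= [set j | lam j = l])%card) ->
  exists p, rearranges s lam p.
Proof.
move=> s0 lam0 card.
have ex l : exists f : nat -> nat, 0 < l -> set_bij [set j | s j = l] [set j | lam j = l] f.
  have [l0|l0] := ltP 0 l; last by exists id.
  by have /card_set_bijP[f fb] := card l l0; exists f.
have [F HF] := choice ex; exists (fun i => F (s i) i); split.
- by move=> i si; have [fA _ _] := HF _ si; exact: (fA i).
- move=> i j si sj E; have [fA fi _] := HF _ si; have [fA' _ _] := HF _ sj.
  have ss : s i = s j by rewrite -(fA i (erefl _)) E (fA' j).
  apply: fi; rewrite ?inE //= E ss //.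
- move=> j lj; have [_ _ fs] := HF _ lj; have [i /= si E] := fs j (erefl _).
  by exists i; rewrite si.
Qed.

Lemma rearranges_sum s lam p : (forall j, 0 <= s j) -> (forall j, 0 <= lam j) ->
  rearranges s lam p ->
  (\sum_(0 <= j <oo) (s j)%:E = \sum_(0 <= j <oo) (lam j)%:E)%E.
Proof.
move=> s0 lam0 [sp pinj psurj].
have E (t : nat -> R) : (forall j, 0 <= t j) ->
    (\sum_(0 <= j <oo) (t j)%:E = \esum_(j in [set j | (0 < t j)%R]) (t j)%:E)%E.
  move=> t0; rewrite -nneseries_esum; last by move=> j; rewrite lee_fin.
  rewrite [RHS]eseries_mkcond; apply: eq_eseriesr => j _.
  by case: ltP => // tj; congr (_%:E); apply: le_anti; rewrite tj t0.
rewrite !E // (@reindex_esum _ _ _ [set j | 0 < s j] [set j | 0 < lam j] p).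
  by apply: eq_esum => i /= si; rewrite sp.
split.
- by move=> i /= si; rewrite /= sp.
- by move=> i j; rewrite !inE /=; exact: pinj.
- by move=> j /= /psurj[i si <-]; exists i.
Qed.

Lemma rearranges_vanishes s lam p : (forall j, 0 <= s j) -> nonincreasing_seq s ->
  vanishes lam -> rearranges s lam p -> vanishes s.
Proof.
move=> s0 sN lv [sp pinj _] eps eps0.
have [n sn] : exists n, s n < eps.
  apply: contrapT => h; have big n : eps <= s n.
    by rewrite leNgt; apply/negP => sn; apply: h; exists n.
  have pos n : 0 < s n by exact: lt_le_trans (big n).
  have pi : injective p by move=> i j; exact: pinj.
  have [N HN] := lv _ eps0; have [i Ni] := injective_unbounded pi N.
  by have := HN _ Ni; rewrite sp // ltNge big.
by exists n => j nj; apply: le_lt_trans sn; exact: sN.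
Qed.

Lemma rearranges_pos s lam p : nonincreasing_seq s -> rearranges s lam p ->
  infinite_set [set j | 0 < lam j] -> forall i, 0 < s i.
Proof.
move=> sN [sp pinj psurj] inf i; rewrite ltNge; apply/negP => si.
apply: inf; apply: (@sub_finite_set _ _ (p @` `I_i)).
  move=> j /= /psurj[k sk <-]; exists k => //=; rewrite ltnNge; apply/negP => ik.
  by have := le_trans (sN _ _ ik) si; rewrite leNgt sk.
exact/finite_image/finite_II.
Qed.

End Rearrangement.

Section Dimension.
Context {R : realType} {H : completeNormedModType R[i]} (dot : {dot H for Num.conj}).
Hypothesis dotH : hilbert_dot dot.
Implicit Types (x y z : H) (a : R[i]) (T : H -> H) (V : set H).
Local Notation sq := (sq dot).

Lemma has_dim_free V n m (u : 'I_m -> H) : has_dim V n -> (forall i, V (u i)) ->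
  (forall c : 'I_m -> R[i], \sum_i c i *: u i = 0 -> forall i, c i = 0) -> (m <= n)%N.
Proof.
move=> [b [Vb bspan]] Vu free; rewrite leqNgt; apply/negP => nm.
have ex i : exists c : 'I_n -> R[i], u i = \sum_j c j *: b j.
  by have [c [h _]] := bspan _ (Vu i); exists c.
have [C HC] := choice ex.
have [w w0 wA] := wide_kernel (\matrix_(i < m, j < n) C i j) nm.
move/eqP: w0; apply; apply/rowP => i; rewrite mxE.
apply: (free (fun i => w 0 i)).
under eq_bigr => k _ do rewrite HC scaler_sumr.
rewrite exchange_big big1 // => j _.
have := congr1 (fun B : 'rV_n => B 0 j) wA; rewrite !mxE => E.
rewrite -[RHS](scale0r (b j)) -[in RHS]E scaler_suml; apply: eq_bigr => k _.
by rewrite scalerA mxE.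
Qed.

Lemma has_dim_unique V n m : V 0 -> has_dim V n -> has_dim V m -> n = m.
Proof.
move=> V0 Vn Vm; apply/eqP; rewrite eqn_leq.
have free k (b : 'I_k -> H) : (forall x, V x -> exists! c : 'I_k -> R[i], x = \sum_i c i *: b i) ->
    forall c : 'I_k -> R[i], \sum_i c i *: b i = 0 -> forall i, c i = 0.
  move=> /(_ 0 V0)[c0 [_ c0u]] c /esym c1 i.
  have z : 0 = \sum_i (fun=> 0 : R[i]) i *: b i.
    by rewrite big1 // => j _; rewrite scale0r.
  by rewrite -(congr1 (fun f => f i) (c0u _ c1)) (congr1 (fun f => f i) (c0u _ z)).
have [b [Vb bs]] := Vn; have [b' [Vb' bs']] := Vm.
by rewrite (has_dim_free Vm Vb (free _ _ bs)) (has_dim_free Vn Vb' (free _ _ bs')).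
Qed.

Lemma op_eigenspace0 T : linear T -> forall l : R, op_eigenspace T l 0.
Proof. by move=> Tl l; rewrite /op_eigenspace /= (linear_zero Tl) scaler0. Qed.

Lemma kernel_eigenspace T : Defs.kernel T = op_eigenspace T 0.
Proof. by rewrite /Defs.kernel /op_eigenspace; apply/seteqP; split=> x /=; rewrite scale0r. Qed.

Section Eigen.
Variables (T : H -> H) (g : nat -> H) (lam : nat -> R).
Hypothesis Tg : eigenbasis dot T g lam.

Lemma eigenspace_coord (l : R) x k : op_eigenspace T l x -> lam k != l -> dot x (g k) = 0.
Proof.
move=> Ex kl; have := eigen_coord dotH Tg x k; rewrite Ex dotZl => /eqP.
rewrite -subr_eq0 -mulrBl mulf_eq0 => /orP[|/eqP //].
by rewrite subr_eq0 => /eqP /complexI /eqP; rewrite eq_sym (negPf kl).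
Qed.

Lemma eigenspace_dim (l : R) n : ([set j | lam j = l] #= `I_n)%card ->
  has_dim (op_eigenspace T l) n.
Proof.
have [gb [Tl _] _ E] := Tg; rewrite card_eq_sym => /card_set_bijP[f [fA fi fs]].
exists (fun i => g (f i)); split=> [i|x Ex].
  by rewrite /op_eigenspace /= E (fA i) //=; exact: ltn_ord.
have gf (c : 'I_n -> R[i]) (i : 'I_n) : dot (\sum_j c j *: g (f j)) (g (f i)) = c i.
  rewrite dot_suml (bigD1 i) //= dotZl gb.1 eqxx mulr1 big1 ?addr0 // => j ji.
  rewrite dotZl gb.1; case: eqP => [fji|]; rewrite ?mulr0 //; case/eqP: ji.
  by apply: val_inj; apply: fi; rewrite ?inE //=; exact: ltn_ord.
exists (fun i => dot x (g (f i))); split; last first.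
  by move=> c' xc; apply/funext => i; rewrite [in LHS]xc gf.
apply: (coord_ext gb) => k; have [kl|kl] := eqVneq (lam k) l.
  have [i /= iN <-] := fs k kl; exact/esym/(gf _ (Ordinal iN)).
rewrite (eigenspace_coord Ex kl) dot_suml big1 // => i _.
rewrite dotZl gb.1; case: eqP => [fk|]; rewrite ?mulr0 //.
by move: kl; rewrite -fk (fA i) ?eqxx //=; exact: ltn_ord.
Qed.

Lemma finite_dim_kernel : finite_dim (Defs.kernel T) <-> finite_set [set j | lam j = 0].
Proof.
have [gb TB lam0 E] := Tg; rewrite kernel_eigenspace; split; last first.
  by move=> /finite_setP[n /eigenspace_dim h]; exists n.
move=> [n Vn]; apply: contrapT => /infinite_inj[f fi f0].
have Vu (i : 'I_n.+1) : op_eigenspace T 0 (g (f i)).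
  by rewrite /op_eigenspace /= E f0.
have := has_dim_free Vn Vu; rewrite ltnn => h; suff : false by []; apply: h.
move=> c c0 i; have : dot (\sum_j c j *: g (f j)) (g (f i)) = 0 by rewrite c0 dot0l.
rewrite dot_suml (bigD1 i) //= dotZl gb.1 eqxx mulr1 big1 ?addr0 // => j ji.
rewrite dotZl gb.1; case: eqP => [/fi fji|]; rewrite ?mulr0 //; case/eqP: ji.
exact: val_inj.
Qed.

Lemma level_finite (l : R) : vanishes lam -> 0 < l -> finite_set [set j | lam j = l].
Proof.
move=> lv l0; have [N HN] := lv _ l0; apply: sub_finite_set (finite_II N) => j /= jl.
by rewrite ltnNge; apply/negP => /HN; rewrite jl ltxx.
Qed.

Lemma singular_seqP : vanishes lam -> is_singular_seq T (singular_seq T).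
Proof.
move=> lv; have [gb TB lam0 E] := Tg.
have [p [pi pN psurj]] := decreasing_rearrangement lam0 lv.
apply: (@xgetPex _ _ (is_singular_seq T)); exists (lam \o p); split=> //.
  by move=> j /=.
move=> l l0; have /finite_setP[n hn] := level_finite lv l0; exists n.
  exact: eigenspace_dim.
apply: card_eq_trans hn; apply/card_set_bijP; exists p; split=> //.
  by move=> i j _ _; exact: pi.
move=> j /= jl; have [|i pij] := psurj j; first by rewrite jl.
by exists i => //=; rewrite pij.
Qed.

(** Each level set of the singular sequence has the dimension of an eigenspace as its cardinality,
    and that dimension is also the number of [lam j] at this level. *)
Lemma singular_seq_rearranges : vanishes lam ->
  exists p, rearranges (singular_seq T) lam p.
Proof.
move=> lv; have [gb TB lam0 E] := Tg; have [sN s0 slev] := singular_seqP lv.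
apply: level_sets_rearrange => // l l0.
have [n Vn cs] := slev l l0; have /finite_setP[m hm] := level_finite lv l0.
have mn : m = n.
  by apply: has_dim_unique Vn; [exact: op_eigenspace0 TB.1 _|exact: eigenspace_dim].
by apply: card_eq_trans cs _; rewrite card_eq_sym -mn.
Qed.

End Eigen.
End Dimension.

(** * Traces of range projections *)

Section Indicator.
Context {R : realType}.
Implicit Types (P : pred nat).

Lemma count_sum_infinite P : infinite_set [set k | P k] ->
  (\sum_(0 <= k <oo) ((P k)%:R : R)%:E = +oo)%E.
Proof.
move=> iP; have big m : exists N, m%:R <= \sum_(k < N) ((P k)%:R : R).
  elim: m => [|m [N IH]]; first by exists 0%N; rewrite big_ord0.
  have [k Nk Pk] := infinite_nat_unbounded iP N.
  exists k.+1; rewrite big_ord_recr /= Pk -natr1 lerD2r.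
  apply: le_trans IH _; rewrite -(subnKC Nk) big_split_ord /= lerDl.
  by apply: sumr_ge0.
apply/eqyP => M M0; have [N HN] := big (Num.truncn M).+1.
apply: (@le_trans _ _ (\sum_(0 <= k < N) ((P k)%:R : R)%:E)%E); last first.
  by apply: nneseries_lim_ge => n _ _; rewrite lee_fin.
rewrite sumEFin lee_fin big_mkord; apply: le_trans HN; exact/ltW/truncnS_gt.
Qed.

Lemma finite_set_bounded (A : set nat) : finite_set A ->
  exists N, forall k, A k -> (k < N)%N.
Proof.
move=> /finite_seqP[s ->]; exists (\max_(i <- s) i).+1 => k ks.
by rewrite ltnS; exact: (@leq_bigmax_seq _ s xpredT (fun i => i) k ks isT).
Qed.

Lemma count_sum_finite P : finite_set [set k | P k] ->
  (\sum_(0 <= k <oo) ((P k)%:R : R)%:E < +oo)%E.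
Proof.
move=> /finite_set_bounded[N PN].
rewrite (@sums_toE _ _ (\sum_(k < N) ((P k)%:R : R))) ?ltry // => eps eps0.
exists N => n Nn; rewrite -(subnKC Nn) big_split_ord /= [X in _ + X - _]big1; last first.
  move=> i _; case Pk: (P _) => //; have := PN _ Pk.
  by rewrite ltnNge leq_addr.
by rewrite addr0 subrr normr0.
Qed.

End Indicator.

Section Trace.
Context {R : realType} {H : completeNormedModType R[i]} (dot : {dot H for Num.conj}).
Hypothesis dotH : hilbert_dot dot.
Implicit Types (x y z : H) (a : R[i]) (T : H -> H) (V : set H).
Local Notation sq := (sq dot).

(** Basis independence of the trace: the double series has nonnegative terms, so the sum over [n]
    may be taken first, where Parseval gives 1. *)
Lemma trace_eigen e T g mu : orthonormal_basis dot e -> eigenbasis dot T g mu ->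
  (trace dot e T = \sum_(0 <= k <oo) (mu k)%:E)%E.
Proof.
move=> eb Tg; have [gb TB mu0 E] := Tg.
have idg h : orthonormal_basis dot h -> eigenbasis dot (fun x => x) h (fun=> 1).
  by move=> hb; split=> // [|n]; [exact: BH_id|rewrite scale1r].
rewrite /trace (eq_eseriesr (g := fun n =>
  \sum_(0 <= k <oo) (mu k * abs2 (dot (e n) (g k)))%:E)%E); last first.
  move=> n _; rewrite (sums_toE _ (eigen_form_sums dotH Tg (e n))) // => k.
  by rewrite mulr_ge0 ?abs2_ge0.
rewrite nneseries_interchange; last by move=> i j; rewrite lee_fin mulr_ge0 ?abs2_ge0.
apply: eq_eseriesr => k _.
rewrite (eq_eseriesr (g := fun n => (mu k)%:E * (abs2 (dot (g k) (e n)))%:E)%E); last first.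
  by move=> n _; rewrite EFinM dotC abs2_conj.
rewrite nneseriesZl; last by move=> n _; rewrite lee_fin abs2_ge0.
rewrite (sums_toE _ (eigen_sq_sums dotH (idg e eb) (g k))); last by move=> n; exact: abs2_ge0.
by rewrite (orthonormal_sq _ gb.1) mule1.
Qed.

Lemma closure_seq (A : set H) (u : nat -> H) (l : H) : (forall n, A (u n)) ->
  u n @[n --> \oo] --> l -> closure A l.
Proof.
move=> Au ul B /ul; case=> N _ HN; exists (u N); split=> //; exact: HN (leqnn N).
Qed.

Lemma indicator_operator g (P : pred nat) : orthonormal_basis dot g ->
  exists2 Q, eigenbasis dot Q g (fun k => (P k)%:R) &
    forall x k, dot (Q x) (g k) = (P k)%:R * dot x (g k).
Proof.
move=> gb; have c1 k : abs2 ((P k)%:R : R[i]) <= 1.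
  by case: (P k); rewrite ?abs21 ?abs20.
have [Q QB HQ] := coord_operator_BH dotH gb.1 gb c1; exists Q => //; split=> // n.
apply: (coord_ext gb) => k; rewrite HQ dotZl gb.1.
by case: eqP => [->|]; rewrite ?mulr0 // rmorph_nat.
Qed.

Variables (T : H -> H) (g : nat -> H) (lam : nat -> R).
Hypothesis Tg : eigenbasis dot T g lam.

(** The indicator of the positive eigenvalues is an orthogonal projection onto the closed range, and
    such a projection is unique. *)
Lemma range_proj_coord x k :
  dot (range_proj dot T x) (g k) = (0 < lam k)%R%:R * dot x (g k).
Proof.
have [gb TB lam0 E] := Tg; have Tl := TB.1.
have [P _ HP] := indicator_operator (fun k => 0 < lam k)%R gb.
set V := closure (range T).
have PV y : V (P y).
  apply: closure_seq (gb.2 (P y)) => n.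
  (* Preimages under [T] come from dividing each coordinate by its eigenvalue; terms with
     [lam i = 0] vanish. *)
  exists (\sum_(i < n) ((lam i)^-1)%:C * dot (P y) (g i) *: g i) => //.
  rewrite (linear_big _ _ _ Tl); apply: eq_bigr => i _.
  rewrite (linear_scale Tl) E scalerA HP; congr (_ *: _).
  have := lam0 i; rewrite le_eqVlt => /orP[/eqP <-|li].
    by rewrite ltxx mulr0n !mul0r mulr0 ?mul0r.
  by rewrite li mulr1n mul1r mulrAC -rmorphM /= mulVf ?gt_eqF // mul1r.
have Po y z : V z -> dot (y - P y) z = 0.
  move=> Vz; set d := y - P y.
  have Td : T d = 0.
    apply: (coord_ext gb) => j; rewrite (eigen_coord dotH Tg) dotBl HP dot0l.
    have := lam0 j; rewrite le_eqVlt => /orP[/eqP <-|->]; first by rewrite mul0r.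
    by rewrite mulr1n mul1r subrr mulr0.
  apply: abs2_eq0; apply: le_anti; rewrite abs2_ge0 andbT.
  have d1 : 0 < sq d + 1 by rewrite ltr_wpDl // sq_ge0.
  apply: le0_eps => eps eps0.
  have [_ [t _ <-] h] := closure_sq dotH Vz (divr_gt0 eps0 d1).
  have -> : dot d z = dot d (z - T t).
    by rewrite dotBr -(eigen_selfadjoint dotH Tg) Td dot0l subr0.
  apply: le_trans (CauchySchwarz _ _ _) _.
  apply: (@le_trans _ _ ((sq d + 1) * sq (z - T t))).
    by rewrite ler_wpM2r ?sq_ge0 // lerDl.
  by move: h; rewrite ltr_pdivlMr // mulrC => /ltW.
have : is_orth_proj dot V (range_proj dot T).
  by apply: (@xgetPex _ _ (is_orth_proj dot V)); exists P => y; split=> // z; exact: Po.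
move=> /(_ x)[VQ Qo]; rewrite -HP; congr (dot _ _).
apply/eqP; rewrite -subr_eq0; apply/eqP/(@sq_eq0 _ _ dot)/complexI; rewrite -sqE.
set Q := range_proj dot T x in VQ Qo *.
have h z : V z -> dot (Q - P x) z = 0.
  move=> Vz; have -> : Q - P x = (x - P x) - (x - Q) by rewrite opprB [RHS]addrC addrA subrK.
  by rewrite dotBl Po // Qo // subr0.
by rewrite dotBr !h // subr0.
Qed.

Lemma trace_range_proj e : orthonormal_basis dot e ->
  (trace dot e (range_proj dot T) = \sum_(0 <= k <oo) ((0 < lam k)%R%:R : R)%:E)%E.
Proof.
move=> eb; have [gb _ _ _] := Tg.
have [Q Qg HQ] := indicator_operator (fun k => 0 < lam k)%R gb.
rewrite (_ : range_proj dot T = Q); first exact: trace_eigen eb Qg.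
by apply/funext => x; apply: (coord_ext gb) => k; rewrite range_proj_coord HQ.
Qed.

Lemma trace_range_proj_perp e : orthonormal_basis dot e ->
  (trace dot e (range_proj_perp dot T) = \sum_(0 <= k <oo) ((lam k == 0)%R%:R : R)%:E)%E.
Proof.
move=> eb; have [gb _ lam0 _] := Tg.
have [Q Qg HQ] := indicator_operator (fun k => lam k == 0)%R gb.
rewrite (_ : range_proj_perp dot T = Q); first exact: trace_eigen eb Qg.
apply/funext => x; apply: (coord_ext gb) => k.
rewrite /range_proj_perp dotBl range_proj_coord HQ lt_neqAle lam0 andbT eq_sym.
by case: eqP => _ /=; rewrite ?mulr1n ?mulr0n ?mul1r ?mul0r ?subr0 ?subrr.
Qed.

Lemma rank_infinite e : orthonormal_basis dot e ->
  trace dot e (range_proj dot T) = +oo%E -> infinite_set [set j | 0 < lam j].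
Proof.
move=> eb; rewrite trace_range_proj // => h fin.
by have /= := count_sum_finite (R := R) fin; rewrite h ltxx.
Qed.

Lemma kernel_infinite e : orthonormal_basis dot e ->
  trace dot e (range_proj_perp dot T) = +oo%E <-> infinite_set [set j | lam j = 0].
Proof.
move=> eb; rewrite trace_range_proj_perp //.
have -> : [set j | lam j = 0] = [set j | (fun k => lam k == 0)%R j].
  by apply/seteqP; split=> j /= /eqP.
split=> [h fin|]; last exact: count_sum_infinite.
by have /= := count_sum_finite (R := R) fin; rewrite h ltxx.
Qed.

Lemma kernel_finite e : orthonormal_basis dot e ->
  (trace dot e (range_proj_perp dot T) < +oo)%E <-> finite_set [set j | lam j = 0].
Proof.
move=> eb; rewrite ltey; split=> [/eqP h|fin].
  by apply: contrapT => inf; apply: h; exact/(kernel_infinite eb).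
by apply/eqP => /(kernel_infinite eb).
Qed.

End Trace.

(** * Averages with doubly stochastic weights *)

Section DoublyStochastic.
Context {R : realType}.
Implicit Types (F : nat -> R).

Lemma sum_uniq_sub F (r1 r2 : seq nat) : (forall k, 0 <= F k) -> uniq r1 -> uniq r2 ->
  {subset r1 <= r2} -> \sum_(k <- r1) F k <= \sum_(k <- r2) F k.
Proof.
move=> F0 u1 u2 sub.
have P : perm_eq r1 [seq k <- r2 | k \in r1].
  apply: uniq_perm => //; first exact: filter_uniq.
  move=> k; rewrite mem_filter /=; case k1: (k \in r1) => //=; rewrite sub //.
rewrite (perm_big _ P) big_filter /= [leRHS](bigID (fun k => k \in r1)) /= lerDl.
by apply: sumr_ge0.
Qed.

Lemma sum_uniq_le F (r : seq nat) N : (forall k, 0 <= F k) -> uniq r ->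
  (forall k, k \in r -> (k < N)%N) -> \sum_(k <- r) F k <= \sum_(k < N) F k.
Proof.
move=> F0 u sub; rewrite -(big_mkord xpredT F) /index_iota subn0.
by apply: sum_uniq_sub; rewrite ?iota_uniq // => k /sub; rewrite mem_iota.
Qed.

Lemma seq_bounded (r : seq nat) : exists N, forall k, k \in r -> (k < N)%N.
Proof.
exists (\max_(i <- r) i).+1 => k kr.
by rewrite ltnS; exact: (@leq_bigmax_seq _ r xpredT (fun i => i) k kr isT).
Qed.

Lemma sums_to_le (a : nat -> R) l M : sums_to a l -> (forall N, \sum_(i < N) a i <= M) -> l <= M.
Proof.
move=> al aM; apply/ler_addgt0Pr => eps /al[N /(_ N (leqnn N))].
by rewrite ltr_norml; have := aM N; lra.
Qed.

Lemma sums_to_ge (a : nat -> R) l N : (forall i, 0 <= a i) -> sums_to a l ->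
  \sum_(i < N) a i <= l.
Proof.
move=> a0 al; apply/ler_addgt0Pr => eps /al[M HM].
have := HM (maxn M N) (leq_maxl _ _); rewrite ltr_norml => /andP[_].
have : \sum_(i < N) a i <= \sum_(i < maxn M N) a i.
  rewrite -(subnKC (leq_maxr M N)) big_split_ord /= lerDl.
  by apply: sumr_ge0.
by lra.
Qed.

Lemma sums_to_big (I : Type) (r : seq I) (a : I -> nat -> R) (l : I -> R) :
  (forall i, sums_to (a i) (l i)) ->
  sums_to (fun k => \sum_(i <- r) a i k) (\sum_(i <- r) l i).
Proof.
move=> al; elim: r => [|i r IH] eps eps0.
  exists 0%N => n _; rewrite big_nil big1 ?subrr ?normr0 // => k _.
  by rewrite big_nil.
have e2 : 0 < eps / 2 by rewrite divr_gt0.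
have [N1 H1] := al i _ e2; have [N2 H2] := IH _ e2.
exists (maxn N1 N2) => n; rewrite geq_max => /andP[/H1 h1 /H2 h2].
under eq_bigr do rewrite big_cons; rewrite big_split big_cons /=.
rewrite opprD addrACA; apply: le_lt_trans (ler_normD _ _) _.
by rewrite [ltRHS](splitr eps) ltrD.
Qed.

Lemma sums_to_term (a : nat -> R) l : sums_to a l -> vanishes a.
Proof.
move=> al eps eps0; have e2 : 0 < eps / 2 by rewrite divr_gt0.
have [N HN] := al _ e2; exists N => n Nn.
have := HN _ Nn; have := HN _ (leqW Nn); rewrite big_ord_recr /= !ltr_norml.
by move=> /andP[h1 h2] /andP[h3 h4]; lra.
Qed.

Variables (q : nat -> nat -> R) (lam b s sB : nat -> R) (p pB : nat -> nat).
Hypotheses (q0 : forall n j, 0 <= q n j) (qrow : forall n, sums_to (q n) 1).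
Hypothesis qcol : forall j, sums_to (fun n => q n j) 1.
Hypotheses (lam0 : forall j, 0 <= lam j) (lamv : vanishes lam).
Hypothesis qb : forall n, sums_to (fun j => lam j * q n j) (b n).
Hypotheses (sN : nonincreasing_seq s) (s0 : forall j, 0 <= s j) (sp : rearranges s lam p).

Let b0 n : 0 <= b n.
Proof. by apply: sums_to_ge0 (qb n) => j; rewrite mulr_ge0. Qed.

(** Beyond [J] the [lam j] are small and a row has mass 1; the first [J] columns have convergent
    sums, so their entries are small far down. *)
Lemma average_vanishes : vanishes b.
Proof.
move=> eps eps0; have e2 : 0 < eps / 2 by rewrite divr_gt0.
have [J HJ] := lamv e2.
set C := \sum_(j < J) lam j.
have C1 : 0 < C + 1 by rewrite ltr_wpDl // sumr_ge0.
have small N0 : exists N, forall n, (N <= n)%N -> forall j, (j < N0)%N -> q n j < eps / 2 / (C + 1).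
  elim: N0 => [|N0 [N HN]]; first by exists 0%N.
  have [N' HN'] := sums_to_term (qcol N0) (divr_gt0 e2 C1).
  exists (maxn N N') => n; rewrite geq_max => /andP[/HN h /HN' h'] j.
  by rewrite ltnS leq_eqVlt => /orP[/eqP -> //|/h].
have [N HN] := small J; exists N => n Nn.
have h : b n <= C * (eps / 2 / (C + 1)) + eps / 2.
  apply: sums_to_le (qb n) _ => M.
  apply: (@le_trans _ _ (\sum_(j < J + M) lam j * q n j)).
    rewrite addnC big_split_ord /= lerDl; apply: sumr_ge0 => i _; exact: mulr_ge0.
  rewrite big_split_ord /=; apply: lerD.
    rewrite mulr_suml; apply: ler_sum => j _; rewrite ler_wpM2l // ltW //.
    by apply: HN.
  apply: (@le_trans _ _ (\sum_(i < M) (eps / 2 * q n (J + i)%N))).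
    by apply: ler_sum => i _; rewrite ler_wpM2r // ltW // HJ // leq_addr.
  rewrite -mulr_sumr ler_piMr ?(ltW e2) //.
  have := sums_to_ge (J + M) (q0 n) (qrow n); rewrite big_split_ord /=.
  by apply: le_trans; rewrite lerDr; exact: sumr_ge0.
apply: le_lt_trans h _; rewrite {3}(splitr eps) ltrD2r mulrA ltr_pdivrMr //.
by rewrite mulrC ltr_pM2l // ltrDl.
Qed.

(* Bathtub principle, with threshold t = s_m: lam_j c_j <= (lam_j - t) c_j + t c_j. *)
Lemma weighted_sum_le (c : nat -> R) m N :
  (forall j, 0 <= c j <= 1) -> \sum_(j < N | 0 < lam j) c j <= m%:R ->
  \sum_(j < N) lam j * c j <= \sum_(i < m) s i.
Proof.
move=> c01 cm; have [sp1 pinj psurj] := sp; set t := s m.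
(* The term of [j] is charged to the [i < m] with [p i = j]; if there is none, then [lam j <= t] and
   the left side is not positive. *)
have pt j : 0 < lam j -> (lam j - t) * c j <= \sum_(i < m | p i == j) (s i - t).
  move=> lj; have /andP[c0 c1] := c01 j.
  have ge0 (i : 'I_m) : 0 <= s i - t by rewrite subr_ge0; apply: sN; exact: ltnW.
  have [tl|lt] := ltP t (lam j); last first.
    apply: le_trans (_ : 0 <= _); last by apply: sumr_ge0.
    by rewrite mulr_le0_ge0 // subr_le0.
  have [i si pij] := psurj j lj.
  have im : (i < m)%N.
    rewrite ltnNge; apply/negP => /sN; rewrite -/t leNgt.
    by rewrite -sp1 // pij tl.
  rewrite (bigD1 (Ordinal im)) /= ?pij ?eqxx //.
  apply: (@le_trans _ _ (s i - t)); last by rewrite lerDl; exact: sumr_ge0.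
  by rewrite -sp1 // pij ler_piMr // subr_ge0 ltW.
have -> : \sum_(j < N) lam j * c j =
    \sum_(j < N | 0 < lam j) (lam j - t) * c j + t * \sum_(j < N | 0 < lam j) c j.
  rewrite mulr_sumr -big_split /= [RHS]big_mkcond /=; apply: eq_bigr => j _.
  rewrite -mulrDl subrK; case: ltP => // h.
  by rewrite (_ : lam j = 0) ?mul0r //; apply: le_anti; rewrite h lam0.
have -> : \sum_(i < m) s i = \sum_(i < m) (s i - t) + t * m%:R.
  by rewrite sumrB sumr_const card_ord mulr_natr subrK.
apply: lerD; last by rewrite (ler_wpM2l (s0 m)).
apply: (@le_trans _ _ (\sum_(j < N | 0 < lam j) \sum_(i < m | p i == j) (s i - t))).
  by apply: ler_sum => j; exact: pt.
rewrite (exchange_big_dep xpredT) //=; apply: ler_sum => i _.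
have ge0 : 0 <= s i - t by rewrite subr_ge0; apply: sN; exact: ltnW.
rewrite sumr_const -[leRHS]mulr1n ler_wpMn2l //.
apply/card_le1_eqP => j k; rewrite !unfold_in => /andP[_ /eqP jp] /andP[_ /eqP kp].
by apply: val_inj; rewrite /= -jp -kp.
Qed.

(* The rows in r spend at least k of their total mass size r <= m + k on the zeros
   in K, so at most m of it is left for the positive lam_j. *)
Lemma top_sum_le (r K : seq nat) m k : uniq r -> uniq K ->
  (forall j, j \in K -> lam j = 0) -> (size r <= m + k)%N ->
  k%:R <= \sum_(n <- r) \sum_(j <- K) q n j ->
  \sum_(n <- r) b n <= \sum_(i < m) s i.
Proof.
move=> ur uK K0 rm rK; pose c j := \sum_(n <- r) q n j.
have cs : sums_to (fun j => \sum_(n <- r) lam j * q n j) (\sum_(n <- r) b n).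
  exact: sums_to_big.
apply: sums_to_le cs _ => N; under eq_bigr do rewrite -mulr_sumr.
have [N1 HN1] := seq_bounded r; have [N2 HN2] := seq_bounded K.
apply: (@le_trans _ _ (\sum_(j < N2 + N) lam j * c j)).
  rewrite addnC big_split_ord /= lerDl; apply: sumr_ge0 => i _.
  by rewrite mulr_ge0 //; exact: sumr_ge0.
apply: weighted_sum_le => [j|].
  rewrite sumr_ge0 //=; apply: le_trans (sum_uniq_le _ ur HN1) _ => //.
  by apply: sums_to_ge (qcol j).
have Kc : k%:R <= \sum_(j < N2 + N | ~~ (0 < lam j)) c j.
  apply: le_trans rK _; rewrite exchange_big /= -/c.
  rewrite -(big_mkord (fun j => ~~ (0 < lam j)) c) -[leRHS]big_filter.
  apply: (@sum_uniq_sub c) => //; first by move=> j; exact: sumr_ge0.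
    by rewrite filter_uniq // iota_uniq.
  move=> j jK; rewrite mem_filter K0 // ltxx mem_iota /= subn0.
  by apply: leq_trans (HN2 j jK) _; rewrite add0n leq_addr.
have tot : \sum_(j < N2 + N) c j <= (m + k)%:R.
  apply: (@le_trans _ _ ((size r)%:R)); last by rewrite ler_nat.
  rewrite /c exchange_big /= -sum1_size natr_sum; apply: ler_sum => n _.
  exact: sums_to_ge.
move: tot; rewrite (bigID (fun j : 'I_(N2 + N) => 0 < lam j)) /= natrD.
by move: Kc; lra.
Qed.

Hypotheses (sBN : nonincreasing_seq sB) (sB0 : forall j, 0 <= sB j) (sBp : rearranges sB b pB).

Lemma average_majorized : majorized sB s.
Proof.
have [sp1 pinj psurj] := sBp; split=> [n|]; last first.
  rewrite (rearranges_sum sB0 b0 sBp) (rearranges_sum s0 lam0 sp).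
  rewrite (eq_eseriesr (g := fun n => \sum_(0 <= j <oo) (lam j * q n j)%:E)%E); last first.
    by move=> n _; rewrite (sums_toE _ (qb n)) // => j; rewrite mulr_ge0.
  rewrite nneseries_interchange; last by move=> i j; rewrite lee_fin mulr_ge0.
  apply: eq_eseriesr => j _; under eq_eseriesr do rewrite EFinM.
  rewrite nneseriesZl; last by move=> n _; rewrite lee_fin.
  by rewrite (sums_toE _ (qcol j)) ?mule1.
(* Zero terms are dropped because [pB] is unconstrained, hence possibly not injective, there. *)
pose r := [seq pB i | i <- iota 0 n & 0 < sB i].
have ur : uniq r.
  rewrite map_inj_in_uniq ?filter_uniq ?iota_uniq // => i j.
  by rewrite !mem_filter => /andP[si _] /andP[sj _]; exact: pinj.
have -> : \sum_(j < n) sB j = \sum_(k <- r) b k.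
  rewrite big_map big_filter -(big_mkord xpredT sB) /index_iota subn0 [RHS]big_mkcond /=.
  apply: eq_bigr => i _; case: ltP => [/sp1 //|h].
  by apply: le_anti; rewrite h sB0.
apply: (@top_sum_le r [::] n 0) => //.
  by rewrite addn0 size_map size_filter (leq_trans (count_size _ _)) // size_iota.
by apply: sumr_ge0 => k _; rewrite big_nil.
Qed.

Lemma average_oo_majorized : finite_set [set n | b n = 0] ->
  infinite_set [set j | lam j = 0] -> oo_majorized sB s.
Proof.
move=> fb il k; split; first exact: average_majorized.
have [sp1 pinj psurj] := sBp.
have [z Hz] := finite_set_bounded fb.
have [f fi f0] := infinite_inj il.
(* Rows with [b n = 0] have index below [z] and mass at most 1 each, so [k + z] units of column mass
   leave [k] for the positive rows; the extra column covers the truncation error at row [M]. *)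
pose K := map f (iota 0 (k + z).+1).
have uK : uniq K by rewrite map_inj_uniq // iota_uniq.
have K0 j : j \in K -> lam j = 0 by move=> /mapP[i _ ->]; exact: f0.
have Ks : size K = (k + z).+1 by rewrite size_map size_iota.
have KS : sums_to (fun n => \sum_(j <- K) q n j) (size K)%:R.
  rewrite -sum1_size natr_sum; exact: sums_to_big.
have [M HM] := KS 1 ltr01.
have hM : (k + z)%:R <= \sum_(n < M) \sum_(j <- K) q n j.
  have := HM M (leqnn _); rewrite ltr_norml Ks -natr1 => /andP[h _].
  by move: h; lra.
have bpos i : 0 < sB i.
  apply: (rearranges_pos sBN sBp) => fin.
  have [z' Hz'] := finite_set_bounded fin.
  have := Hz' (maxn z z'); have := Hz (maxn z z') => /=.
  have := b0 (maxn z z'); rewrite le_eqVlt => /orP[/eqP <- /(_ erefl)|bp _ /(_ bp)].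
    by rewrite ltnNge leq_maxl.
  by rewrite ltnNge leq_maxr.
have pBi : injective pB by move=> i j; exact: pinj.
(* From length [I0] on, the top rows include all positive rows below [M] and so carry the mass
   [k]. *)
have [I0 HI] : exists I0, forall n, (n < M)%N -> 0 < b n -> exists2 i, (i < I0)%N & pB i = n.
  elim: (M) => [|M' [I0 HI]]; first by exists 0%N.
  have [bM|bM] := ltP 0 (b M'); last first.
    exists I0 => n; rewrite ltnS leq_eqVlt => /orP[/eqP ->|/HI //].
    by rewrite ltNge bM.
  have [i _ pi] := psurj _ bM; exists (maxn I0 i.+1) => n.
  rewrite ltnS leq_eqVlt => /orP[/eqP -> _|nM bn].
    by exists i => //; rewrite leq_max ltnSn orbT.
  have [i' i'I <-] := HI n nM bn; exists i' => //; by rewrite leq_max i'I.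
exists I0 => n In; pose r := map pB (iota 0 (n + k)).
have ur : uniq r by rewrite map_inj_uniq // iota_uniq.
have -> : \sum_(j < n + k) sB j = \sum_(i <- r) b i.
  rewrite big_map -(big_mkord xpredT sB) /index_iota subn0.
  by apply: eq_bigr => i _; rewrite sp1.
apply: (@top_sum_le r K n k) => //; first by rewrite size_map size_iota.
have Q0 i : 0 <= \sum_(j <- K) q i j by exact: sumr_ge0.
have h1 : \sum_(i < M | 0 < b i) \sum_(j <- K) q i j <= \sum_(i <- r) \sum_(j <- K) q i j.
  rewrite -(big_mkord (fun i => 0 < b i) (fun i => \sum_(j <- K) q i j)) -big_filter.
  apply: sum_uniq_sub => //; first by rewrite filter_uniq // iota_uniq.
  move=> i; rewrite mem_filter mem_iota subn0 add0n => /andP[bi /andP[_ iM]].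
  have [i' i'I <-] := HI i iM bi; apply: map_f.
  by rewrite mem_iota add0n /= (leq_trans i'I) // (leq_trans In) // leq_addr.
have h2 : \sum_(i < M | ~~ (0 < b i)) \sum_(j <- K) q i j <= z%:R.
  apply: (@le_trans _ _ (\sum_(i < z) (1 : R))); last first.
    by rewrite sumr_const card_ord.
  apply: (@le_trans _ _ (\sum_(i < z) \sum_(j <- K) q i j)).
    rewrite -(big_mkord (fun i => ~~ (0 < b i)) (fun i => \sum_(j <- K) q i j)) -big_filter.
    apply: sum_uniq_le => //; first by rewrite filter_uniq // iota_uniq.
    move=> i; rewrite mem_filter -leNgt => /andP[bi _]; apply: Hz => /=.
    by apply: le_anti; rewrite bi b0.
  apply: ler_sum => i _.
  have [N2 HN2] := seq_bounded K.
  by apply: le_trans (sum_uniq_le (q0 i) uK HN2) _; apply: sums_to_ge.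
move: hM; rewrite (bigID (fun i : 'I_M => 0 < b i)) /= natrD.
by lra.
Qed.

End DoublyStochastic.

(** * The diagonals of the unitary orbit *)

Section Orbit.
Context {R : realType} {H : completeNormedModType R[i]} (dot : {dot H for Num.conj}).
Hypothesis dotH : hilbert_dot dot.
Implicit Types (x y z : H) (T : H -> H).
Local Notation sq := (sq dot).
Variable e : nat -> H.
Hypothesis eb : orthonormal_basis dot e.

Lemma eigen_form_real T g lam x : eigenbasis dot T g lam ->
  dot (T x) x = (complex.Re (dot (T x) x))%:C.
Proof.
move=> Tg; have [_ Tp] := eigen_positive dotH Tg.
by rewrite RRe_real // ger0_real.
Qed.

Lemma diagonal_Kplus T : (diagonal_operators e `&` Kplus dot) T <->
  exists2 b, eigenbasis dot T e b & vanishes b.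
Proof.
split=> [[[TB Td] TK]|[b Tb bv]].
  have [c Hc] := choice Td.
  have cE n : dot (T (e n)) (e n) = c n by rewrite Hc dotZl eb.1 eqxx mulr1.
  have c0 n : 0 <= c n by rewrite -cE; have [_ [_]] := TK.
  have Te : eigenbasis dot T e (fun n => complex.Re (c n)).
    split=> // n; first by have := c0 n; rewrite lecE => /andP[].
    by rewrite Hc RRe_real // ger0_real.
  exists (fun n => complex.Re (c n)) => //.
  exact: (eigen_vanishes dotH TK.1 Te).
split; last exact: eigen_Kplus Tb bv.
have [_ TB _ E] := Tb; split=> // n; by exists (b n)%:C.
Qed.

Variables (A : H -> H) (g : nat -> H) (lam : nat -> R).
Hypothesis Ag : eigenbasis dot A g lam.

Lemma cond_expP X (b : nat -> R) (M : R) : (forall n, 0 <= b n) -> (forall n, b n ^+ 2 <= M) ->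
  (forall n, dot (X (e n)) (e n) = (b n)%:C) ->
  eigenbasis dot (cond_exp dot e X) e b.
Proof.
move=> b0 bM Xb; set Y := cond_exp dot e X.
have c1 n : abs2 ((b n)%:C : R[i]) <= M by rewrite abs2R.
have [D DB HD] := coord_operator_BH dotH eb.1 eb c1.
have De n : D (e n) = (b n)%:C *: e n.
  apply: (coord_ext eb) => k; rewrite HD dotZl eb.1.
  by case: eqP => [->|]; rewrite ?mulr0.
have [[YB Yd] HY] : [set Y | diagonal_operators e Y /\
    forall n, dot (Y (e n)) (e n) = dot (X (e n)) (e n)] Y.
  apply: xgetPex; exists D; split; last by move=> n; rewrite De dotZl eb.1 eqxx mulr1 Xb.
  by split=> // n; exists (b n)%:C.
split=> // n; have [c Hc] := Yd n.
by have := HY n; rewrite Hc dotZl eb.1 eqxx mulr1 Xb => ->.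
Qed.

Lemma cond_exp_unique X B (b : nat -> R) : eigenbasis dot B e b ->
  (forall n, dot (X (e n)) (e n) = (b n)%:C) -> cond_exp dot e X = B.
Proof.
move=> Be Xb; have [_ BB b0 EB] := Be.
have [[YB Yd] HY] : [set Y | diagonal_operators e Y /\
    forall n, dot (Y (e n)) (e n) = dot (X (e n)) (e n)] (cond_exp dot e X).
  apply: xgetPex; exists B; split; last by move=> n; rewrite EB dotZl eb.1 eqxx mulr1 Xb.
  by split=> // n; exists (b n)%:C.
apply: (operator_basis_ext dotH eb YB BB) => n; rewrite EB; have [c Hc] := Yd n.
by have := HY n; rewrite Hc dotZl eb.1 eqxx mulr1 Xb => ->.
Qed.

(** The diagonal of [U A U^*] in [e] is that of [A] in the basis [U^* e n], and every orthonormal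
    basis arises in this way. *)
Lemma EU_iff B : EU dot e A B <->
  exists h b, [/\ orthonormal_basis dot h, eigenbasis dot B e b &
    forall n, complex.Re (dot (A (h n)) (h n)) = b n].
Proof.
have [gb AB lam0 AE] := Ag; split.
  move=> [X [U [S [[UB SB US UoS SoU] ->]]] <-]; pose h n := S (e n).
  have USx x : U (S x) = x by have := congr1 (fun f => f x) UoS.
  have SUx x : S (U x) = x by have := congr1 (fun f => f x) SoU.
  have ho : orthonormal_seq dot h by move=> m n; rewrite /h -US USx eb.1.
  have hb : orthonormal_basis dot h.
    apply: orthonormal_basis_total => // y yh.
    rewrite -(SUx y) (_ : U y = 0) ?(linear_zero SB.1) //.
    by apply: (basis_total eb) => n; rewrite US yh.
  exists h, (fun n => complex.Re (dot (A (h n)) (h n))); split=> //.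
  have [M M0 HM] := BH_bounded dotH AB.
  apply: (@cond_expP _ _ M) => n.
  - by have [_ Ap] := eigen_positive dotH Ag; have := Ap (h n); rewrite lecE => /andP[].
  - apply: (@le_trans _ _ (abs2 (dot (A (h n)) (h n)))).
      by rewrite /abs2 lerDl sqr_ge0.
    apply: le_trans (CauchySchwarz _ _ _) _; rewrite (orthonormal_sq _ ho) mulr1.
    by apply: le_trans (HM _) _; rewrite (orthonormal_sq _ ho) mulr1.
  - by rewrite /= US -/(h n) (eigen_form_real _ Ag).
move=> [h [b [hb Be Hb]]].
have [U [S [US Se]]] := basis_change_unitary dotH eb hb.
exists (U \o A \o S); first by exists U, S.
apply: cond_exp_unique Be _ => n /=; have [_ _ adj _ _] := US.
by rewrite adj Se (eigen_form_real _ Ag) Hb.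
Qed.

Lemma EU_necessary B : vanishes lam -> EU dot e A B -> exists b,
  [/\ eigenbasis dot B e b, vanishes b,
      majorized (singular_seq B) (singular_seq A) &
      finite_set [set n | b n = 0] -> infinite_set [set j | lam j = 0] ->
      oo_majorized (singular_seq B) (singular_seq A)].
Proof.
move=> lv /EU_iff[h [b [hb Be Hb]]]; exists b; have [gb AB lam0 AE] := Ag.
(* Parseval makes [q] doubly stochastic: rows in the basis [g], columns in the basis [h]. *)
pose q n j := abs2 (dot (h n) (g j)).
have q0 n j : 0 <= q n j by exact: abs2_ge0.
have idf f : orthonormal_basis dot f -> eigenbasis dot (fun x => x) f (fun=> 1).
  by move=> fb; split=> // [|n]; [exact: BH_id|rewrite scale1r].
have qrow n : sums_to (q n) 1.
  by have := eigen_sq_sums dotH (idf g gb) (h n); rewrite (orthonormal_sq _ hb.1).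
have qcol j : sums_to (fun n => q n j) 1.
  have := eigen_sq_sums dotH (idf h hb) (g j); rewrite (orthonormal_sq _ gb.1).
  by congr sums_to; apply/funext => n; rewrite /q dotC abs2_conj.
have qb n : sums_to (fun j => lam j * q n j) (b n).
  by rewrite -Hb; exact: eigen_form_sums.
have bv : vanishes b by exact: (average_vanishes q0 qrow qcol lam0 lv qb).
have [p sp] := singular_seq_rearranges dotH Ag lv.
have [pB sBp] := singular_seq_rearranges dotH Be bv.
have [sN s0 _] := singular_seqP dotH Ag lv.
have [sBN sB0 _] := singular_seqP dotH Be bv.
split=> //.
  exact: (average_majorized q0 qrow qcol lam0 qb sN s0 sp sB0 sBp).
exact: (average_oo_majorized q0 qrow qcol lam0 qb sN s0 sp sBN sB0 sBp).
Qed.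

End Orbit.

(** * Vectors realizing a diagonal *)

(** The squares of the cosine and sine are barycentric weights of [x] between [wa] and [wb]. A
    nonzero sine means that the vector at [b] really enters the mixture; kernel vectors are used up
    through this. *)
Lemma mixing_weights {R : realType} (wa wb x : R) : wb <= x -> x <= wa ->
  exists cs : R * R, [/\ cs.1 ^+ 2 + cs.2 ^+ 2 = 1,
    cs.1 ^+ 2 * wa + cs.2 ^+ 2 * wb = x & x < wa -> cs.2 != 0].
Proof.
move=> bx xa; have [ab|ab] := eqVneq wa wb.
  exists (0, 1); rewrite /= expr0n expr1n add0r mul0r mul1r add0r oner_eq0; split=> //.
  by apply: le_anti; rewrite bx -ab xa.
have d0 : 0 < wa - wb by rewrite subr_gt0 lt_neqAle eq_sym ab (le_trans bx xa).
exists (Num.sqrt ((x - wb) / (wa - wb)), Num.sqrt ((wa - x) / (wa - wb))) => /=.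
rewrite !sqr_sqrtr ?divr_ge0 ?subr_ge0 ?(ltW d0) // ?(le_trans bx xa) //; split.
- by field; rewrite gt_eqF.
- by field; rewrite gt_eqF.
- by move=> xa'; rewrite gt_eqF // sqrtr_gt0 divr_gt0 // subr_gt0.
Qed.

Lemma sum_two_indices {R : realType} (F F' : nat -> R) (a b N : nat) : a != b ->
  (a < N)%N -> (b < N)%N -> (forall j, j != a -> j != b -> F' j = F j) ->
  F' a + F' b = F a + F b -> \sum_(j < N) F' j = \sum_(j < N) F j.
Proof.
move=> ab aN bN FF' E.
have ba : (Ordinal bN != Ordinal aN) by apply: contra ab => /eqP [->].
rewrite (bigD1 (Ordinal aN)) // (bigD1 (Ordinal bN)) //= addrA E.
rewrite [RHS](bigD1 (Ordinal aN)) // (bigD1 (Ordinal bN)) //= addrA; congr (_ + _).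
by apply: eq_bigr => j /andP[ja jb]; apply: FF'.
Qed.

(** A pair orthogonal to [(c1, s1)] is a multiple of [(- s1, c1)]; the factor will be the coordinate
    along the new residual. *)
Lemma rotation_solve (C : comPzRingType) (c1 s1 u v : C) : c1 ^+ 2 + s1 ^+ 2 = 1 ->
  c1 * u + s1 * v = 0 ->
  u = - (s1 * (c1 * v - s1 * u)) /\ v = c1 * (c1 * v - s1 * u).
Proof.
move=> h1 h2; have h3 : s1 * v = - (c1 * u) by apply/eqP; rewrite -addr_eq0 addrC h2.
have h4 : c1 * u = - (s1 * v) by rewrite h3 opprK.
split.
  have -> : - (s1 * (c1 * v - s1 * u)) = s1 ^+ 2 * u - c1 * (s1 * v) by ring.
  by rewrite h3 mulrN opprK mulrA -expr2 -mulrDl addrC h1 mul1r.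
have -> : c1 * (c1 * v - s1 * u) = c1 ^+ 2 * v - s1 * (c1 * u) by ring.
by rewrite h4 mulrN opprK mulrA -expr2 -mulrDl h1 mul1r.
Qed.

Section Vectors.
Context {R : realType} {H : completeNormedModType R[i]} (dot : {dot H for Num.conj}).
Hypothesis dotH : hilbert_dot dot.
Local Notation sq := (sq dot).
Variables (A : H -> H) (g : nat -> H) (lam : nat -> R) (tau : nat -> nat).
Hypotheses (Ag : eigenbasis dot A g lam) (tauI : injective tau).
Variables (xi : nat -> R) (al : nat -> pred nat) (w : nat -> nat -> R) (a b : nat -> nat).
Hypotheses (al0 : forall j, al 0 j) (w0 : forall j, w 0 j = lam (tau j)).
Hypotheses (alS : forall k, al k.+1 = kill (al k) (b k)).
Hypothesis wS : forall k, w k.+1 = upd (w k) (a k) (w k (a k) + w k (b k) - xi k).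
Hypotheses (ala : forall k, al k (a k)) (alb : forall k, al k (b k)) (ab : forall k, a k != b k).
Hypotheses (wb : forall k, w k (b k) <= xi k) (wa : forall k, xi k <= w k (a k)).
Hypotheses (w_ge0 : forall k j, 0 <= w k j) (xi0 : forall k, 0 < xi k).

Let ex_cs k := mixing_weights (wb k) (wa k).
Let cs k : R * R := projT1 (cid (ex_cs k)).
Let c k := (cs k).1.
Let s k := (cs k).2.
Let cs1 k : c k ^+ 2 + s k ^+ 2 = 1.
Proof. by rewrite /c /s /cs; case: cid => ? []. Qed.
Let csx k : c k ^+ 2 * w k (a k) + s k ^+ 2 * w k (b k) = xi k.
Proof. by rewrite /c /s /cs; case: cid => ? []. Qed.
Let s_neq0 k : xi k < w k (a k) -> s k != 0.
Proof. by rewrite /c /s /cs; case: cid => ? []. Qed.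

Fixpoint residual k : nat -> H :=
  if k is m.+1 then
    fun j => if j == a m then (c m)%:C *: residual m (b m) - (s m)%:C *: residual m (a m)
             else residual m j
  else fun j => g (tau j).

Definition new_vector k : H :=
  (c k)%:C *: residual k (a k) + (s k)%:C *: residual k (b k).

Local Notation x := residual.
Local Notation f := new_vector.

Let aliveS k j : al k.+1 j -> al k j /\ j != b k.
Proof. by rewrite alS => /andP[]. Qed.

Lemma residual_ortho k :
  [/\ forall i j, al k i -> al k j -> dot (x k i) (x k j) = (i == j)%:R,
      forall i j, al k i -> al k j -> dot (A (x k i)) (x k j) = (w k i * (i == j)%:R)%:C,
      forall i j, (i < k)%N -> al k j -> dot (f i) (x k j) = 0 &
      forall y j, (forall i, dot (g (tau i)) y = 0) -> al k j -> dot (x k j) y = 0].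
Proof.
have [gb AB lam0 AE] := Ag; have Al := AB.1.
elim: k => [|k [IH1 IH2 IH3 IH4]].
  split=> //= [i j _ _|i j _ _].
    by rewrite gb.1 (inj_eq tauI).
  rewrite AE dotZl gb.1 (inj_eq tauI) w0 rmorphM /=; congr (_ * _).
  by case: (i == j).
have ba : b k != a k by rewrite eq_sym.
have xa : x k.+1 (a k) = (c k)%:C *: x k (b k) - (s k)%:C *: x k (a k).
  by rewrite /= eqxx.
have xj j : j != a k -> x k.+1 j = x k j by move=> /negPf ja; rewrite /= ja.
have wa' : w k.+1 (a k) = w k (a k) + w k (b k) - xi k by rewrite wS /upd eqxx.
have wj j : j != a k -> w k.+1 j = w k j by move=> /negPf ja; rewrite wS /upd ja.
have dxa y : dot (x k.+1 (a k)) y = (c k)%:C * dot (x k (b k)) y - (s k)%:C * dot (x k (a k)) y.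
  by rewrite xa dotBl !dotZl.
have dax y : dot y (x k.+1 (a k)) = (c k)%:C * dot y (x k (b k)) - (s k)%:C * dot y (x k (a k)).
  by rewrite xa dotBr !dotZr !conjc_real.
have dAxa y : dot (A (x k.+1 (a k))) y =
    (c k)%:C * dot (A (x k (b k))) y - (s k)%:C * dot (A (x k (a k))) y.
  by rewrite xa (linear_sub Al) !(linear_scale Al) dotBl !dotZl.
have df y : dot (f k) y = (c k)%:C * dot (x k (a k)) y + (s k)%:C * dot (x k (b k)) y.
  by rewrite /f dotDl !dotZl.
have one : (1 : R[i]) = (c k ^+ 2 + s k ^+ 2)%:C by rewrite cs1.
split.
- move=> i j /aliveS[ai ib] /aliveS[aj jb].
  have [->|ia] := eqVneq i (a k); have [->|ja] := eqVneq j (a k).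
  + rewrite dxa !dax !IH1 // !eqxx (negPf ba) eq_sym (negPf ba).
    by rewrite !mulr1 !mulr0 one rmorphD !rmorphXn /=; ring.
  + by rewrite dxa xj // !IH1 // ![_ == j]eq_sym (negPf ja) (negPf jb) !mulr0 subr0.
  + by rewrite dax xj // !IH1 // (negPf ia) (negPf ib) !mulr0 subr0.
  + by rewrite !xj // IH1.
- move=> i j /aliveS[ai ib] /aliveS[aj jb].
  have [->|ia] := eqVneq i (a k); have [->|ja] := eqVneq j (a k).
  + rewrite dAxa !dax !IH2 // !eqxx (negPf ba) eq_sym (negPf ba) wa' !mulr1 !mulr0.
    rewrite subr0 sub0r mulrN opprK -!rmorphM -rmorphD /= -[in RHS](csx k); congr (_ %:C).
    have := cs1 k; set u := w k (a k); set v := w k (b k) => h.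
    have -> : u + v - (c k ^+ 2 * u + s k ^+ 2 * v) =
              (c k ^+ 2 + s k ^+ 2) * (u + v) - (c k ^+ 2 * u + s k ^+ 2 * v).
      by rewrite h mul1r.
    by ring.
  + by rewrite dAxa xj // !IH2 // ![_ == j]eq_sym (negPf ja) (negPf jb) !mulr0 subr0.
  + by rewrite dax xj // !IH2 // (negPf ia) (negPf ib) !mulr0 subr0.
  + by rewrite !xj // IH2 // wj.
- move=> i j; rewrite ltnS leq_eqVlt => /orP[/eqP -> | ik] /aliveS[aj jb].
    have [->|ja] := eqVneq j (a k).
      by rewrite df !dax !IH1 // !eqxx (negPf ba) eq_sym (negPf ba) !mulr1 !mulr0; ring.
    by rewrite df xj // !IH1 // ![_ == j]eq_sym (negPf ja) (negPf jb) !mulr0 addr0.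
  have [->|ja] := eqVneq j (a k); last by rewrite xj // IH3.
  by rewrite dax !IH3 // !mulr0 subr0.
- move=> y j yg /aliveS[aj jb]; have [->|ja] := eqVneq j (a k); last by rewrite xj // IH4.
  by rewrite dxa !IH4 // !mulr0 subr0.
Qed.

Lemma new_vector_orthonormal : orthonormal_seq dot f.
Proof.
have lt m n : (m < n)%N -> dot (f m) (f n) = 0.
  move=> mn; have [_ _ h _] := residual_ortho n.
  by rewrite /f dotDr !dotZr !h // !mulr0 addr0.
move=> m n; case: (ltngtP m n) => [/lt //|/lt h|->].
  by rewrite dotC h conjc0.
have [h _ _ _] := residual_ortho n.
rewrite /f dotDl !dotDr !dotZl !dotZr !conjc_real !h // !eqxx (negPf (ab n)) eq_sym (negPf (ab n)).
rewrite !mulr1 !mulr0; have -> : (1 : R[i]) = (c n ^+ 2 + s n ^+ 2)%:C by rewrite cs1.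
by rewrite rmorphD !rmorphXn /=; ring.
Qed.

Lemma new_vector_form k : dot (A (f k)) (f k) = (xi k)%:C.
Proof.
have [_ h _ _] := residual_ortho k; have [_ AB _ _] := Ag; have Al := AB.1.
rewrite /f (linear_add Al) !(linear_scale Al) dotDl !dotDr !dotZl !dotZr !conjc_real !h //.
rewrite !eqxx (negPf (ab k)) eq_sym (negPf (ab k)) !mulr1 !mulr0 addr0 add0r.
by rewrite -!rmorphM -rmorphD /= -(csx k); congr (_ %:C); ring.
Qed.

Lemma new_vector_perp k y : (forall i, dot (g (tau i)) y = 0) -> dot (f k) y = 0.
Proof.
by move=> yg; have [_ _ _ h] := residual_ortho k; rewrite /f dotDl !dotZl !h // !mulr0 addr0.
Qed.

Section Completeness.
Variable y : H.
Hypothesis yf : forall k, dot y (f k) = 0.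

Let p k j := abs2 (dot y (x k j)).

Let p_step k : exists2 X : R, p k (a k) = s k ^+ 2 * X &
  p k (b k) = c k ^+ 2 * X /\ p k.+1 (a k) = X.
Proof.
have EX : dot y (x k.+1 (a k)) = (c k)%:C * dot y (x k (b k)) - (s k)%:C * dot y (x k (a k)).
  by rewrite /= eqxx dotBr !dotZr !conjc_real.
have C1 : (c k)%:C ^+ 2 + (s k)%:C ^+ 2 = 1 :> R[i] by rewrite -!rmorphXn -rmorphD /= cs1.
have := yf k; rewrite /f dotDr !dotZr !conjc_real => /(rotation_solve C1)[Eu Ev].
exists (p k.+1 (a k)); last split=> //.
  by rewrite {1}/p Eu abs2N abs2M abs2R /p EX.
by rewrite {1}/p Ev abs2M abs2R /p EX.
Qed.

(* On the orthogonal complement of the vectors already chosen, the form of A is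
   diagonal in the active residual vectors, with the active weights as diagonal. *)
Let weighted_inv k : exists N0, forall N, (N0 <= N)%N ->
  \sum_(j < N) (al k j)%:R * (w k j * p k j) = \sum_(j < N) lam (tau j) * p 0 j.
Proof.
elim: k => [|k [N0 IH]].
  by exists 0%N => N _; apply: eq_bigr => j _; rewrite al0 w0 mul1r.
exists (maxn N0 (maxn (a k).+1 (b k).+1)) => N; rewrite !geq_max => /and3P[/IH <- aN bN].
apply: (@sum_two_indices _ (fun j => (al k j)%:R * (w k j * p k j))
   (fun j => (al k.+1 j)%:R * (w k.+1 j * p k.+1 j)) (a k) (b k)) => //.
  by move=> j /negPf ja jb; rewrite alS wS /kill /upd /p /= ja jb andbT.
have [X -> [-> ->]] := p_step k.
rewrite alS wS /kill /upd eqxx ala alb ab eqxx /= !mul1r mul0r addr0 -(csx k).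
have := cs1 k; set u := w k (a k); set v := w k (b k) => h.
have -> : u + v - (c k ^+ 2 * u + s k ^+ 2 * v) =
          (c k ^+ 2 + s k ^+ 2) * (u + v) - (c k ^+ 2 * u + s k ^+ 2 * v).
  by rewrite h mul1r.
by ring.
Qed.

(** The squared coordinates of [y] at [a] and [b] are handed over to the new residual, since
    [c ^+ 2 + s ^+ 2 = 1]. *)
Let mass_inv k : exists N0, forall N, (N0 <= N)%N ->
  \sum_(j < N) (al k j)%:R * p k j = \sum_(j < N) p 0 j.
Proof.
elim: k => [|k [N0 IH]].
  by exists 0%N => N _; apply: eq_bigr => j _; rewrite al0 mul1r.
exists (maxn N0 (maxn (a k).+1 (b k).+1)) => N; rewrite !geq_max => /and3P[/IH <- aN bN].
apply: (@sum_two_indices _ (fun j => (al k j)%:R * p k j)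
   (fun j => (al k.+1 j)%:R * p k.+1 j) (a k) (b k)) => //.
  by move=> j /negPf ja jb; rewrite alS /kill /p /= ja jb andbT.
have [X -> [-> ->]] := p_step k.
rewrite alS /kill ala alb ab eqxx /= !mul1r mul0r addr0.
by rewrite -mulrDl addrC cs1 mul1r.
Qed.

Hypothesis small : forall eps, 0 < eps -> exists k, forall j, al k j -> w k j <= eps.

Let p_ge0 k j : 0 <= p k j. Proof. exact: abs2_ge0. Qed.

(** The form at [y] can be evaluated at any stage, where it is at most the largest active weight
    times the squared norm of [y]. *)
Let form_zero N : \sum_(j < N) lam (tau j) * p 0 j = 0.
Proof.
have [gb _ lam0 _] := Ag.
apply: le_anti; rewrite sumr_ge0 ?andbT; last by move=> j _; exact: mulr_ge0.
have s1 : 0 < sq y + 1 by rewrite ltr_wpDl // sq_ge0.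
apply: le0_eps => eps eps0; have [k Hk] := small (divr_gt0 eps0 s1).
have [N1 H1] := weighted_inv k; have [N2 H2] := mass_inv k.
set M := (N + maxn N1 N2)%N.
have M1 : (N1 <= M)%N by rewrite (leq_trans (leq_maxl N1 N2)) // leq_addl.
have M2 : (N2 <= M)%N by rewrite (leq_trans (leq_maxr N1 N2)) // leq_addl.
apply: (@le_trans _ _ (\sum_(j < M) lam (tau j) * p 0 j)).
  by rewrite /M big_split_ord /= lerDl sumr_ge0 // => j _; exact: mulr_ge0.
rewrite -H1 //; apply: (@le_trans _ _ (eps / (sq y + 1) * \sum_(j < M) (al k j)%:R * p k j)).
  rewrite mulr_sumr; apply: ler_sum => j _; case E: (al k j); last first.
    by rewrite mulr0n !mul0r mulr0.
  by rewrite mulr1n !mul1r ler_wpM2r // Hk.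
have to : orthonormal_seq dot (fun j => g (tau j)).
  by move=> i j; rewrite gb.1 (inj_eq tauI).
rewrite H2 // mulrAC ler_pdivrMr // ler_pM2l //.
by apply: le_trans (bessel y M to) _; rewrite lerDl.
Qed.

Let alive_zero k j : al k j -> 0 < w k j -> dot y (x k j) = 0.
Proof.
move=> alj wj; apply: abs2_eq0; have [N0 HN] := weighted_inv k.
have := HN (N0 + j.+1)%N (leq_addr _ _); rewrite form_zero => /eqP.
rewrite psumr_eq0; last by move=> i _; rewrite !mulr_ge0.
have jN : (j < N0 + j.+1)%N by rewrite leq_addl.
move=> /allP/(_ (Ordinal jN)); rewrite mem_index_enum => /(_ isT) /=.
by rewrite alj mulr1n mul1r mulf_eq0 gt_eqF //= => /eqP.
Qed.

(** Vectors of positive weight are orthogonal to [y] since the form vanishes. A kernel vector is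
    still unchanged when it is mixed into [f k] with a residual of positive weight; [y] annihilates
    [f k] and that residual, hence the kernel vector, whose coefficient [s k] is nonzero. *)
Lemma new_vector_total : (forall z, lam (tau z) = 0 ->
    exists k, [/\ b k = z, xi k < w k (a k) & forall i, a i != z]) ->
  forall j, dot y (g (tau j)) = 0.
Proof.
move=> kern j; have [_ _ lam0 _] := Ag.
have := lam0 (tau j); rewrite le_eqVlt => /orP[/eqP lj|lj]; last first.
  by apply: (@alive_zero 0) => //; rewrite w0.
have [k [bk xa az]] := kern j (esym lj).
have xz i : x i j = g (tau j).
  by elim: i => //= i IH; rewrite eq_sym (negPf (az i)).
have ya : dot y (x k (a k)) = 0.
  by apply: alive_zero => //; exact: lt_le_trans (xi0 k) (wa k).
have := yf k; rewrite /f dotDr !dotZr ya mulr0 add0r conjc_real bk xz => /eqP.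
rewrite mulf_eq0 => /orP[|/eqP //].
by move=> /eqP /complexI /eqP; rewrite (negPf (s_neq0 xa)).
Qed.

End Completeness.
End Vectors.

(** * Bases realizing a majorized diagonal *)

Section Sufficiency.
Context {R : realType}.

Lemma nneseries_le (a : nat -> R) M : (forall i, 0 <= a i) ->
  (forall n, \sum_(i < n) a i <= M) -> (\sum_(0 <= i <oo) (a i)%:E <= M%:E)%E.
Proof.
move=> a0 aM; apply: lime_le; first by apply: is_cvg_nneseries => n _ _; rewrite lee_fin.
by apply: nearW => n; rewrite sumEFin big_mkord lee_fin.
Qed.

Lemma greedy_pairing (v xi : nat -> R) :
  (forall j, 0 <= v j) -> vanishes v -> (forall N, exists2 j, (N <= j)%N & 0 < v j) ->
  (forall k, 0 < xi k) -> (forall k l, (k <= l)%N -> xi l <= xi k) -> vanishes xi ->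
  dominates xi 0 xpredT v ->
  (forall (J : {fset nat}), ((\sum_(j <- J) v j)%:E <= \sum_(0 <= k <oo) (xi k)%:E)%E) ->
  (forall z, v z = 0 -> forall p, exists N, forall m, (N <= m)%N ->
     fits xpredT v m (tail_sum xi 0 (m + p))) ->
  exists (al : nat -> pred nat) (w : nat -> nat -> R) (a b : nat -> nat),
  [/\ [/\ forall j, al 0 j, forall j, w 0 j = v j, forall k, al k.+1 = kill (al k) (b k) &
          forall k, w k.+1 = upd (w k) (a k) (w k (a k) + w k (b k) - xi k)],
      [/\ forall k, al k (a k), forall k, al k (b k) & forall k, a k != b k],
      [/\ forall k, w k (b k) <= xi k, forall k, xi k <= w k (a k) & forall k j, 0 <= w k j],
      forall eps, 0 < eps -> exists k, forall j, al k j -> w k j <= eps &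
      forall z, v z = 0 -> exists k, [/\ b k = z, xi k < w k (a k) & forall i, a i != z]].
Proof.
move=> v0 vv vpos xi0 xiN xiv dom tot oo.
(* At most [xi k], as a partner weight must be, and summable, as the divergent case demands. *)
pose e k := Num.min (xi k) (2^-1 ^+ k.+1).
have e0 k : 0 < e k by rewrite /e lt_min xi0 exprn_gt0.
have exi k : e k <= xi k by rewrite /e ge_min lexx.
have eC : exists C, forall n, \sum_(i < n) e i <= C.
  exists 1 => n; apply: (@le_trans _ _ (1 - 2^-1 ^+ n)); last by rewrite gerBl exprn_ge0.
  elim: n => [|n IH]; first by rewrite big_ord0 expr0 subrr.
  rewrite big_ord_recr /=; apply: le_trans (lerD IH (_ : _ <= 2^-1 ^+ n.+1)) _.
    by rewrite /e ge_min lexx orbT.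
  by rewrite exprS; lra.
pose st := greedy_state v xi e; pose pk k := greedy_choice xi e k (st k).
have inv k : greedy_inv v xi k (st k) by exact: greedy_stateP.
have G k : greedy xi e k (st k).1 (st k).2 (pk k).1 (pk k).2 by exact: greedy_choiceP (inv k).
exists (fun k => (st k).1), (fun k => (st k).2), (fun k => (pk k).1), (fun k => (pk k).2).
split=> //.
- by split=> k; have [[? ? ?] _ _ _ _] := G k.
- split=> k; first by have [_ _ ? _ _] := G k.
    by have [_ _ _ ? _] := G k.
  by move=> j; have [h _ _ _ _] := inv k; exact: h.
- have [div|] := pselect (forall M, exists n, M < tail_sum xi 0 n).
    exact: (greedy_vanish_divergent v0 vv vpos xi0 xiN xiv e0 exi dom div eC).
  move=> /existsNP[M /forallNP HM].
  have bnd : (\sum_(0 <= k <oo) (xi k)%:E <= M%:E)%E.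
    apply: nneseries_le => [i|n]; first exact: ltW.
    by have := HM n; rewrite /tail_sum => /negP; rewrite -leNgt.
  have ge0 : (0 <= \sum_(0 <= k <oo) (xi k)%:E)%E.
    by apply: nneseries_ge0 => n _ _; rewrite lee_fin ltW.
  move: tot bnd ge0; case E : (\sum_(0 <= k <oo) (xi k)%:E)%E => [V| |] // tot _ _.
  apply: (greedy_vanish_summable v0 vv vpos xi0 xiN e0 exi dom (V := V)) => // eps eps0.
  apply: contrapT => h.
  have : (\sum_(0 <= k <oo) (xi k)%:E <= (V - eps)%:E)%E.
    apply: nneseries_le => [i|n]; first exact: ltW.
    by rewrite leNgt; apply/negP => hn; apply: h; exists n; exact: ltW.
  by rewrite E lee_fin; lra.
- by move=> z vz; apply: (greedy_kernel v0 vv vpos xi0 xiN e0 exi dom (oo z vz) vz).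
Qed.

Context {H : completeNormedModType R[i]} (dot : {dot H for Num.conj}).
Hypothesis dotH : hilbert_dot dot.
Variables (A : H -> H) (g : nat -> H) (lam : nat -> R).
Hypotheses (Ag : eigenbasis dot A g lam) (lv : vanishes lam).
Variables (b : nat -> R) (s sB : nat -> R) (p pB tau sigma : nat -> nat).
Hypotheses (sN : nonincreasing_seq s) (s_pos : forall i, 0 < s i) (sp : rearranges s lam p).
Hypotheses (sBN : nonincreasing_seq sB) (sB_pos : forall i, 0 < sB i) (sBv : vanishes sB).
Hypotheses (sBp : rearranges sB b pB) (b0 : forall n, 0 <= b n).
Hypotheses (tauI : injective tau) (tau_pos : forall j, 0 < lam j -> exists i, tau i = j).
Hypothesis sigmaB : set_bij [set n | b n = 0] (~` range tau) sigma.
Hypothesis maj : majorized sB s.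
Hypothesis kern : forall z, lam (tau z) = 0 -> oo_majorized sB s.

(** [tau] lists the basis vectors that enter the pairing; [sigma] assigns the others, all in the
    kernel, to the zeros of [b]. Since [kern] asks for oo-majorization only when kernel vectors
    enter, both halves of the theorem are instances. *)
Lemma realize_diagonal : exists h, orthonormal_basis dot h /\
  forall n, complex.Re (dot (A (h n)) (h n)) = b n.
Proof.
have [gb AB lam0 AE] := Ag; have [sp1 pinj psurj] := sp; have [sBp1 pBinj pBsurj] := sBp.
pose v j := lam (tau j).
have exp' i : exists j, tau j = p i by apply: tau_pos; rewrite sp1.
have [p' Hp'] := choice exp'.
have p'I : injective p'.
  by move=> i j E; apply: pinj => //; rewrite -!Hp' E.
have vp' i : v (p' i) = s i by rewrite /v Hp' sp1.
have fitsv n V : V <= \sum_(i < n) s i -> fits xpredT v n V.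
  move=> Vs; have u : uniq (map p' (iota 0 n)) by rewrite map_inj_uniq // iota_uniq.
  exists [fset j in map p' (iota 0 n)]%fset; split=> //.
    by rewrite card_fseq undup_id // size_map size_iota.
  apply: le_trans Vs _; rewrite -(big_mkord xpredT s) /index_iota subn0.
  rewrite [leRHS](perm_big (map p' (iota 0 n))) /=.
    by rewrite big_map; apply: ler_sum => i _; rewrite vp'.
  by apply: uniq_perm => //; [exact: fset_uniq|move=> j; rewrite in_fset].
have vv : vanishes v.
  move=> eps /lv[N HN].
  have [M HM] : exists M, forall j, tau j \in iota 0 N -> (j < M)%N.
    apply: (finite_set_bounded (A := [set j | tau j \in iota 0 N])).
    apply: contrapT => /infinite_inj[f fi fN].
    have [i Ni] := injective_unbounded (inj_comp tauI fi) N.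
    by have := fN i; rewrite /= mem_iota add0n /= ltnNge Ni.
  exists M => j Mj; apply: HN; rewrite leqNgt; apply/negP => jN.
  by have := HM j; rewrite mem_iota add0n jN ltnNge Mj => /(_ isT).
have vpos N : exists2 j, (N <= j)%N & 0 < v j.
  by have [i Ni] := injective_unbounded p'I N; exists (p' i) => //; rewrite vp'.
have tsE n : tail_sum sB 0 n = \sum_(i < n) sB i by [].
have dom : dominates sB 0 xpredT v.
  by move=> n; apply: fitsv; rewrite tsE; exact: maj.1.
have tot (J : {fset nat}) : ((\sum_(j <- J) v j)%:E <= \sum_(0 <= k <oo) (sB k)%:E)%E.
  have -> : (\sum_(0 <= k <oo) (sB k)%:E = \sum_(0 <= k <oo) (lam k)%:E)%E.
    by rewrite maj.2; apply: rearranges_sum sp => // j; exact: ltW.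
  have u : uniq (map tau J) by rewrite map_inj_uniq // fset_uniq.
  have [N HN] := seq_bounded (map tau J).
  have := sum_uniq_le lam0 u HN; rewrite big_map => h.
  apply: (@le_trans _ _ (\sum_(0 <= k < N) (lam k)%:E)%E).
    by rewrite sumEFin lee_fin big_mkord.
  by apply: nneseries_lim_ge => n _ _; rewrite lee_fin.
have oo z : v z = 0 -> forall k, exists N, forall m, (N <= m)%N ->
    fits xpredT v m (tail_sum sB 0 (m + k)).
  by move=> /kern/(_ _)oom k; have [_ [N HN]] := oom k; exists N => m /HN; exact: fitsv.
have sBN' k l : (k <= l)%N -> sB l <= sB k by exact: sBN.
have [al [w [a [bb [[al0 w0 alS wS] [ala alb ab] [wb wa w_ge0] small kern']]]]] :=
  greedy_pairing (fun j => lam0 (tau j)) vv vpos sB_pos sBN' sBv dom tot oo.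
pose f := new_vector g tau wb wa.
have fo : orthonormal_seq dot f by exact: (new_vector_orthonormal Ag tauI w0 alS wS ala alb ab).
have fform k : dot (A (f k)) (f k) = (sB k)%:C.
  exact: (new_vector_form Ag tauI w0 alS wS ala alb ab).
have sig n : b n = 0 -> ~ range tau (sigma n) by have [h _ _] := sigmaB; exact: h.
have fsig k n : b n = 0 -> dot (f k) (g (sigma n)) = 0.
  move=> bn; apply: (new_vector_perp Ag tauI w0 alS wS ala alb ab) => i.
  rewrite gb.1; case: eqP => // E; exfalso; apply: (sig n bn); by exists i.
have lamsig n : b n = 0 -> lam (sigma n) = 0.
  move=> bn; apply: le_anti; rewrite lam0 andbT leNgt; apply/negP => /tau_pos[i E].
  by apply: (sig n bn); exists i.
have exi n : exists i, b n != 0 -> pB i = n.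
  have := b0 n; rewrite le_eqVlt => /orP[/eqP <-|/pBsurj[i _ pi]]; last by exists i.
  by exists 0%N; rewrite eqxx.
have [iota' Hiota] := choice exi.
pose h n := if b n == 0 then g (sigma n) else f (iota' n).
have ho : orthonormal_seq dot h.
  move=> m n; rewrite /h; case: (eqVneq (b m) 0) => bm; case: (eqVneq (b n) 0) => bn.
  - rewrite gb.1; congr (_%:R); congr (nat_of_bool _); apply/eqP/eqP => [|-> //].
    by have [_ si _] := sigmaB; apply: si; rewrite inE.
  - rewrite dotC fsig // conjc0; case: eqP => // mn; by rewrite -mn bm eqxx in bn.
  - rewrite fsig //; case: eqP => // mn; by rewrite mn bn eqxx in bm.
  - rewrite fo; congr (_%:R); congr (nat_of_bool _); apply/eqP/eqP => [E|-> //].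
    by rewrite -(Hiota m bm) -(Hiota n bn) E.
exists h; split; last first.
  move=> n; rewrite /h; case: eqVneq => bn.
    by rewrite AE lamsig // scale0r dot0l bn.
  by rewrite fform /= -(sBp1 _ (sB_pos _)) Hiota.
apply: orthonormal_basis_total => // y yh; apply: (basis_total gb) => m.
have ysig n : b n = 0 -> dot y (g (sigma n)) = 0.
  by move=> bn; have := yh n; rewrite /h bn eqxx.
have yf k : dot y (f k) = 0.
  have := yh (pB k); rewrite /h sBp1 // gt_eqF //.
  have -> // : iota' (pB k) = k.
  by apply: pBinj => //; apply: Hiota; rewrite sBp1 // gt_eqF.
have [[i _ <-]|mt] := pselect (range tau m).
  exact: (new_vector_total Ag tauI al0 w0 alS wS ala alb ab w_ge0 sB_pos yf small kern').
by have [_ _ /(_ m mt)[n bn <-]] := sigmaB; exact: ysig.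
Qed.

End Sufficiency.

Lemma set_bij_exists (A B : set nat) : (A #= B)%card -> exists f, set_bij A B f.
Proof. by move=> /card_set_bijP. Qed.

Lemma infinite_nat_card (A B : set nat) : infinite_set A -> infinite_set B -> (A #= B)%card.
Proof.
move=> iA iB; have cA : countable A by exact: countableP.
have cB : countable B by exact: countableP.
by apply: card_eq_trans (eq_card_nat cA iA) _; rewrite card_eq_sym; exact: eq_card_nat.
Qed.

Theorem corollary3p5 (R : realType) (H : completeNormedModType R[i])
    (dot : {dot H for Num.conj}) (e : nat -> H)
    (dotH : hilbert_dot dot) (eH : orthonormal_basis dot e)
    (A : H -> H) (AK : Kplus dot A)
    (rankA : trace dot e (range_proj dot A) = +oo%E)
    (kerA : trace dot e (range_proj_perp dot A) = +oo%E) :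
  [/\ EU dot e A = EU_fk dot e A `|` EU_ik dot e A,
      EU_fk dot e A `&` EU_ik dot e A = set0,
      EU_fk dot e A =
        [set B | [/\ (diagonal_operators e `&` Kplus dot) B,
                     oo_majorized (singular_seq B) (singular_seq A) &
                     (trace dot e (range_proj_perp dot B) < +oo)%E]] &
      EU_ik dot e A =
        [set B | [/\ (diagonal_operators e `&` Kplus dot) B,
                     majorized (singular_seq B) (singular_seq A) &
                     trace dot e (range_proj_perp dot B) = +oo%E]]].
Proof.
have [g [lam Ag]] := spectral_basis dotH eH AK.
have lv := eigen_vanishes dotH AK.1 Ag; have [gb AB lam0 AE] := Ag.
have rank_inf : infinite_set [set j | 0 < lam j] := rank_infinite dotH Ag eH rankA.
have ker_inf : infinite_set [set j | lam j = 0] by exact/(kernel_infinite dotH Ag eH).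
have [p sp] := singular_seq_rearranges dotH Ag lv.
have [sN s0 _] := singular_seqP dotH Ag lv.
have s_pos := rearranges_pos sN sp rank_inf.
have [sp1 pinj psurj] := sp.
split.
- apply/seteqP; split=> [B EB|B [[]|[]] //].
  by have [fk|fk] := pselect (finite_dim (Defs.kernel B)); [left|right].
- by apply/seteqP; split=> [B [[_ fk] [_ ik]]|].
- apply/seteqP; split=> [B [EB fk]|B [DK oom fin]].
    have [b [Be bv maj oom]] := EU_necessary dotH eH Ag lv EB.
    have fb : finite_set [set n | b n = 0] by exact/(finite_dim_kernel dotH Be).
    split; last exact/(kernel_finite dotH Be eH).
      by apply/(diagonal_Kplus dotH eH); exists b.
    exact: oom.
  have [b Be bv] := iffLR (diagonal_Kplus dotH eH B) DK.
  have [_ BB b0 BE] := Be.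
  have fb : finite_set [set n | b n = 0] by exact/(kernel_finite dotH Be eH).
  split; last exact/(finite_dim_kernel dotH Be).
  have [pB sBp] := singular_seq_rearranges dotH Be bv.
  have [sBN sB0 _] := singular_seqP dotH Be bv.
  have b_inf : infinite_set [set n | 0 < b n].
    move=> fb'; apply: infinite_nat.
    have fU : finite_set ([set n | b n = 0] `|` [set n | 0 < b n]) by rewrite finite_setU.
    apply: sub_finite_set fU => n _.
    by have := b0 n; rewrite le_eqVlt => /orP[/eqP/esym bn|bn]; [left|right].
  have sB_pos := rearranges_pos sBN sBp b_inf.
  have sBv := rearranges_vanishes sB0 sBN bv sBp.
  have [f fi f0] := infinite_inj ker_inf.
  have /finite_setP[n bn] := fb.
  (* As many kernel vectors as [b] has zeros are set aside; all other basis vectors, infinitely many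
     kernel vectors among them, enter the pairing. *)
  pose F : set nat := f @` `I_n.
  have FC_inf : infinite_set (~` F).
    rewrite -setTD; apply: infinite_setD; first exact: infinite_nat.
    exact/finite_image/finite_II.
  have FC_count : countable (~` F) by exact: countableP.
  have [tau tauI tauF] := infinite_enum FC_count FC_inf.
  have [sigma sigmaB] : exists sigma, set_bij [set n | b n = 0] (~` range tau) sigma.
    rewrite tauF setCK; apply: set_bij_exists; apply: card_eq_trans bn _.
    by rewrite card_eq_sym; apply: inj_card_eq => i j _ _; exact: fi.
  have [h [hb hform]] : exists h, orthonormal_basis dot h /\
      forall n, complex.Re (dot (A (h n)) (h n)) = b n.
    apply: (realize_diagonal dotH Ag lv s_pos sp sBN sB_pos sBv sBp b0 tauI _ sigmaB).
    - move=> j lj; have : (~` F) j by move=> [i _ E]; move: lj; rewrite -E f0 ltxx.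
      by rewrite -tauF => -[i _ <-]; exists i.
    - by have [] := oom 0%N.
    - by move=> _ _; exact: oom.
  by apply/(EU_iff dotH eH Ag); exists h, b.
- apply/seteqP; split=> [B [EB ik]|B [DK maj inf]].
    have [b [Be bv maj oom]] := EU_necessary dotH eH Ag lv EB.
    split=> //; first by apply/(diagonal_Kplus dotH eH); exists b.
    by apply/(kernel_infinite dotH Be eH) => fb; apply/ik/(finite_dim_kernel dotH Be).
  have [b Be bv] := iffLR (diagonal_Kplus dotH eH B) DK.
  have [_ BB b0 BE] := Be.
  have ib : infinite_set [set n | b n = 0] by exact/(kernel_infinite dotH Be eH).
  split; last by move=> /(finite_dim_kernel dotH Be).
  have [pB sBp] := singular_seq_rearranges dotH Be bv.
  have [sBN sB0 _] := singular_seqP dotH Be bv.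
  (* If [singular_seq B] vanished from [i] on, its total would be its [i]-th partial sum, hence at
     most that of [singular_seq A], which is strictly below the common total. *)
  have sB_pos i : 0 < singular_seq B i.
    rewrite lt_neqAle sB0 andbT eq_sym; apply/negP => /eqP si.
    have z j : (i <= j)%N -> singular_seq B j = 0.
      by move=> ij; apply: le_anti; rewrite sB0 andbT -si; exact: sBN.
    have := maj.2; rewrite (@sums_toE _ _ (\sum_(j < i) singular_seq B j)) // => [E|eps eps0].
      have := @nneseries_lim_ge _ (fun j => (singular_seq A j)%:E) xpredT 0 i.+1.
      rewrite -E sumEFin lee_fin big_mkord big_ord_recr /= => h.
      have : \sum_(j < i) singular_seq A j + singular_seq A i <= \sum_(j < i) singular_seq B j.
        by apply: h => j _ _; rewrite lee_fin.
      by have := maj.1 i; have := s_pos i; lra.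
    exists i => j ij; rewrite -(subnKC ij) big_split_ord /= [X in _ + X - _]big1.
      by rewrite addr0 subrr normr0.
    by move=> k _; apply: z; exact: leq_addr.
  have sBv := rearranges_vanishes sB0 sBN bv sBp.
  have pI : injective p by move=> i j; exact: pinj.
  (* With [p] as [tau], only positive eigenvalues enter the pairing, and the whole kernel is left
     for the infinitely many zeros of [b]. *)
  have pR : ~` range p = [set j | lam j = 0].
    apply/seteqP; split=> j /=.
      move=> h; apply: le_anti; rewrite lam0 andbT leNgt; apply/negP => /psurj[i _ E].
      by apply: h; exists i.
    by move=> lj [i _ E]; have := s_pos i; rewrite -sp1 // E lj ltxx.
  have [sigma sigmaB] : exists sigma, set_bij [set n | b n = 0] (~` range p) sigma.
    by rewrite pR; apply: set_bij_exists; exact: infinite_nat_card.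
  have [h [hb hform]] : exists h, orthonormal_basis dot h /\
      forall n, complex.Re (dot (A (h n)) (h n)) = b n.
    apply: (realize_diagonal dotH Ag lv s_pos sp sBN sB_pos sBv sBp b0 pI _ sigmaB maj).
    - by move=> j /psurj[i _ <-]; exists i.
    - by move=> z; rewrite sp1 // => sz; have := s_pos z; rewrite sz ltxx.
  by apply/(EU_iff dotH eH Ag); exists h, b.
Qed.
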